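(* Let $\mathcal{G}$ be the generic structure for the class of all finite flat pregeometries with respect to $\sqsubseteq$. There exists a function $\tau:\mathbb{N}\to\mathbb{N}$ with $\tau(n)\ge n$ for all $n$ such that $\mathcal{G}\models T_\tau$. In particular, $T_\tau$ is satisfiable.
   Context: Pregeometries. A pregeometry $G$ on a (possibly infinite) set $M$ is a function $d=d_G$ from the finite subsets of $M$ to $\mathbb{N}$ such that $d(\emptyset)=0$, $d(A)\le d(A\cup\{x\})\le d(A)+1$, and $d(A\cup B)+d(A\cap B)\le d(A)+d(B)$. A finite $A$ is independent if $d(A)=|A|$; an arbitrary set is independent if all its finite subsets are; $d(Y)=\sup\{|Y_0|: Y_0\subseteq Y \text{ independent}\}$. For finite $A$, $\mathrm{cl}_G(A)=\{x: d(A\cup\{x\})=d(A)\}$, and $\mathrm{cl}_G(Y)=\bigcup\{\mathrm{cl}_G(Y_0): Y_0\subseteq Y\text{ finite}\}$. $Y$ is closed in $G$ if $\mathrm{cl}_G(Y)=Y$. A subpregeometry $H\subseteq G$ is the restriction of $d_G$ to subsets of a subset; subsets and subpregeometries are identified. For a finite collection $\Sigma=\{E_1,\dots,E_k\}$ of finite-dimensional closed sets of $G$ let $\Delta_G(\Sigma)=\sum_{\emptyset\ne s\subseteq\{1,\dots,k\}}(-1)^{|s|+1}d_G\left(\bigcap_{i\in s}E_i\right)$. $G$ is flat if $\Delta_G(\Sigma)\ge d_G(\bigcup\Sigma)$ for every such $\Sigma$. Embeddings. For $H\subseteq G$: $H\sqsubseteq^* G$ means $d_H(X_1\cap X_2)=d_G(\mathrm{cl}_G(X_1)\cap\mathrm{cl}_G(X_2))$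 for all $X_1,X_2$ closed in $H$. $H\sqsubseteq G$ means that for every finite collection $\Sigma$ of finite-dimensional closed sets of $G$, $\Delta_H(\{E\cap H: E\in\Sigma\})\le\Delta_G(\Sigma)$. $X\sqsubseteq^n G$ means: $X\sqsubseteq^* G$ and $X\sqsubseteq Y$ for every $Y$ with $X\subseteq Y\sqsubseteq^* G$ and $|Y\setminus X|\le n$. Language and theory. Pregeometries are structures in the language $\mathcal{L}=\{I_n:n\in\omega\}$, $I_n$ an $n$-ary relation symbol interpreted as the set of independent $n$-tuples. $\mathfrak{C}$ is the class of all finite flat pregeometries. For $\tau:\mathbb{N}\to\mathbb{N}$ with $\tau(n)\ge n$, $T_\tau$ is the $\mathcal{L}$-theory stating of the ambient structure $G$: (T1) $G$ is a flat pregeometry; (T2) $G$ is infinite-dimensional; (T3) for all finite $F\sqsubseteq^* G$, all $H\in\mathfrak{C}$ with $F\sqsubseteq H$, and all $n\in\mathbb{N}$: if $F\sqsubseteq^{\tau(|H|+n)}G$ then there is an embedding $f:H\to G$ fixing $F$ pointwise with $f[H]\sqsubseteq^n G$. Generic structure. $\mathcal{G}$ is the countable pregeometry, unique up to isomorphism, such that: (i) up to isomorphism, the finite $A\sqsubseteq\mathcal{G}$ are exactly the members of $\mathfrak{C}$; (ii) whenever $A\sqsubseteq\mathcal{G}$ is finite and $A\sqsubseteq B\in\mathfrak{C}$, there is an embedding $f:B\to\mathcal{G}$ fixing $A$ pointwise with $f[B]\sqsubseteq\mathcal{G}$; (iii) every finite subset of $\mathcal{G}$ is contained in a finite $A\sqsubseteq\mathcal{G}$.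 *)

(* Defs.v *)
From HB Require Import structures.
From mathcomp Require Import all_boot all_order all_algebra.
From mathcomp Require Import finmap mathcomp_extra boolp classical_sets.
From mathcomp Require Import functions cardinality.

Set Implicit Arguments.
Unset Strict Implicit.
Unset Printing Implicit Defensive.

Import Order.TTheory GRing.Theory Num.Theory.

Local Open Scope classical_set_scope.
Local Open Scope card_scope.

Record pregeom (M : choiceType) := Pregeom {
  dim :> {fset M} -> nat;
  dim_fset0 : dim fset0 = 0;
  dim_fsetU1 : forall (A : {fset M}) (x : M),
    dim A <= dim (x |` A)%fset <= (dim A).+1;
  dim_submod : forall A B : {fset M},
    dim (A `|` B)%fset + dim (A `&` B)%fset <= dim A + dim B }.

Section Pregeometry.
Variables (M : choiceType) (G : pregeom M).
Implicit Types (A : {fset M}) (X Y : set M).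

Definition indep A : Prop := G A = #|` A|.

Definition indep_sizes Y : set nat :=
  [set n | exists A, [/\ [set` A] `<=` Y, indep A & #|` A| = n]].

Definition findim Y : Prop := has_ubound (indep_sizes Y).

(* Meaningful only when [findim Y]: otherwise there is no supremum in nat and
   the value is 0. *)
Definition dimS Y : nat := supremum 0 (indep_sizes Y).

(* The dimension in nat extended with infinity; None stands for infinity. *)
Definition dimx Y : option nat := if `[< findim Y >] then Some (dimS Y) else None.

Definition cl_fin A : set M := [set x | G (x |` A)%fset = G A].

Definition cl Y : set M := \bigcup_(A in [set A | [set` A] `<=` Y]) cl_fin A.

Definition closed Y : Prop := cl Y = Y.

(* Collections {E_1, ..., E_k} are indexed families.  Repetitions are harmless:
   the alternating sum only depends on the set of members of the family. *)
Definition Delta (k : nat) (E : 'I_k -> set M) : int :=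
  (\sum_(s : {set 'I_k} | s != finset.set0)
     (-1) ^+ (#|s|.+1) * (dimS (\bigcap_(i in [set` s]) E i))%:Z)%R.

Definition findim_closed (k : nat) (E : 'I_k -> set M) : Prop :=
  forall i, closed (E i) /\ findim (E i).

Definition flat : Prop :=
  forall (k : nat) (E : 'I_k -> set M), findim_closed E ->
    ((dimS (\bigcup_i E i))%:Z <= Delta E)%R.

Section Sub.
Variable X : set M.

Definition up (A : {fset X}) : {fset M} := [fset val x | x in A]%fset.

Lemma up0 : G (up fset0) = 0.
Proof. by rewrite /up imfset0 dim_fset0. Qed.

Lemma upU1 (A : {fset X}) (x : X) :
  G (up A) <= G (up (x |` A)%fset) <= (G (up A)).+1.
Proof.
have -> : up (x |` A)%fset = (val x |` up A)%fset by rewrite /up imfsetU1.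
exact: dim_fsetU1.
Qed.

Lemma up_submod (A B : {fset X}) :
  G (up (A `|` B)%fset) + G (up (A `&` B)%fset) <= G (up A) + G (up B).
Proof.
have -> : up (A `|` B)%fset = (up A `|` up B)%fset by rewrite /up imfsetU.
have -> : up (A `&` B)%fset = (up A `&` up B)%fset.
  by rewrite /up imfsetI // => ? ? _ _; apply: val_inj.
exact: dim_submod.
Qed.

(* The subpregeometry on X; its carrier is the subtype of elements of X. *)
Definition subgeom : pregeom X := Pregeom up0 upU1 up_submod.

End Sub.
End Pregeometry.

Section Embeddings.
Variables (M : choiceType) (G : pregeom M).
Implicit Types (X Y : set M).

Definition sqsub_star X : Prop :=
  forall X1 X2 : set X,
    closed (subgeom G X) X1 -> closed (subgeom G X) X2 ->
    dimx (subgeom G X) (X1 `&` X2)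
      = dimx G (cl G (val @` X1) `&` cl G (val @` X2)).

(* The trace of E on X, as a set of elements of the carrier of [subgeom G X],
   is the preimage of E under val. *)
Definition sqsub X : Prop :=
  forall (k : nat) (E : 'I_k -> set M), findim_closed G E ->
    (Delta (subgeom G X) (fun i => val @^-1` E i) <= Delta G E)%R.

End Embeddings.

Definition sqsub_n (M : choiceType) (G : pregeom M) (n : nat) (X : set M) : Prop :=
  sqsub_star G X /\
  forall Y : set M, X `<=` Y -> sqsub_star G Y -> Y `\` X #<= `I_n ->
    sqsub (subgeom G Y) (val @^-1` X).

Definition embedding (M N : choiceType) (H : pregeom N) (G : pregeom M)
    (f : N -> M) : Prop :=
  injective f /\ forall A : {fset N}, G [fset f x | x in A]%fset = H A.

Record Lstructure (M : Type) := LStructure {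
  rel_I : forall n : nat, n.-tuple M -> Prop }.

(* I_n holds of the tuples with distinct entries that form an independent set. *)
Definition Lstruct_of (M : choiceType) (G : pregeom M) : Lstructure M :=
  LStructure (fun n (t : n.-tuple M) => uniq t /\ indep G [fset x in tval t]%fset).

Definition interprets (M : choiceType) (G : pregeom M) (S : Lstructure M) : Prop :=
  forall (n : nat) (t : n.-tuple M), rel_I S t <-> rel_I (Lstruct_of G) t.

(* A finite pregeometry H extending the finite subpregeometry F of G is given up
   to isomorphism over F: by an embedding i of F into a pregeometry H on a
   finType.  "Fixing F pointwise" then reads f (i x) = x. *)
Definition T3 (tau : nat -> nat) (M : choiceType) (G : pregeom M) : Prop :=
  forall F : set M, finite_set F -> sqsub_star G F ->
  forall (N : finType) (H : pregeom N) (i : F -> N),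
    flat H -> embedding (subgeom G F) H i -> sqsub H (range i) ->
  forall n : nat, sqsub_n G (tau (#|N| + n)) F ->
  exists f : N -> M,
    [/\ embedding H G f, forall x : F, f (i x) = val x & sqsub_n G n (range f)].

(* The theory T_tau is given by its models: S is the structure of independent
   tuples of a pregeometry satisfying its three axioms.  That pregeometry is
   determined by S, since dim A is the largest size of an independent subset. *)
Definition models_T (tau : nat -> nat) (M : choiceType) (S : Lstructure M) : Prop :=
  exists G : pregeom M,
    [/\ interprets G S, flat G, ~ findim G [set: M] & T3 tau G].

Definition satisfiable_T (tau : nat -> nat) : Prop :=
  exists (M : choiceType) (S : Lstructure M), models_T tau S.

Record generic (M : choiceType) (G : pregeom M) : Prop := Generic {
  generic_countable : countable [set: M];
  generic_age : forall A : set M, finite_set A -> sqsub G A ->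
    exists (N : finType) (H : pregeom N) (f : N -> M),
      [/\ flat H, embedding H G f & range f = A];
  generic_universal : forall (N : finType) (H : pregeom N), flat H ->
    exists f : N -> M, embedding H G f /\ sqsub G (range f);
  generic_extension : forall A : set M, finite_set A -> sqsub G A ->
    forall (N : finType) (B : pregeom N) (i : A -> N),
      flat B -> embedding (subgeom G A) B i -> sqsub B (range i) ->
    exists f : N -> M,
      [/\ embedding B G f, forall x : A, f (i x) = val x & sqsub G (range f)];
  generic_cofinal : forall X : set M, finite_set X ->
    exists A : set M, [/\ finite_set A, X `<=` A & sqsub G A] }.

(* Main.v *)
Require Import Defs.
From HB Require Import structures.
From mathcomp Require Import all_boot all_order all_algebra.
From mathcomp Require Import finmap mathcomp_extra boolp classical_sets.
From mathcomp Require Import functions cardinality zify.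
(* Imported once more so that [closed] means closed in a pregeometry. *)
Require Import Defs.

(** Everything is reduced to finite sets of points.  Let [mu] be the Moebius
    transform of the rank function of a pregeometry, so that the rank of a finite
    set [A] is the total mass of the subsets of [A].  By inclusion-exclusion the
    alternating sum Delta of a family of flats is the mass of the sets contained
    in some member of the family.  This turns flatness and both embeddings into
    statements about one signed measure.  If [Y] is embedded in the starred sense
    in [Z], the flats spanned by [Y] are closed under intersection, and therefore
    (lemma [star_msr]) their Delta can be computed in [Y].

    Amalgamation.  Let [A] and [H] be flat and let their common part [F] be strong
    in [H].  For a set [Y] with closed traces put
    [phi Y = d (Y & A) + d (Y & H) - d (Y & F)], and let the rank of [X] be the
    least value of [phi] on the supersets of [X].  By [amalgam_flat] this is a flat
    pregeometry; [A] is strong in it, [H] is starred in it when [F] is starred in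
    [A], and Delta is the sum of those of [A] and [H] minus that of [F].

    Hulls.  In a flat pregeometry every set of [n] points lies in a starred set
    whose size is bounded by a function [theta] of [n] ([hull_exists]).  Choose a
    finite intersection-closed family of flats spanned by its points, and record
    for each [i] the measure of its members of rank at most [i].  If two flats
    spanned by the points meet in a flat that is not spanned by points, the family
    can be enlarged, by a controlled amount, so that this vector drops
    lexicographically, high ranks being compared first.  The vectors are
    well-founded and each step leaves boundedly many choices, so the process stops
    after boundedly many points.

    The generic pregeometry satisfies the axioms.  Flatness and infinite dimension
    are seen on finite strong subsets.  For the extension axiom take [F], strong
    in its starred extensions by boundedly many points, and [H] in which [F] is
    strong; take a finite strong [A] containing [F], amalgamate [A] and [H] over
    [F], and embed the result strongly over [A].  The image of [H] is starred.  It
    is strong in a starred set [Y] with at most [n] more points, because by the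
    formula for Delta only the traces on [A] of flats generated by [Y] matter;
    there are boundedly many of them, so they are spanned by a set embedded in [A]
    of bounded size, and this is a set in which [F] was assumed to be strong
    ([amalgam_nstrong]).  The bound is the function [tau].

    Satisfiability.  When [F] is strong in both sides, both sides are strong in
    the amalgam, so a generic pregeometry exists on the natural numbers as the
    union of a chain of finite flat pregeometries in which every amalgamation task
    is eventually carried out ([generic_exists]). *)

Set Implicit Arguments.
Unset Strict Implicit.
Unset Printing Implicit Defensive.

Import Order.TTheory GRing.Theory Num.Theory.

Local Open Scope fset_scope.
Local Open Scope nat_scope.

(** * Rank, closure and basis of finite sets *)

(** Boolean identities and inclusions between finite sets are checked pointwise,
    by cases on all memberships, after every inclusion in the context has been
    instantiated at the point. *)
Ltac fset_pointwise x :=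
  repeat match goal with
    | H : is_true (fsubset _ _) |- _ =>
        move/fsubsetP/(_ x)/implyP: H => H
    end;
  repeat match goal with
    | H : is_true (_ ==> _) |- _ => revert H
    end;
  rewrite ?inE /=;
  repeat match goal with
    | |- context [?a \in ?b] => case: (a \in b) => //=
    | |- context [?a == ?b] => case: (a == b) => //=
    end.
Ltac fset_bool :=
  let x := fresh "x" in
  first [apply/fsetP => x; fset_pointwise x
        |apply/fsubsetP => x; apply/implyP; fset_pointwise x].

Section Rank.
Variables (K : choiceType) (G : pregeom K).
Implicit Types (A B C S U V W X Y Z E F : {fset K}).

Lemma dim_mono A B : A `<=` B -> G A <= G B.
Proof.
move=> AB; have -> : B = B `|` A by fset_bool.
clear AB; elim/fset1U_rect: B => [|x B _ IH]; first by rewrite fset0U.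
have /andP[h _] := dim_fsetU1 G (B `|` A) x.
by rewrite -fsetUA (leq_trans IH).
Qed.

Lemma dim_submod_sub A B C : C `<=` A -> C `<=` B ->
  G (A `|` B) + G C <= G A + G B.
Proof.
move=> CA CB; apply: leq_trans (dim_submod G A B).
by rewrite leq_add2l dim_mono // fsubsetI CA.
Qed.

Lemma dimU_le A B : G (A `|` B) <= G A + G B.
Proof. exact: leq_trans (leq_addr _ _) (dim_submod G A B). Qed.

Lemma dim_card A : G A <= #|` A|.
Proof.
elim/fset1U_rect: A => [|x A xA IH]; first by rewrite dim_fset0.
have /andP[_ h] := dim_fsetU1 G A x.
by rewrite (leq_trans h) // cardfsU1 xA add1n ltnS.
Qed.

Lemma dim_absorb_mono A B x : A `<=` B -> G (x |` A) = G A -> G (x |` B) = G B.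
Proof.
move=> AB xA; apply/eqP; rewrite eqn_leq (dim_mono (fsubsetU1 x B)) andbT.
have := @dim_submod_sub (x |` A) B A (fsubsetU1 x A) AB.
have -> : x |` A `|` B = x |` B by fset_bool.
by rewrite xA; lia.
Qed.

Lemma dim_absorb A B : {in B, forall x, G (x |` A) = G A} -> G (B `|` A) = G A.
Proof.
elim/fset1U_rect: B => [|x B xB IH] h; first by rewrite fset0U.
have IH' : G (B `|` A) = G A.
  by apply: IH => y yB; apply: h; rewrite inE yB orbT.
rewrite -fsetUA (dim_absorb_mono _ (h x _)) //; first exact: fsubsetUr.
by rewrite fset1U1.
Qed.

Lemma dim_eq_absorb A B x : A `<=` B -> G A = G B -> x \in B ->
  G (x |` A) = G A.
Proof.
move=> AB e xB; apply/eqP; rewrite eqn_leq (dim_mono (fsubsetU1 _ _)) andbT e.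
by apply: dim_mono; rewrite fsubUset fsub1set xB.
Qed.

Lemma basis_exists A : exists B, [/\ B `<=` A, G B = G A & #|` B| = G A].
Proof.
elim/fset1U_rect: A => [|x A xA [B [BA eB cB]]].
  by exists fset0; rewrite fsubset_refl dim_fset0 cardfs0.
have /andP[h1 h2] := dim_fsetU1 G A x.
have [e|ne] := eqVneq (G (x |` A)) (G A).
  by exists B; rewrite e; split => //; apply: fsubset_trans BA (fsubsetU1 _ _).
have e : G (x |` A) = (G A).+1 by lia.
exists (x |` B); split; first exact: fsetUS.
- rewrite e; have /andP[k1 k2] := dim_fsetU1 G B x.
  suff : G (x |` B) <> G B by lia.
  by move=> /(dim_absorb_mono BA); lia.
- rewrite cardfsU1 cB e; case: (boolP (x \in B)) => // /(fsubsetP BA).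
  by rewrite (negPf xA).
Qed.

Definition bas A : {fset K} := projT1 (cid (basis_exists A)).

Lemma basP A : [/\ bas A `<=` A, G (bas A) = G A & #|` bas A| = G A].
Proof. exact: (projT2 (cid (basis_exists A))). Qed.

Definition rcl Z S : {fset K} := [fset x in Z | G (x |` S) == G S].
Definition rclosed Z S : bool := (S `<=` Z) && (rcl Z S `<=` S).

Lemma in_rcl Z S x : (x \in rcl Z S) = (x \in Z) && (G (x |` S) == G S).
Proof. by rewrite !inE. Qed.

Lemma rcl_subl Z S : rcl Z S `<=` Z.
Proof. exact: fset_sub. Qed.

Lemma sub_rcl Z S : S `<=` Z -> S `<=` rcl Z S.
Proof.
move=> SZ; apply/fsubsetP => x xS; rewrite in_rcl (fsubsetP SZ) //=.
by rewrite mem_fset1U.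
Qed.

Lemma dim_rcl Z S : S `<=` Z -> G (rcl Z S) = G S.
Proof.
move=> SZ; have := sub_rcl SZ => /fsetUidPl <-.
by apply: dim_absorb => x; rewrite in_rcl => /andP[_ /eqP].
Qed.

Lemma rcl_mono Z S T : S `<=` T -> rcl Z S `<=` rcl Z T.
Proof.
move=> ST; apply/fsubsetP => x; rewrite !in_rcl => /andP[-> /eqP e] /=.
by apply/eqP; apply: dim_absorb_mono e.
Qed.

Lemma rclosed_sub Z S : rclosed Z S -> S `<=` Z.
Proof. by case/andP. Qed.

Lemma rclosedP Z S : rclosed Z S ->
  forall x, x \in Z -> G (x |` S) = G S -> x \in S.
Proof.
by case/andP=> _ h x xZ e; apply: (fsubsetP h); rewrite in_rcl xZ e eqxx.
Qed.

Lemma rclosed_rcl Z S : S `<=` Z -> rclosed Z (rcl Z S).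
Proof.
move=> SZ; rewrite /rclosed rcl_subl; apply/fsubsetP => x.
rewrite !in_rcl => /andP[xZ /eqP e]; rewrite xZ /=.
apply/eqP/eqP; rewrite eqn_leq (dim_mono (fsubsetU1 _ _)) andbT.
rewrite -(dim_rcl SZ) -e; apply: dim_mono; apply: fsetUS; exact: sub_rcl.
Qed.

Lemma rcl_min Z E S : rclosed Z E -> S `<=` E -> rcl Z S `<=` E.
Proof. by case/andP=> _ h SE; apply: fsubset_trans (rcl_mono _ SE) h. Qed.

Lemma rcl_spanned Z E S : rclosed Z E -> S `<=` E -> G S = G E -> rcl Z S = E.
Proof.
move=> cE SE e; apply/eqP; rewrite eqEfsubset rcl_min //=.
apply/fsubsetP => x xE; rewrite in_rcl (fsubsetP (rclosed_sub cE)) //=.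
by apply/eqP; apply: dim_eq_absorb e xE.
Qed.

Lemma rclosed_eq Z E S : rclosed Z S -> E `<=` Z -> S `<=` E -> G S = G E -> S = E.
Proof.
move=> cS EZ SE e; apply/eqP; rewrite eqEfsubset SE /=; apply/fsubsetP => x xE.
apply: (rclosedP cS); first exact: (fsubsetP EZ).
exact: dim_eq_absorb e xE.
Qed.

Lemma rclosed_trace Z Y S : Y `<=` Z -> rclosed Z S -> rclosed Y (S `&` Y).
Proof.
move=> YZ cS; rewrite /rclosed fsubsetIr; apply/fsubsetP => x.
rewrite in_rcl inE => /andP[xY /eqP e]; rewrite xY andbT.
apply: (rclosedP cS); first exact: (fsubsetP YZ).
exact: dim_absorb_mono (fsubsetIl S Y) e.
Qed.

Lemma rclosedI Z S T : rclosed Z S -> rclosed Z T -> rclosed Z (S `&` T).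
Proof.
move=> cS cT; rewrite /rclosed (fsubset_trans (fsubsetIl _ _) (rclosed_sub cS)).
by rewrite /= fsubsetI !rcl_min ?fsubsetIl ?fsubsetIr.
Qed.

Lemma rclosed_full Z : rclosed Z Z.
Proof. by rewrite /rclosed fsubset_refl rcl_subl. Qed.

Lemma rcl_trace Z Y S : Y `<=` Z -> rclosed Y S -> rcl Z S `&` Y = S.
Proof.
move=> YZ cS; apply/eqP; rewrite eqEfsubset fsubsetI (rclosed_sub cS).
rewrite sub_rcl ?(fsubset_trans (rclosed_sub cS)) // !andbT.
apply/fsubsetP => x; rewrite inE in_rcl => /andP[/andP[xZ /eqP e] xY].
exact: (rclosedP cS).
Qed.

End Rank.

(** * The Moebius measure and inclusion-exclusion *)

Section Measure.
Variable K : choiceType.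
Implicit Types (A B C S T U V W X Y Z E F : {fset K}) (SS : seq {fset K}).
Implicit Types (w f : {fset K} -> int) (P Q : pred {fset K}).

Definition wsum w U P : int := (\sum_(B <- fpowerset U | P B) w B)%R.
Definition cover SS : pred {fset K} := fun B => has (fun S => B `<=` S) SS.

Lemma eq_wsum w U P Q : (forall B, B `<=` U -> P B = Q B) ->
  wsum w U P = wsum w U Q.
Proof.
move=> h; rewrite /wsum big_seq_cond [RHS]big_seq_cond; apply: eq_bigl => B.
by rewrite fpowersetE; case: (boolP (B `<=` U)) => // /h ->.
Qed.

Lemma wsum_narrow w U V P : V `<=` U -> (forall B, P B -> B `<=` U -> B `<=` V) ->
  wsum w U P = wsum w V P.
Proof.
move=> VU h; rewrite /wsum big_seq_cond [RHS]big_seq_cond.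
rewrite -big_filter -[RHS]big_filter; apply: perm_big; apply: uniq_perm.
- by rewrite filter_uniq // fset_uniq.
- by rewrite filter_uniq // fset_uniq.
move=> B; rewrite !mem_filter !fpowersetE.
case: (boolP (P B)) => PB; rewrite ?andbF // !andbT !andbb.
by apply/idP/idP => [/(h _ PB)//|/fsubset_trans]; apply.
Qed.

Lemma wsumU w U P Q : (wsum w U (fun B => P B || Q B)
  = wsum w U P + wsum w U Q - wsum w U (fun B => P B && Q B))%R.
Proof.
rewrite /wsum (big_mkcond P) (big_mkcond Q) (big_mkcond (fun B => P B && Q B)).
rewrite (big_mkcond (fun B => P B || Q B)) -big_split -sumrB /=.
apply: eq_bigr => B _; case: (P B); case: (Q B) => //=; lia.
Qed.

Lemma wsum_weight w U V P : V `<=` U ->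
  (wsum (fun B => if B `<=` V then w B else 0) U P = wsum w V P)%R.
Proof.
move=> VU; rewrite {1}/wsum -big_mkcondr.
have -> : (\sum_(B <- fpowerset U | P B && (B `<=` V)) w B)%R
   = wsum w U (fun B => P B && (B `<=` V)) by [].
rewrite (@wsum_narrow _ U V) //; last by move=> B /andP[].
by apply: eq_wsum => B ->; rewrite andbT.
Qed.

Lemma wsumB w w' U P : (wsum (fun B => w B - w' B) U P = wsum w U P - wsum w' U P)%R.
Proof. by rewrite /wsum sumrB. Qed.

Lemma cover_map T SS B :
  cover [seq V `&` T | V <- SS] B = (B `<=` T) && cover SS B.
Proof.
rewrite /cover has_map; case: (boolP (B `<=` T)) => BT /=.
  by apply: eq_has => S /=; rewrite fsubsetI BT andbT.
by rewrite -[RHS](has_pred0 SS); apply: eq_has => S /=;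
  rewrite fsubsetI (negPf BT) andbF.
Qed.

(** The members of the family are peeled off one at a time; the overlap of the
    first with the others is again a union of members of the class, by closure
    under intersection.  Used with [w] the difference of two measures that agree
    on a class of flats. *)
Lemma valuation_ext w U (C : pred {fset K}) :
  (forall S T, C S -> C T -> C (S `&` T)) ->
  (forall S, C S -> wsum w U (fun B => B `<=` S) = 0)%R ->
  forall SS, all C SS -> (wsum w U (cover SS) = 0)%R.
Proof.
move=> CI C0 SS; move: {2}(size SS) (erefl (size SS)) => n.
elim: n SS => [|n IH] [|S SS] //=; first by move=> _ _; rewrite /wsum big_pred0.
case=> sz /andP[CS CSS].
rewrite (@eq_wsum _ _ _ (fun B => (B `<=` S) || cover SS B)) // wsumU C0 //.
rewrite (IH SS) // (@eq_wsum _ _ _ (cover [seq V `&` S | V <- SS])); last first.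
  by move=> B _; rewrite cover_map.
rewrite IH ?size_map //.
apply/allP => _ /mapP[T TSS ->].
by apply: CI => //; apply: (allP CSS).
Qed.

(** Moebius inversion on finite sets, with the recursion bounded by [n]; any
    bound at least the cardinality gives the same value. *)
Fixpoint mobius f n A : int :=
  if n is n'.+1 then (f A - \sum_(B <- fpowerset A | B != A) mobius f n' B)%R
  else f A.

Lemma mobius_stable f n m A : #|` A| <= n -> #|` A| <= m ->
  mobius f n A = mobius f m A.
Proof.
have e0 n' : mobius f n' fset0 = f fset0.
  case: n' => //= n'; rewrite big_mkcond fpowerset0 big_seq_fset1 eqxx.
  by rewrite subr0.
elim: n m A => [|n IH] [|m] A cA cA' //=.
- have -> : A = fset0 by apply: cardfs0_eq; lia.
  by have /= -> := e0 m.+1.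
- have -> : A = fset0 by apply: cardfs0_eq; lia.
  by have /= -> := e0 n.+1.
congr (_ - _)%R; rewrite big_seq_cond [RHS]big_seq_cond.
apply: eq_bigr => B /andP[]; rewrite fpowersetE => BA nBA.
have cB : #|` B| < #|` A| by apply: fproper_ltn_card; rewrite fproperEneq nBA.
by apply: IH; lia.
Qed.

Definition mob f A : int := mobius f #|` A| A.

Lemma sum_mob f A : (\sum_(B <- fpowerset A) mob f B = f A)%R.
Proof.
have AA : A \in fpowerset A by rewrite fpowersetE.
rewrite (bigD1_seq A) //= ?fset_uniq // {1}/mob (@mobius_stable f _ #|` A|.+1) //=.
set a := (X in (_ - X + _)%R); set b := (X in (_ - _ + X)%R).
suff -> : a = b by rewrite subrK.
rewrite /a /b big_seq_cond [RHS]big_seq_cond.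
apply: eq_bigr => B /andP[]; rewrite fpowersetE => BA nBA.
apply: mobius_stable => //; exact: fsubset_leq_card.
Qed.

(** The coefficient of [mob f B] on the left is the alternating sum over the
    nonempty sets of indices of members containing [B], which is 1 as soon as
    there is such a member. *)
Lemma inclusion_exclusion f Z k (E : 'I_k -> {fset K}) (g : {set 'I_k} -> {fset K}) :
  (forall s x, (x \in g s) = (x \in Z) && [forall i in s, x \in E i]) ->
  (\sum_(s : {set 'I_k} | s != finset.set0) (-1) ^+ (#|s|.+1) * f (g s)
    = wsum (mob f) Z (cover [seq E i | i <- enum 'I_k]))%R.
Proof.
move=> gP.
have gE s : f (g s) = (\sum_(B <- fpowerset Z)
    if s \subset [set i | B `<=` E i] then mob f B else 0)%R.
  rewrite -big_mkcond -[LHS]sum_mob.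
  have -> : (\sum_(B <- fpowerset (g s)) mob f B)%R
     = wsum (mob f) (g s) (fun B => s \subset [set i | B `<=` E i]).
    rewrite /wsum [RHS]big_mkcond big_seq [RHS]big_seq; apply: eq_bigr => B.
    rewrite fpowersetE => Bg; case: ifP => // /negP[].
    apply/fintype.subsetP => i si; rewrite inE; apply/fsubsetP => x xB.
    by have := fsubsetP Bg x xB; rewrite gP => /andP[_ /forall_inP]; apply.
  apply/esym/wsum_narrow.
    by apply/fsubsetP => x; rewrite gP => /andP[].
  move=> B /fintype.subsetP sB BZ; apply/fsubsetP => x xB; rewrite gP (fsubsetP BZ) //=.
  by apply/forall_inP => i /sB; rewrite inE => /fsubsetP; apply.
under eq_bigr => s _ do rewrite gE mulr_sumr.
rewrite exchange_big /= /wsum [RHS]big_mkcond; apply: eq_bigr => B _.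
set I := [set i | B `<=` E i].
have alt : (\sum_(s : {set 'I_k} | s \subset I) (-1) ^+ #|s|
    = (I == finset.set0)%:R :> int)%R.
  have := @bigA_distr int 0%R 1%R *%R +%R _
    (fun i : 'I_k => if i \in I then -1 else 0 : int)%R (fun=> 1%R).
  have -> : (\prod_(i < k) ((if i \in I then -1 else 0 : int) + 1)
              = (I == finset.set0)%:R)%R.
    have [->|/finset.set0Pn[i iI]] := eqVneq I finset.set0.
      by apply: big1 => i _; rewrite inE add0r.
    by rewrite (bigD1 i) //= iI addNr mul0r.
  move=> ->; rewrite big_mkcond; apply: eq_bigr => s _.
  case: ifP => [/fintype.subsetP sI|/negbT/fintype.subsetPn[i si iI]].
    rewrite -prodr_const big_mkcond; apply: eq_bigr => i _.
    by case: ifP => // /sI ->.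
  by rewrite (bigD1 i) //= si (negPf iI) mul0r.
have cI : cover [seq E i | i <- enum 'I_k] B = (I != finset.set0).
  rewrite /cover has_map; apply/hasP/finset.set0Pn => [[i _ /= h]|[i]].
    by exists i; rewrite inE.
  by rewrite inE => h; exists i; rewrite ?mem_enum.
rewrite cI; move: alt; rewrite (bigD1 finset.set0) ?finset.sub0set //= cards0 expr0.
move=> alt.
have -> : (\sum_(s : {set 'I_k} | s != finset.set0)
    (-1) ^+ #|s|.+1 * (if s \subset I then mob f B else 0) =
  - (\sum_(s : {set 'I_k} | (s \subset I) && (s != finset.set0)) (-1) ^+ #|s|) * mob f B)%R.
  rewrite mulNr mulr_suml -sumrN [RHS]big_mkcondl; apply: eq_bigr => s _.
  by case: ifP => _; rewrite ?mulr0 // exprS mulN1r mulNr.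
move: alt; set a := (\sum_(s | _) _)%R => alt.
have -> : a = ((I == finset.set0)%:R - 1)%R by rewrite -alt addrC addrK.
by case: (I == finset.set0) => /=; rewrite ?subrr ?sub0r ?oppr0 ?opprK ?mul0r ?mul1r.
Qed.
End Measure.

(** * Flatness and embeddings of finite sets *)

Definition fcup (K : choiceType) (SS : seq {fset K}) : {fset K} :=
  \bigcup_(V <- SS) V.

Lemma in_fcup (K : choiceType) (SS : seq {fset K}) x :
  (x \in fcup SS) = has (fun V : {fset K} => x \in V) SS.
Proof.
apply/bigfcupP/hasP => [[V /andP[VSS _] xV]|[V VSS xV]]; exists V => //.
by rewrite VSS.
Qed.

Lemma fcup_sub (K : choiceType) (SS : seq {fset K}) (U : {fset K}) :
  (fcup SS `<=` U) = all (fun V => V `<=` U) SS.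
Proof.
apply/fsubsetP/allP => [h V VSS|h x].
  by apply/fsubsetP => x xV; apply: h; rewrite in_fcup; apply/hasP; exists V.
by rewrite in_fcup => /hasP[V VSS]; apply/fsubsetP/h.
Qed.

Lemma fcup_sup (K : choiceType) (SS : seq {fset K}) V : V \in SS -> V `<=` fcup SS.
Proof.
by move=> VSS; apply/fsubsetP => x xV; rewrite in_fcup; apply/hasP; exists V.
Qed.

Lemma card_fcup (K : choiceType) (T : eqType) (f : T -> {fset K}) (s : seq T) k :
  (forall x, x \in s -> #|` f x| <= k) -> #|` fcup (map f s)| <= size s * k.
Proof.
elim: s => [|x s IH] h; first by rewrite /fcup big_nil cardfs0.
rewrite /fcup /= big_cons -/(fcup _) mulSn; apply: leq_trans (leq_card_fsetU _ _) _.
by rewrite leq_add ?h ?mem_head // IH // => y ys; rewrite h // inE ys orbT.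
Qed.

Section Finite.
Variables (K : choiceType) (G : pregeom K).
Implicit Types (A B C S T U V W X Y Z E F : {fset K}) (SS : seq {fset K}).

(** [msr U SS] is the Delta of the family [SS] computed inside [U], as the mass of
    the subsets of [U] contained in some member.  The same measure serves all
    subsets of the carrier, and [msr] does not see repetitions or members
    contained in others. *)
Definition mu : {fset K} -> int := mob (fun A => (G A)%:Z%R).
Definition msr U SS : int := wsum mu U (cover SS).

Lemma wsum_mu U V : (wsum mu U (fun B => B `<=` V) = (G (V `&` U))%:Z)%R.
Proof.
rewrite (@wsum_narrow _ _ _ (V `&` U)) ?fsubsetIr //; last first.
  by move=> B BV BU; rewrite fsubsetI BV.
rewrite -[RHS](sum_mob (fun A => (G A)%:Z%R)) /wsum big_seq_cond [RHS]big_seq.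
apply: eq_bigl => B; rewrite fpowersetE fsubsetI.
by case: (B `<=` V); rewrite ?andbT ?andbF.
Qed.

Lemma eq_msr U SS SS' : (forall B, B `<=` U -> cover SS B = cover SS' B) ->
  msr U SS = msr U SS'.
Proof. exact: eq_wsum. Qed.

Lemma msr_nil U : msr U [::] = 0%R.
Proof. by rewrite /msr /wsum big_pred0. Qed.

Lemma msr_cons U V SS :
  (msr U (V :: SS) = (G (V `&` U))%:Z + msr U SS - msr (V `&` U) SS)%R.
Proof.
rewrite /msr (@eq_wsum _ _ _ _ (fun B => (B `<=` V) || cover SS B)) //.
rewrite wsumU wsum_mu; congr (_ - _)%R.
rewrite (@wsum_narrow _ _ _ (V `&` U)) ?fsubsetIr //; last first.
  by move=> B /andP[BV _] BU; rewrite fsubsetI BV.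
by apply: eq_wsum => B; rewrite fsubsetI => /andP[->].
Qed.

Lemma msr_trace T U SS : U `<=` T -> msr U [seq V `&` T | V <- SS] = msr U SS.
Proof.
move=> UT; apply: eq_msr => B BU; rewrite cover_map.
by rewrite (fsubset_trans BU UT).
Qed.

Lemma msr_fset0 SS : msr fset0 SS = 0%R.
Proof.
rewrite /msr /wsum big_mkcond fpowerset0 big_seq_fset1 /mu /mob cardfs0 /=.
by rewrite dim_fset0 if_same.
Qed.

Lemma msr1 U V : msr U [:: V] = (G (V `&` U))%:Z%R.
Proof.
by rewrite msr_cons msr_nil /msr /wsum big_pred0 // subr0 addr0.
Qed.

Lemma msr2 U V W : (msr U [:: V; W] =
  (G (V `&` U))%:Z + (G (W `&` U))%:Z - (G (V `&` W `&` U))%:Z)%R.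
Proof.
rewrite msr_cons !msr1; congr (_ - (G _)%:Z)%R; by fset_bool.
Qed.

(** Flatness of [Z], strength of [F] in [Z] and the starred embedding of [F] in
    [Z], for finite sets and with flats taken relative to [Z].  The starred
    embedding says that the flats spanned by [F] are closed under intersection. *)
Definition fflat Z : Prop := forall SS, all (rclosed G Z) SS ->
  ((G (fcup SS))%:Z <= msr Z SS)%R.

Definition fstrong F Z : Prop := forall SS, all (rclosed G Z) SS ->
  (msr F SS <= msr Z SS)%R.

Definition spanned F W : bool := G (W `&` F) == G W.

Definition fstar F Z : Prop := forall W1 W2,
  rclosed G Z W1 -> rclosed G Z W2 -> spanned F W1 -> spanned F W2 ->
  spanned F (W1 `&` W2).

(** The measures of [Z] and of [F] agree on each flat spanned by [F], and these
    flats are closed under intersection, so that [valuation_ext] applies. *)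
Lemma star_msr F Z SS : F `<=` Z -> fstar F Z -> all (rclosed G Z) SS ->
  all (spanned F) SS -> msr Z SS = msr F SS.
Proof.
move=> FZ FsZ cSS sSS.
pose w B := (mu B - if B `<=` F then mu B else 0)%R.
have w0 : (wsum w Z (cover SS) = 0)%R.
  apply: (@valuation_ext _ _ _ (fun S => rclosed G Z S && spanned F S)).
  - move=> S T /andP[cS sS] /andP[cT sT]; rewrite rclosedI //=.
    exact: FsZ.
  - move=> S /andP[cS /eqP sS]; rewrite wsumB wsum_weight // !wsum_mu sS.
    by have /fsetIidPl -> := rclosed_sub cS; rewrite subrr.
  - by apply/allP => S SS'; rewrite (allP cSS) // (allP sSS).
by move: w0; rewrite wsumB wsum_weight // => /eqP; rewrite subr_eq0 => /eqP.
Qed.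

Lemma spanned_sub F Y W : F `<=` Y -> spanned F W -> spanned Y W.
Proof.
move=> FY /eqP sW; rewrite /spanned eqn_leq dim_mono ?fsubsetIl //= -sW.
by apply/dim_mono/fsetIS.
Qed.

Lemma spannedP F Z W : rclosed G Z W -> F `<=` Z ->
  reflect (rcl G Z (W `&` F) = W) (spanned F W).
Proof.
move=> cW FZ; apply: (iffP eqP) => [e|<-].
  by apply: rcl_spanned => //; apply: fsubsetIl.
have h : W `&` F `<=` Z by apply: fsubset_trans (fsubsetIr _ _) FZ.
rewrite (dim_rcl G h); apply/eqP; rewrite eqn_leq.
rewrite -{1}(dim_rcl G h) dim_mono ?fsubsetIl //=.
by apply: dim_mono; rewrite fsubsetI fsubsetIr sub_rcl.
Qed.

Lemma rcl_fam Y Z SS : Y `<=` Z -> all (rclosed G Y) SS ->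
  let TT := [seq rcl G Z V | V <- SS] in
  [/\ all (rclosed G Z) TT, all (spanned Y) TT
    & [seq V `&` Y | V <- TT] = SS].
Proof.
move=> YZ cSS TT; have SZ V : V \in SS -> V `<=` Z.
  by move=> /(allP cSS)/rclosed_sub/fsubset_trans; apply.
split.
- by apply/allP => _ /mapP[V VSS ->]; apply: rclosed_rcl; apply: SZ.
- apply/allP => _ /mapP[V VSS ->]; rewrite /spanned.
  by rewrite rcl_trace ?(allP cSS) // dim_rcl // SZ.
- rewrite -map_comp -[RHS]map_id; apply/eq_in_map => V VSS /=.
  by rewrite rcl_trace // (allP cSS).
Qed.

Lemma star_msr_rcl Y Z SS : Y `<=` Z -> fstar Y Z -> all (rclosed G Y) SS ->
  msr Z [seq rcl G Z V | V <- SS] = msr Y SS.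
Proof.
move=> YZ sYZ cSS; have [cTT sTT eTT] := rcl_fam YZ cSS.
by rewrite (star_msr YZ sYZ) // -(@msr_trace Y) // eTT.
Qed.

Lemma rclosed_traces Y Z SS : Y `<=` Z -> all (rclosed G Z) SS ->
  all (rclosed G Y) [seq V `&` Y | V <- SS].
Proof.
move=> YZ cSS; apply/allP => _ /mapP[V VSS ->].
by apply: rclosed_trace YZ _; apply: (allP cSS).
Qed.

Lemma fstar_trans F Y Z : F `<=` Y -> Y `<=` Z -> fstar F Y -> fstar Y Z ->
  fstar F Z.
Proof.
move=> FY YZ sFY sYZ W1 W2 c1 c2 s1 s2.
have tr W : W `&` Y `&` F = W `&` F by fset_bool.
have e1 := spanned_sub FY s1; have e2 := spanned_sub FY s2.
have := sFY _ _ (rclosed_trace YZ c1) (rclosed_trace YZ c2).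
rewrite /spanned !tr (eqP s1) (eqP s2) (eqP e1) (eqP e2) !eqxx => /(_ isT isT).
have -> : W1 `&` Y `&` (W2 `&` Y) = W1 `&` W2 `&` Y by fset_bool.
by rewrite tr => /eqP ->; apply: sYZ.
Qed.

Lemma fstar_narrow F Y Z : F `<=` Y -> Y `<=` Z -> fstar F Z -> fstar F Y.
Proof.
move=> FY YZ sFZ W1 W2 c1 c2 s1 s2.
have tr W : rclosed G Y W -> rcl G Z W `&` F = W `&` F.
  move=> cW; rewrite -{2}(rcl_trace YZ cW); clear -FY; by fset_bool.
have sZ W : rclosed G Y W -> W `<=` Z.
  by move=> /rclosed_sub/fsubset_trans; apply.
have st W : rclosed G Y W -> spanned F W -> spanned F (rcl G Z W).
  by move=> cW /eqP sW; rewrite /spanned tr // sW dim_rcl // sZ.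
have := sFZ _ _ (rclosed_rcl G (sZ _ c1)) (rclosed_rcl G (sZ _ c2))
  (st _ c1 s1) (st _ c2 s2).
rewrite /spanned; set R := _ `&` rcl G Z W2.
have RF : R `&` F = W1 `&` W2 `&` F.
  have := tr _ c1; have := tr _ c2; rewrite /R => e2 e1.
  rewrite -fsetIA e2 fsetIA -[LHS]fsetIA [W2 `&` F]fsetIC fsetIA e1.
  by rewrite -fsetIA [F `&` W2]fsetIC fsetIA.
have WR : W1 `&` W2 `<=` R by apply: fsetISS; apply: sub_rcl; apply: sZ.
rewrite RF => /eqP e; rewrite eqn_leq dim_mono ?fsubsetIl //= e.
exact: dim_mono.
Qed.

Lemma fstrong_trans F Y Z : F `<=` Y -> Y `<=` Z -> fstrong F Y ->
  fstrong Y Z -> fstrong F Z.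
Proof.
move=> FY YZ sFY sYZ SS cSS; apply: le_trans (sYZ _ cSS).
have := sFY _ (rclosed_traces YZ cSS).
by rewrite !msr_trace.
Qed.

Lemma fflat_narrow Y Z : Y `<=` Z -> fstar Y Z -> fflat Z -> fflat Y.
Proof.
move=> YZ sYZ fZ SS cSS; have [cTT _ eTT] := rcl_fam YZ cSS.
rewrite -(star_msr_rcl YZ sYZ cSS); apply: le_trans (fZ _ cTT).
rewrite lez_nat; apply: dim_mono; rewrite fcup_sub; apply/allP => V VSS.
apply: fsubset_trans (fcup_sup (map_f (rcl G Z) VSS)).
apply/sub_rcl/(fsubset_trans _ YZ)/rclosed_sub/(allP cSS) => //.
Qed.

Lemma fstrong0 Z : fflat Z -> fstrong fset0 Z.
Proof.
move=> fZ SS cSS; rewrite msr_fset0; apply: le_trans (fZ _ cSS).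
by rewrite lez_nat.
Qed.

Lemma msr_ge0 Z SS : fflat Z -> all (rclosed G Z) SS -> (0 <= msr Z SS)%R.
Proof. by move=> fZ /(fstrong0 fZ); rewrite msr_fset0. Qed.

End Finite.

Section Agree.
Variables (K : choiceType) (G G' : pregeom K) (Z : {fset K}).
Hypothesis GG' : forall X, X `<=` Z -> G X = G' X.


Lemma agree_mu B : B `<=` Z -> mu G B = mu G' B.
Proof.
rewrite /mu /mob; move: #|` B| => n; elim: n B => [|n IH] A AZ /=; rewrite ?GG' //.
congr (_ - _)%R; rewrite big_seq_cond [RHS]big_seq_cond.
apply: eq_bigr => C /andP[]; rewrite fpowersetE => CA _.
by apply: IH; apply: fsubset_trans AZ.
Qed.

Lemma agree_msr U SS : U `<=` Z -> msr G U SS = msr G' U SS.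
Proof.
move=> UZ; rewrite /msr /wsum big_seq_cond [RHS]big_seq_cond.
apply: eq_bigr => C /andP[]; rewrite fpowersetE => CU _.
by apply: agree_mu; apply: fsubset_trans UZ.
Qed.

Lemma agree_rcl V : V `<=` Z -> rcl G Z V = rcl G' Z V.
Proof.
move=> VZ; apply/fsetP => x; rewrite !in_rcl; case xZ: (x \in Z) => //=.
by rewrite !GG' // fsubUset fsub1set xZ.
Qed.

Lemma agree_rclosed V : rclosed G Z V = rclosed G' Z V.
Proof. by rewrite /rclosed; case VZ: (V `<=` Z) => //=; rewrite agree_rcl. Qed.

Lemma agree_fflat : fflat G Z -> fflat G' Z.
Proof.
move=> fZ SS cSS; rewrite -agree_msr // -GG'; last first.
  by rewrite fcup_sub; apply/allP => V /(allP cSS)/rclosed_sub.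
by apply: fZ; rewrite (eq_all agree_rclosed).
Qed.

Lemma agree_fstrong F : F `<=` Z -> fstrong G F Z -> fstrong G' F Z.
Proof.
move=> FZ sF SS cSS; rewrite -!agree_msr //.
by apply: sF; rewrite (eq_all agree_rclosed).
Qed.

Lemma agree_fstar F : F `<=` Z -> fstar G F Z -> fstar G' F Z.
Proof.
have e W : rclosed G' Z W -> spanned G' F W = spanned G F W.
  move=> /rclosed_sub WZ; rewrite /spanned !GG' //.
  by apply: fsubset_trans WZ; apply: fsubsetIl.
move=> FZ sF W1 W2 c1 c2 s1 s2; rewrite e ?rclosedI //.
by apply: sF; rewrite ?agree_rclosed -?e.
Qed.
End Agree.

(** * Frames and their potentials *)

Section Hull.
Variables (K : choiceType) (G : pregeom K) (Z : {fset K}).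
Hypothesis flatZ : fflat G Z.
Implicit Types (A B N U V W Y E : {fset K}) (FF SS TT : seq {fset K}).

Local Notation cl1 y := (rcl G Z [fset y]).

(** A finite family of flats spanned by the points of [Y], closed under
    intersection and containing the flats of rank at most one generated by these
    points.  Its potentials, compared from the top level downwards, decrease while
    [Y] is enlarged towards a starred set. *)
Definition frame Y FF : Prop :=
  [/\ Y `<=` Z, all (rclosed G Z) FF & all (spanned G Y) FF] /\
  [/\ Z \in FF, rcl G Z fset0 \in FF, {in Y, forall y, cl1 y \in FF}
    & {in FF &, forall U V, U `&` V \in FF}].

Definition lev FF i := [seq U <- FF | G U <= i].
Definition pot FF i := msr G Z (lev FF i).
Definition below FF W := [seq U <- FF | U `<` W].

Lemma rclosed_lt U V : rclosed G Z U -> rclosed G Z V -> U `<` V -> G U < G V.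
Proof.
move=> cU cV UV; have sUV := fproper_sub UV; rewrite ltn_neqAle dim_mono // andbT.
apply/eqP => e; move: UV.
by rewrite (rclosed_eq cU (rclosed_sub cV) sUV e) fproperEneq eqxx.
Qed.

Lemma atom_meet V y : rclosed G Z V -> y \in Z ->
  cl1 y `&` V = cl1 y \/ cl1 y `&` V = rcl G Z fset0.
Proof.
move=> cV yZ; have y1Z : [fset y] `<=` Z by rewrite fsub1set.
have c1 := rclosed_rcl G y1Z; have cI := rclosedI c1 cV.
have [e|ne] := eqVneq (G (cl1 y `&` V)) (G (cl1 y)).
  by left; apply: rclosed_eq cI (rclosed_sub c1) (fsubsetIl _ _) e.
right; apply/esym/rcl_spanned => //.
have : G (cl1 y `&` V) < G (cl1 y) by rewrite ltn_neqAle ne dim_mono ?fsubsetIl.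
have := dim_card G [fset y]; rewrite -(dim_rcl G y1Z) cardfs1 dim_fset0; lia.
Qed.

Lemma msr_narrow V SS : rclosed G Z V -> all (rclosed G Z) SS ->
  let TT := [seq U `&` V | U <- SS] in
  all (rclosed G Z) TT /\ msr G V SS = msr G Z TT.
Proof.
move=> cV cSS TT; split.
  by apply/allP => _ /mapP[U USS ->]; apply: rclosedI => //; apply: (allP cSS).
rewrite -(@msr_trace _ _ V V) // /msr; apply/esym/wsum_narrow.
  exact: rclosed_sub cV.
by move=> B; rewrite cover_map => /andP[].
Qed.

(** By flatness, the part of [V] that is covered already has mass at least the rank
    of its points, which is the rank of [V]. *)
Lemma msr_add V SS Y : rclosed G Z V -> spanned G Y V -> Y `<=` Z ->
  all (rclosed G Z) SS -> {in Y `&` V, forall y, cl1 y \in SS} ->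
  (msr G Z (V :: SS) <= msr G Z SS)%R.
Proof.
move=> cV /eqP sV YZ cSS h; rewrite msr_cons.
have /fsetIidPl -> := rclosed_sub cV.
have [cTT ->] := msr_narrow cV cSS; have := flatZ cTT.
set TT := map _ _; suff : G V <= G (fcup TT) by lia.
rewrite -sV; apply: dim_mono; apply/fsubsetP => y; rewrite inE => /andP[yV yY].
rewrite in_fcup; apply/hasP; exists (cl1 y `&` V).
  by apply: (map_f (fun U => U `&` V)); apply: h; rewrite inE yY.
rewrite inE yV andbT; apply: (fsubsetP (sub_rcl _ _)); last exact: fset11.
by rewrite fsub1set (fsubsetP YZ).
Qed.

Lemma msr_adds TT SS Y : Y `<=` Z -> all (rclosed G Z) TT -> all (spanned G Y) TT ->
  all (rclosed G Z) SS ->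
  (forall V y, V \in TT -> y \in Y `&` V -> cl1 y \in SS) ->
  (msr G Z (TT ++ SS) <= msr G Z SS)%R.
Proof.
move=> YZ + + cSS; elim: TT => //= V TT IH /andP[cV cTT] /andP[sV sTT] h.
apply: (@le_trans _ _ (msr G Z (TT ++ SS))); last first.
  by apply: IH => // U y UT; apply: h; rewrite inE UT orbT.
apply: msr_add cV sV YZ _ _; first by rewrite all_cat cTT.
by move=> y yY; rewrite mem_cat (h V) ?orbT // mem_head.
Qed.

Lemma dim_cl1 y : y \in Z -> G (cl1 y) <= 1.
Proof.
by move=> yZ; rewrite dim_rcl ?fsub1set // (leq_trans (dim_card G _)) // cardfs1.
Qed.

Lemma mem_cl1 y : y \in Z -> y \in cl1 y.
Proof.
by move=> yZ; apply: (fsubsetP (sub_rcl _ _)); rewrite ?fset11 ?fsub1set.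
Qed.

Lemma rclosed_cl1 y : y \in Z -> rclosed G Z (cl1 y).
Proof. by move=> yZ; apply: rclosed_rcl; rewrite fsub1set. Qed.

Lemma msr_points SS : all (rclosed G Z) SS -> all (fun V => G V <= 1) SS ->
  (msr G Z SS <= (size SS)%:Z)%R.
Proof.
elim: SS => [|V SS IH] /=; first by rewrite msr_nil.
move=> /andP[cV cSS] /andP[V1 SS1]; have := IH cSS SS1.
rewrite msr_cons; have /fsetIidPl -> := rclosed_sub cV.
have [cTT ->] := msr_narrow cV cSS; have := msr_ge0 flatZ cTT; lia.
Qed.

Lemma cl1_lev Y FF i V y : frame Y FF -> V \in lev FF i -> y \in Y `&` V ->
  cl1 y \in lev FF i.
Proof.
case=> -[YZ cFF sFF] [_ _ pFF _]; rewrite !mem_filter inE => /andP[Vi VFF].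
move=> /andP[yY yV]; rewrite pFF // andbT (leq_trans _ Vi) //.
apply: dim_mono; apply: rcl_min; first exact: (allP cFF).
by rewrite fsub1set.
Qed.

Lemma lev_rclosed FF i : all (rclosed G Z) FF -> all (rclosed G Z) (lev FF i).
Proof. by move=> /allP h; apply/allP => V; rewrite mem_filter => /andP[_ /h]. Qed.

Lemma pot_le Y FF i : frame Y FF -> (pot FF i <= #|` Y|%:Z)%R.
Proof.
move=> fr; have [[YZ cFF sFF] [_ _ pFF _]] := fr.
pose SS := [seq V <- [seq cl1 y | y <- Y] | G V <= i].
have cS0 : all (rclosed G Z) [seq cl1 y | y <- Y].
  by apply/allP => _ /mapP[y yY ->]; apply/rclosed_cl1/(fsubsetP YZ).
have cSS : all (rclosed G Z) SS := lev_rclosed i cS0.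
have -> : pot FF i = msr G Z (lev FF i ++ SS).
  apply: eq_msr => B BZ; rewrite /cover has_cat; apply/esym/orb_idr.
  move=> /hasP[V]; rewrite mem_filter => /andP[Vi /mapP[y yY eV]] BV.
  by apply/hasP; exists V => //; rewrite mem_filter Vi eV pFF.
apply: (@le_trans _ _ (msr G Z SS)).
  apply: (@msr_adds _ _ Y) => //; first exact: lev_rclosed.
    by apply/allP => V; rewrite mem_filter => /andP[_ /(allP sFF)].
  move=> V y Vl yV; have := cl1_lev fr Vl yV; rewrite !mem_filter => /andP[-> _].
  by move: yV; rewrite inE => /andP[yY _]; apply: (map_f (fun y => cl1 y) yY).
apply: le_trans (msr_points cSS _) _.
  apply/allP => V; rewrite mem_filter => /andP[_ /mapP[y yY ->]].
  by apply/dim_cl1/(fsubsetP YZ).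
by rewrite lez_nat size_filter (leq_trans (count_size _ _)) // size_map.
Qed.

Lemma pot_ge0 Y FF i : frame Y FF -> (0 <= pot FF i)%R.
Proof. by case=> -[_ cFF _] _; apply/msr_ge0/lev_rclosed. Qed.

(** The traces on [E] may be added without new points, since the points span them
    already; by [msr_add] no potential increases. *)
Lemma frame_add Y FF E : frame Y FF -> rclosed G Z E ->
  {in FF, forall U, spanned G Y (U `&` E)} ->
  let FF1 := FF ++ [seq U `&` E | U <- FF] in
  [/\ frame Y FF1, E \in FF1 & forall i, (pot FF1 i <= pot FF i)%R].
Proof.
move=> fr cE sE FF1; have [[YZ cFF sFF] [zFF oFF pFF iFF]] := fr.
have cT : all (rclosed G Z) [seq U `&` E | U <- FF].
  by apply/allP => _ /mapP[U UFF ->]; apply: rclosedI => //; apply: (allP cFF).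
have sT : all (spanned G Y) [seq U `&` E | U <- FF].
  by apply/allP => _ /mapP[U UFF ->]; apply: sE.
have EZ := rclosed_sub cE; split.
- split; first by rewrite !all_cat cFF cT sFF sT.
  rewrite !mem_cat zFF oFF; split => //.
    by move=> y /pFF; rewrite mem_cat => ->.
  move=> U V; rewrite !mem_cat => /orP[UF|/mapP[U' UF ->]] /orP[VF|/mapP[V' VF ->]].
  + by rewrite iFF.
  + by rewrite fsetIA (map_f (fun U => U `&` E)) ?orbT // iFF.
  + by rewrite fsetIAC (map_f (fun U => U `&` E)) ?orbT // iFF.
  + by rewrite -fsetIIl (map_f (fun U => U `&` E)) ?orbT // iFF.
- rewrite mem_cat; apply/orP; right; apply/mapP; exists Z => //.
  by apply/esym/fsetIidPr.
move=> i; rewrite /pot (@eq_msr _ _ _ _ (lev [seq U `&` E | U <- FF] i ++ lev FF i)).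
  apply: (@msr_adds _ _ Y) => //; try exact: lev_rclosed.
    by apply/allP => V; rewrite mem_filter => /andP[_ /(allP sT)].
  move=> V y; rewrite !mem_filter => /andP[Vi /mapP[U UF eV]].
  rewrite inE => /andP[yY yV]; rewrite pFF // andbT (leq_trans _ Vi) //.
  apply: dim_mono; apply: rcl_min; last by rewrite fsub1set.
  by rewrite eV; apply: rclosedI => //; apply: (allP cFF).
by move=> B _; rewrite /lev filter_cat /cover !has_cat orbC.
Qed.

(** The hypothesis on [N] is a defect of the frame at [W]: the traces on [N] of the
    members below [W] have more mass than [N] itself.  Adding the traces of all
    members on [N], with bases of them, replaces this mass by the rank of [N] at
    the level just below the rank of [W].  Higher levels already contain [W] and
    hence all subsets of [N], so they do not change. *)
Lemma frame_improve Y FF W N : frame Y FF -> W \in FF -> rclosed G Z N ->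
  N `<` W -> ((G N)%:Z < msr G N (below FF W))%R ->
  exists Y' FF' j, [/\ frame Y' FF', Y `<=` Y',
    #|` Y'| <= #|` Y| + size FF * G Z,
    size FF' <= size FF + size FF + #|` Y'|
    & [/\ j < G Z, (pot FF' j < pot FF j)%R
        & forall i, j < i -> pot FF' i = pot FF i]].
Proof.
move=> fr WF cN NW ltN; have [[YZ cFF sFF] [zFF oFF pFF iFF]] := fr.
have cW := allP cFF _ WF; have WZ := rclosed_sub cW.
have subNW := fproper_sub NW; have NZ := rclosed_sub cN.
have rNW : G N < G W by apply: rclosed_lt.
pose Y1 := fcup [seq bas G (U `&` N) | U <- FF].
have Y1N : Y1 `<=` N.
  rewrite fcup_sub; apply/allP => _ /mapP[U UF ->].
  by have [/fsubset_trans h _ _] := basP G (U `&` N); apply: h; apply: fsubsetIr.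
pose Y' := Y `|` Y1.
have Y'Z : Y' `<=` Z by rewrite fsubUset YZ (fsubset_trans Y1N).
pose T := [seq U `&` N | U <- FF]; pose P := [seq cl1 y | y <- Y'].
pose FF' := FF ++ (T ++ P).
have PF y : y \in Y' -> cl1 y \in FF'.
  by move=> yY; rewrite !mem_cat (map_f (fun y => cl1 y)) ?orbT.
have cT : all (rclosed G Z) T.
  by apply/allP => _ /mapP[U UFF ->]; apply: rclosedI => //; apply: (allP cFF).
have cP : all (rclosed G Z) P.
  by apply/allP => _ /mapP[y yY ->]; apply/rclosed_cl1/(fsubsetP Y'Z).
have cFF' : all (rclosed G Z) FF' by rewrite !all_cat cFF cT cP.
have P_W y : y \in Y' -> y \in Y \/ cl1 y `<=` N.
  rewrite inE => /orP[|yY]; [by left|right].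
  by apply: rcl_min; rewrite // fsub1set (fsubsetP Y1N).
have fr' : frame Y' FF'.
  split; split => //.
  - rewrite !all_cat; apply/and3P; split.
    + by apply/allP => U /(allP sFF)/spanned_sub; apply; apply: fsubsetUl.
    + apply/allP => _ /mapP[U UF ->]; rewrite /spanned eqn_leq.
      rewrite dim_mono ?fsubsetIl //=; have [b1 <- _] := basP G (U `&` N).
      apply: dim_mono; rewrite fsubsetI b1; apply: fsubset_trans (fsubsetUr _ _).
      by apply: fcup_sup; apply: (map_f (fun U => bas G (U `&` N))).
    + apply/allP => _ /mapP[y yY ->]; have yZ := fsubsetP Y'Z _ yY.
      rewrite /spanned eqn_leq dim_mono ?fsubsetIl //=.
      rewrite {1}dim_rcl ?fsub1set // dim_mono // fsub1set inE yY.
      by rewrite mem_cl1.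
  - by rewrite mem_cat zFF.
  - by rewrite mem_cat oFF.
  have old U : U \in FF -> U \in FF' by rewrite mem_cat => ->.
  have new U : U \in FF -> U `&` N \in FF'.
    by move=> UF; rewrite !mem_cat (map_f (fun U => U `&` N)) ?orbT.
  have pts y V : y \in Y' -> rclosed G Z V -> cl1 y `&` V \in FF'.
    move=> yY cV; have [-> | ->] := atom_meet cV (fsubsetP Y'Z _ yY).
      exact: PF.
    exact: old.
  move=> U V UF' VF'; have cU := allP cFF' _ UF'; have cV := allP cFF' _ VF'.
  move: UF' VF'; rewrite /FF' 4!mem_cat.
  case/or3P=> [UF|/mapP[U' UF eU]|/mapP[y yY eU]]; last by rewrite eU pts.
    case/or3P=> [VF|/mapP[V' VF eV]|/mapP[y yY eV]].
    + exact/old/iFF.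
    + by rewrite eV fsetIA; apply/new/iFF.
    + by rewrite eV fsetIC pts.
  case/or3P=> [VF|/mapP[V' VF eV]|/mapP[y yY eV]].
  + by rewrite eU fsetIAC; apply/new/iFF.
  + by rewrite eU eV -fsetIIl; apply/new/iFF.
  + by rewrite eV fsetIC pts.
have FF'P U : U \in FF' -> U \in FF \/ U `<=` N.
  rewrite !mem_cat => /or3P[UF|/mapP[V VF ->]|/mapP[y yY ->]]; first by left.
    by right; apply: fsubsetIr.
  by case: (P_W y yY) => [/pFF|]; [left|right].
exists Y', FF', (G W).-1; split => //.
- exact: fsubsetUl.
- apply: leq_trans (leq_card_fsetU _ _) _; rewrite leq_add2l.
  apply: card_fcup => U _; have [_ _ ->] := basP G (U `&` N).
  by rewrite dim_mono // (fsubset_trans (fsubsetIr _ _)).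
- by rewrite !size_cat !size_map addnA.
split.
- by move: (dim_mono G WZ) rNW; clear; lia.
- pose j := (G W).-1; have jW U : G U < G W -> G U <= j by rewrite /j; clear; lia.
  have -> : pot FF' j = msr G Z (N :: lev FF j).
    apply: eq_msr => B BZ; apply/hasP/orP => [[U]|[BN|/hasP[U]]].
    + rewrite mem_filter => /andP[Uj /FF'P[UF|UN]] BU; last first.
        by left; apply: fsubset_trans BU UN.
      by right; apply/hasP; exists U; rewrite // mem_filter Uj.
    + exists N => //; rewrite mem_filter jW //= !mem_cat.
      have <- : W `&` N = N by apply/fsetIidPr.
      by rewrite (map_f (fun U => U `&` N)) ?orbT.
    + by rewrite mem_filter => /andP[Uj UF] BU; exists U; rewrite // mem_filter Uj mem_cat UF.
  rewrite msr_cons; have /fsetIidPl -> := NZ.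
  suff -> : msr G N (lev FF j) = msr G N (below FF W) by move: ltN; rewrite /pot -/j; clear; lia.
  apply: eq_msr => B BN; apply/hasP/hasP => -[U]; rewrite mem_filter.
    move=> /andP[Uj UF] BU; exists (U `&` W).
      rewrite mem_filter iFF // andbT fproperEneq fsubsetIr andbT.
      apply/eqP => e; have : G W <= G U by rewrite -e dim_mono ?fsubsetIl.
      by move: Uj rNW; rewrite /j; clear; lia.
    by rewrite fsubsetI BU (fsubset_trans BN).
  move=> /andP[UW UF] BU; exists U => //; rewrite mem_filter UF andbT jW //.
  by apply: rclosed_lt => //; apply: (allP cFF).
move=> i ij; have Wi : G W <= i by move: ij rNW; clear; lia.
apply: eq_msr => B BZ; apply/hasP/hasP => -[U]; rewrite mem_filter.
  move=> /andP[Ui /FF'P[UF|UN]] BU; first by exists U; rewrite // mem_filter Ui.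
  exists W; first by rewrite mem_filter Wi.
  by apply: fsubset_trans BU (fsubset_trans UN subNW).
by move=> /andP[Ui UF] BU; exists U => //; rewrite mem_filter Ui mem_cat UF.
Qed.

Lemma frame_hull Y FF B : frame Y FF -> B `<=` Z ->
  exists W, [/\ W \in FF, B `<=` W & forall U, U \in FF -> B `<=` U -> W `<=` U].
Proof.
move=> [_ [zFF _ _ iFF]] BZ.
suff h n W : #|` W| <= n -> W \in FF -> B `<=` W ->
    exists W, [/\ W \in FF, B `<=` W & forall U, U \in FF -> B `<=` U -> W `<=` U].
  exact: (h _ Z (leqnn _)).
elim: n W => [|n IH] W Wn WF BW.
  exists W; split => // U _ _; suff -> : W = fset0 by apply: fsub0set.
  by apply: cardfs0_eq; move: Wn; clear; lia.
have [h|/existsNP[U /not_implyP[UF /not_implyP[BU /negP WU]]]] :=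
    pselect (forall U, U \in FF -> B `<=` U -> W `<=` U); first by exists W.
apply: (IH (W `&` U)); last by rewrite fsubsetI BW.
- have : W `&` U `<` W.
    by rewrite fproperEneq fsubsetIl andbT; apply: contraNneq WU => /fsetIidPl.
  by move=> /fproper_ltn_card; move: Wn; clear; lia.
- exact: iFF.
Qed.

(** Sort the subsets of [E] by the smallest member of the frame containing them:
    the term of [W] is the mass of those sorted to [W], and the total mass is the
    rank of [E].  The members inside [E] contain the points spanning [E], hence by
    flatness account for at least the whole mass. *)
Lemma frame_sum_le0 Y FF E : frame Y FF -> rclosed G Z E -> spanned G Y E ->
  (\sum_(W <- undup FF | ~~ (W `<=` E))
     ((G (E `&` W))%:Z - msr G (E `&` W) (below FF W)) <= 0)%R.
Proof.
move=> fr cE /eqP sE; have [[YZ cFF sFF] [zFF oFF pFF iFF]] := fr.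
have EZ := rclosed_sub cE; pose IN := [seq W <- FF | W `<=` E].
have term W : ((G (E `&` W))%:Z - msr G (E `&` W) (below FF W) =
    \sum_(B <- fpowerset E) if (B `<=` W) && ~~ cover (below FF W) B
       then mu G B else 0)%R.
  rewrite -big_mkcond -/(wsum _ _ _).
  have e : (wsum (mu G) E (fun B => B `<=` W) = (G (E `&` W))%:Z)%R.
    by rewrite wsum_mu fsetIC.
  have m : msr G (E `&` W) (below FF W) =
      wsum (mu G) E (fun B => (B `<=` W) && cover (below FF W) B).
    rewrite (@wsum_narrow _ _ E (E `&` W)) ?fsubsetIl //; last first.
      by move=> B /andP[BW _] BE; rewrite fsubsetI BE.
    by apply: eq_wsum => B; rewrite fsubsetI => /andP[_ ->].
  rewrite m -e /wsum (bigID (cover (below FF W)) (fun B => B `<=` W)) /=.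
  by rewrite addrAC subrr add0r.
under eq_bigr do rewrite term.
rewrite exchange_big /=.
have -> : (\sum_(B <- fpowerset E) \sum_(W <- undup FF | ~~ (W `<=` E))
     (if (B `<=` W) && ~~ cover (below FF W) B then mu G B else 0) =
   \sum_(B <- fpowerset E) if ~~ cover IN B then mu G B else 0)%R.
  rewrite big_seq [RHS]big_seq; apply: eq_bigr => B; rewrite fpowersetE => BE.
  have [V [VF BV Vmin]] := frame_hull fr (fsubset_trans BE EZ).
  have e W : W \in FF -> (B `<=` W) && ~~ cover (below FF W) B = (W == V).
    move=> WF; apply/andP/eqP => [[BW /hasPn h]|->].
      have := Vmin _ WF BW; rewrite fsubEproper => /orP[/eqP//|VW].
      by have := h V; rewrite mem_filter VW VF BV => /(_ isT).
    split => //; apply/hasPn => U; rewrite mem_filter => /andP[UV UF].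
    apply/negP => /(Vmin _ UF) VU; move: UV.
    by rewrite fproperE VU andbF.
  have VuF : V \in undup FF by rewrite mem_undup.
  rewrite big_mkcond (bigD1_seq V) ?undup_uniq //= big_seq_cond big1 => [|W]; last first.
    by rewrite mem_undup => /andP[WF /negPf WV]; rewrite e // WV if_same.
  rewrite addr0 e // eqxx; congr (if ~~ _ then _ else _).
  apply/idP/hasP => [VE|[W]]; first by exists V; rewrite // mem_filter VE.
  by rewrite mem_filter => /andP[WE WF] /(Vmin _ WF)/fsubset_trans; apply.
have : (wsum (mu G) E (fun=> true) =
    msr G E IN + wsum (mu G) E (fun B => ~~ cover IN B))%R.
  by rewrite /msr /wsum (bigID (cover IN)).
rewrite (@eq_wsum _ _ _ _ (fun B => B `<=` E)) ?wsum_mu ?fsetIid; last by move=> B ->.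
rewrite -big_mkcond -/(wsum _ _ (fun B : {fset K} => ~~ cover IN B)).
have -> : msr G E IN = msr G Z IN.
  apply/esym/wsum_narrow => // B /hasP[W]; rewrite mem_filter => /andP[WE _] BW _.
  exact: fsubset_trans BW WE.
have cIN : all (rclosed G Z) IN.
  by apply/allP => W; rewrite mem_filter => /andP[_ /(allP cFF)].
have := flatZ cIN; suff : G E <= G (fcup IN) by clear; lia.
rewrite -sE; apply: dim_mono; apply/fsubsetP => y; rewrite inE => /andP[yE yY].
rewrite in_fcup; apply/hasP; exists (cl1 y); last exact/mem_cl1/(fsubsetP YZ).
by rewrite mem_filter pFF // andbT rcl_min // fsub1set.
Qed.

(** Without a defect all terms of [frame_sum_le0] are nonnegative, hence zero.  For
    a smallest [W] meeting [E] in a flat that is not spanned, the flat generated by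
    the points of that intersection has smaller rank but contains the traces of
    all members below [W], so it is a defect after all. *)
Lemma bad_defect Y FF E W0 : frame Y FF -> rclosed G Z E -> spanned G Y E ->
  W0 \in FF -> ~~ spanned G Y (W0 `&` E) ->
  exists W N, [/\ W \in FF, rclosed G Z N, N `<` W
    & ((G N)%:Z < msr G N (below FF W))%R].
Proof.
move=> fr cE sE W0F; apply: contraNP => noDefect.
have [[YZ cFF sFF] [zFF oFF pFF iFF]] := fr.
have H W N : W \in FF -> rclosed G Z N -> N `<` W ->
    (msr G N (below FF W) <= (G N)%:Z)%R.
  move=> WF cN NW; rewrite leNgt; apply/negP => lt.
  by apply: noDefect; exists W, N.
have EW W : W \in FF -> ~~ (W `<=` E) -> E `&` W `<` W.
  move=> WF WE; rewrite fproperEneq fsubsetIr andbT.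
  by apply: contraNneq WE => /fsetIidPr.
have term0 W : W \in FF -> ~~ (W `<=` E) ->
    ((G (E `&` W))%:Z = msr G (E `&` W) (below FF W))%R.
  move=> WF WE; have WuF : W \in undup FF by rewrite mem_undup.
  have := frame_sum_le0 fr cE sE.
  have ge0 V : V \in FF -> ~~ (V `<=` E) ->
      (0 <= (G (E `&` V))%:Z - msr G (E `&` V) (below FF V))%R.
    by move=> VF VE; rewrite subr_ge0 H // ?EW // rclosedI // (allP cFF).
  rewrite big_mkcond (bigD1_seq W) ?undup_uniq //= WE => le0.
  apply/eqP; rewrite -subr_eq0 eq_le ge0 // andbT; apply: le_trans le0.
  rewrite lerDl big_seq_cond; apply: sumr_ge0 => V /andP[].
  by rewrite mem_undup => VF _; case: ifP => // /(ge0 V VF).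
suff h n W : #|` W| <= n -> W \in FF -> spanned G Y (W `&` E).
  exact: (h _ W0 (leqnn _)).
elim: n W => [|n IH] W Wn WF.
  have -> : W = fset0 by apply: cardfs0_eq; move: Wn; clear; lia.
  by rewrite fset0I /spanned fset0I.
case: (boolP (W `<=` E)) => [/fsetIidPl ->|WE]; first exact: (allP sFF).
have cW := allP cFF _ WF; have cEW := rclosedI cE cW.
apply: contraT => nsEW.
have YEZ : E `&` W `&` Y `<=` Z by apply: fsubset_trans (fsubsetIr _ _) YZ.
pose Q := rcl G Z (E `&` W `&` Y).
have cQ : rclosed G Z Q by apply: rclosed_rcl.
have QEW : Q `<=` E `&` W by apply: rcl_min => //; apply: fsubsetIl.
have ltQ : G Q < G (E `&` W).
  rewrite dim_rcl // ltn_neqAle dim_mono ?fsubsetIl // andbT.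
  by move: nsEW; rewrite /spanned [W `&` E]fsetIC.
have QW : Q `<` W by apply: fsub_proper_trans QEW (EW _ WF WE).
have := H W Q WF cQ QW; suff <- : msr G (E `&` W) (below FF W) = msr G Q (below FF W).
  by rewrite -term0 // lez_nat; move: ltQ; clear; lia.
apply: wsum_narrow => // B /hasP[U]; rewrite mem_filter => /andP[UW UF] BU.
rewrite fsubsetI => /andP[BE _].
have sU : spanned G Y (U `&` E).
  by apply: IH => //; have := fproper_ltn_card UW; move: Wn; clear; lia.
have cU : rclosed G Z (U `&` E) by apply: rclosedI => //; apply: (allP cFF).
have := spannedP cU YZ sU => eU.
have : B `<=` U `&` E by rewrite fsubsetI BU.
rewrite -eU => /fsubset_trans; apply; apply: rcl_mono; apply: fsetSI.
by rewrite fsetIC fsetIS // fproper_sub.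
Qed.

(** Let [E1] and [E2] be spanned flats with an intersection that is not spanned.
    Either [E1] meets some member of the frame in a flat that is not spanned, or
    its traces can be added by [frame_add], and then [E2] meets the new member [E1]
    in such a flat.  In both cases [bad_defect] gives a defect to repair. *)
Lemma frame_step Y FF : frame Y FF -> ~ fstar G Y Z ->
  exists Y' FF' j, [/\ frame Y' FF', Y `<=` Y',
    #|` Y'| <= #|` Y| + (size FF).*2 * G Z,
    size FF' <= (size FF).*2.*2 + #|` Y'|
    & [/\ j < G Z, (pot FF' j < pot FF j)%R
        & forall i, j < i -> (pot FF' i <= pot FF i)%R]].
Proof.
move=> fr nstar; have [[YZ cFF sFF] _] := fr.
have [E1 [E2 [c1 c2 s1 s2 ns]]] : exists E1 E2, [/\ rclosed G Z E1,
    rclosed G Z E2, spanned G Y E1, spanned G Y E2 & ~~ spanned G Y (E1 `&` E2)].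
  apply: contra_notP nstar => h E1 E2 c1 c2 s1 s2.
  by apply: contraT => ns; case: h; exists E1, E2.
have [[W [WF nsW]]|/forallNP good] :=
    pselect (exists W, W \in FF /\ ~~ spanned G Y (W `&` E1)).
  have [V [N [VF cN NV lt]]] := bad_defect fr c1 s1 WF nsW.
  have [Y' [FF' [j [fr' YY' sY sF [jZ pj pi]]]]] := frame_improve fr VF cN NV lt.
  exists Y', FF', j; split => //.
  - by apply: leq_trans sY _; rewrite leq_add2l leq_mul2r -addnn leq_addr orbT.
  - by move: sF; clear; lia.
  - by split => // i /pi ->.
have sE1 : {in FF, forall U, spanned G Y (U `&` E1)}.
  by move=> U UF; apply: contraT => ns'; case: (good U).
have [fr1 E1F p1] := frame_add fr c1 sE1.
have [V [N [VF cN NV lt]]] := bad_defect fr1 c2 s2 E1F ns.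
have [Y' [FF' [j [fr' YY' sY sF [jZ pj pi]]]]] := frame_improve fr1 VF cN NV lt.
rewrite size_cat size_map addnn in sY sF.
exists Y', FF', j; split => //; first by move: sF; clear; lia.
split => //; first exact: lt_le_trans pj (p1 j).
by move=> i /pi ->.
Qed.

End Hull.

(** * Hulls of bounded size *)

(** The largest index is the most significant one; the entries below the one that
    drops are unconstrained, and those above it may drop as well. *)
Lemma lex_ind n (P : (nat -> nat) -> Prop) :
  (forall v, (forall w, (exists j, [/\ j <= n, w j < v j
      & forall i, j < i -> i <= n -> w i <= v i]) -> P w) -> P v) ->
  forall v, P v.
Proof.
elim: n P => [|n IHn] P step v.
  move: {2}(v 0) (leqnn (v 0)) => k; elim: k v => [|k IH] v vk; apply: step.
    by move=> w [j []]; rewrite leqn0 => /eqP ->; lia.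
  by move=> w [j []]; rewrite leqn0 => /eqP -> wv _; apply: IH; lia.
move: {2}(v n.+1) (leqnn (v n.+1)) => k; elim/ltn_ind: k v => k IHk.
suff h : forall v, v n.+1 <= k -> P v by exact: h.
apply: IHn => v IHv vk; apply: step => w [j [jn wv wi]].
have [jle|jgt] := leqP j n; last first.
  have ej : j = n.+1 by lia.
  rewrite ej in wv.
  by apply: (IHk (w n.+1)); lia.
apply: IHv; first by exists j; split => // i ji in_; apply: wi; lia.
by apply: leq_trans vk; apply: wi.
Qed.

(** One application of [frame_step] multiplies the sizes by a fixed factor and
    leads below one of finitely many smaller vectors, one for each level that may
    drop; the bound is the maximum of the bounds for these, estimated by a sum. *)
Lemma frame_star_bound n (v : nat -> nat) : forall s, exists b,
  forall (K : choiceType) (G : pregeom K) (Z Y : {fset K}) (FF : seq {fset K}),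
    fflat G Z -> G Z <= n -> frame G Z Y FF -> #|` Y| <= s -> size FF <= s ->
    (forall i, i <= n -> (pot G Z FF i <= (v i)%:Z)%R) ->
  exists Y', [/\ Y `<=` Y', Y' `<=` Z, fstar G Y' Z & #|` Y'| <= b].
Proof.
elim/(@lex_ind n): v => v IH s.
(* [t] bounds the sizes after one step, hence also the new potentials. *)
pose t := s * (n.*2 + 5).
pose next j i := if i < j then t else if i == j then (v j).-1 else v i.
have {}IH j : exists b, j <= n -> 0 < v j ->
    forall (K : choiceType) (G : pregeom K) (Z Y : {fset K}) (FF : seq {fset K}),
    fflat G Z -> G Z <= n -> frame G Z Y FF -> #|` Y| <= t -> size FF <= t ->
    (forall i, i <= n -> (pot G Z FF i <= (next j i)%:Z)%R) ->
  exists Y', [/\ Y `<=` Y', Y' `<=` Z, fstar G Y' Z & #|` Y'| <= b].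
  have [/andP[jn vj]|/negP nj] := boolP ((j <= n) && (0 < v j)); last first.
    by exists 0 => jn vj; case: nj; rewrite jn.
  have [|b hb] := IH (next j) _ t; last by exists b => _ _; exact: hb.
  exists j; split => //; first by rewrite /next ltnn eqxx; lia.
  by move=> i ji _; rewrite /next ltnNge (ltnW ji) /= gtn_eqF.
have [b hb] := choice IH.
exists (s + \sum_(j < n.+1) b j) => K G Z Y FF fZ Zn fr Ys Fs pv.
have [[YZ _ _] _] := fr.
have [sY|nsY] := pselect (fstar G Y Z).
  by exists Y; split => //; apply: leq_trans Ys (leq_addr _ _).
have [Y' [FF' [j [fr' YY' sY' sF' [jZ pj pi]]]]] := frame_step fZ fr nsY.
have jn : j <= n by apply: leq_trans (ltnW jZ) Zn.
have Y't : #|` Y'| <= s + s.*2 * n.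
  apply: leq_trans sY' _; apply: leq_add => //.
  by apply: leq_mul => //; rewrite leq_double.
have F't : size FF' <= t.
  move: sF' Fs Y't; rewrite /t; clear; nia.
have Yt : #|` Y'| <= t by move: Y't; rewrite /t; clear; nia.
have pj0 := pot_ge0 fZ j fr'.
have pvj := pv j jn.
have vj : 0 < v j by move: pj0 pj pvj; clear; lia.
have [|Y1 [Y'Y1 Y1Z sY1 cY1]] := hb j jn vj K G Z Y' FF' fZ Zn fr' Yt F't.
  move=> i in_; rewrite /next; case: ltngtP => [ij|ji|ij].
  - by apply: le_trans (pot_le fZ i fr') _; rewrite lez_nat.
  - by apply: le_trans (pi i ji) (pv i in_).
  - by rewrite ij; move: pj pvj vj; clear; lia.
exists Y1; split => //; first exact: fsubset_trans YY' Y'Y1.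
apply: leq_trans cY1 _; have jn1 : j < n.+1 by [].
by rewrite (bigD1 (Ordinal jn1)) //= addnCA leq_addr.
Qed.

Lemma rclosed_star (K : choiceType) (G : pregeom K) (Z T : {fset K}) :
  rclosed G Z T -> fstar G T Z.
Proof.
move=> cT W1 W2 c1 c2 /eqP s1 _.
have WT : W1 `&` T = W1.
  by apply: rclosed_eq (rclosedI c1 cT) (rclosed_sub c1) (fsubsetIl _ _) s1.
by rewrite /spanned fsetIAC WT.
Qed.

Lemma hull_exists n : exists b,
  forall (K : choiceType) (G : pregeom K) (Z X : {fset K}),
    fflat G Z -> X `<=` Z -> #|` X| <= n ->
  exists Y, [/\ X `<=` Y, Y `<=` Z, fstar G Y Z & #|` Y| <= b].
Proof.
have [b hb] := frame_star_bound n (fun=> n) n.+2.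
exists b => K G Z X fZ XZ Xn.
pose T := rcl G Z X; have cT : rclosed G Z T := rclosed_rcl G XZ.
have TZ := rclosed_sub cT; have sT := rclosed_star cT.
have fT : fflat G T := fflat_narrow TZ sT fZ.
have XT : X `<=` T := sub_rcl G XZ.
have GT : G T = G X := dim_rcl G XZ.
pose FF := [:: T, rcl G T fset0 & [seq rcl G T [fset x] | x <- X]].
have PF x : x \in X -> rcl G T [fset x] \in FF.
  by move=> xX; rewrite !inE (map_f (fun x => rcl G T [fset x])) ?orbT.
have cFF : all (rclosed G T) FF.
  rewrite /= rclosed_full rclosed_rcl ?fsub0set //=.
  by apply/allP => _ /mapP[x xX ->]; apply/rclosed_cl1/(fsubsetP XT).
have fr : frame G T X FF.
  split; split => //.
  - have XX : T `&` X = X by apply/fsetIidPr.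
    rewrite /= {1}/spanned XX GT eqxx /=; apply/andP; split.
      by rewrite /spanned eqn_leq dim_mono ?fsubsetIl //= dim_rcl ?fsub0set // dim_fset0.
    apply/allP => _ /mapP[x xX ->]; have xT := fsubsetP XT _ xX.
    rewrite /spanned eqn_leq dim_mono ?fsubsetIl //=.
    by rewrite {1}dim_rcl ?fsub1set // dim_mono // fsub1set inE mem_cl1.
  - exact: mem_head.
  - by rewrite inE mem_head orbT.
  move=> U V UF VF; have cU := allP cFF _ UF; have cV := allP cFF _ VF.
  have zero W : rclosed G T W -> rcl G T fset0 `&` W = rcl G T fset0.
    by move=> cW; apply/fsetIidPl; apply: rcl_min => //; apply: fsub0set.
  have pts x W : x \in X -> rclosed G T W -> rcl G T [fset x] `&` W \in FF.
    move=> xX cW; have [-> | ->] := atom_meet cW (fsubsetP XT _ xX).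
      exact: PF.
    by rewrite !inE eqxx orbT.
  move: (UF) (VF); rewrite {1 2}/FF 4!inE.
  case/or3P=> [/eqP->|/eqP->|/mapP[x xX ->]].
  - by move=> _; rewrite (fsetIidPr (rclosed_sub cV)).
  - by move=> _; rewrite zero // !inE eqxx orbT.
  - by move=> _; apply: pts.
have [||||Y [XY YT sY cY]] := hb K G T X FF fT _ fr _ _ _.
- by rewrite GT (leq_trans (dim_card _ _)).
- by apply: leq_trans Xn _; lia.
- by rewrite /= size_map !ltnS.
- by move=> i _; apply: le_trans (pot_le fT i fr) _; rewrite lez_nat.
exists Y; split => //; first exact: fsubset_trans YT TZ.
exact: fstar_trans sT.
Qed.

(** * The amalgam *)

Lemma exists_min (T : Type) (P : T -> Prop) (f : T -> nat) :
  (exists x, P x) -> exists x, P x /\ forall y, P y -> f x <= f y.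
Proof.
move=> [x Px]; move: {2}(f x) (leqnn (f x)) => n.
elim: n x Px => [|n IH] x Px xn; first by exists x; split => // y _; lia.
have [h|/existsNP[y /not_implyP[Py /negP]]] := pselect (forall y, P y -> f x <= f y).
  by exists x.
by rewrite -ltnNge => yx; apply: (IH y Py); lia.
Qed.

Lemma dim_marginal (K : choiceType) (G : pregeom K) (A B : {fset K}) x :
  A `<=` B -> G (x |` B) + G A <= G (x |` A) + G B.
Proof.
move=> AB; have := dim_submod_sub G (fsubsetU1 x A) AB.
suff -> : x |` A `|` B = x |` B by [].
by fset_bool.
Qed.

(** The flats of the union of [A] and [H] have the rank that they have in a free
    amalgam of [A] and [H] over the intersection. *)
Definition modular_over (K : choiceType) (D : pregeom K) (A H : {fset K}) : Prop :=
  forall E, rclosed D (A `|` H) E ->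
    D E + D (E `&` (A `&` H)) = D (E `&` A) + D (E `&` H).

Lemma modular_msr (K : choiceType) (D : pregeom K) (A H : {fset K}) :
  modular_over D A H ->
  forall SS, all (rclosed D (A `|` H)) SS ->
  (msr D (A `|` H) SS = msr D A SS + msr D H SS - msr D (A `&` H) SS)%R.
Proof.
move=> rank SS cSS; set U := A `|` H; set F := A `&` H.
pose w B := (mu D B - (if B `<=` A then mu D B else 0)
   - ((if B `<=` H then mu D B else 0) - (if B `<=` F then mu D B else 0)))%R.
have AU : A `<=` U by exact: fsubsetUl.
have HU : H `<=` U by exact: fsubsetUr.
have FU : F `<=` U by apply: fsubset_trans AU; apply: fsubsetIl.
have wP P : (wsum w U P = wsum (mu D) U P - wsum (mu D) A P
    - (wsum (mu D) H P - wsum (mu D) F P))%R.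
  by rewrite !wsumB !wsum_weight.
have := @valuation_ext _ w U (rclosed D U) (@rclosedI _ _ _) _ SS cSS.
rewrite wP -/(msr _ _ _) -/(msr _ _ _) -/(msr _ _ _) -/(msr _ _ _).
move=> h; suff /h : forall S, rclosed D U S -> wsum w U (fun B => B `<=` S) = 0%R.
  by clear; lia.
move=> S cS; rewrite wP !wsum_mu (fsetIidPl (rclosed_sub cS)).
by have := rank _ cS; rewrite -/F; clear; lia.
Qed.

Section Amalgam.
Variables (K : choiceType) (GA GH : pregeom K) (A H : {fset K}).
Implicit Types (E S W X Y : {fset K}) (SS : seq {fset K}).
Local Notation F := (A `&` H).
Local Notation U := (A `|` H).
Hypothesis agree : forall X, X `<=` F -> GA X = GH X.
Hypothesis flatA : fflat GA A.
Hypothesis flatH : fflat GH H.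
Hypothesis strongF : fstrong GH F H.

(** The rank of [Y] in the free amalgam when the traces of [Y] are closed; the
    subtraction is never truncated. *)
Definition phi Y : nat := GA (Y `&` A) + GH (Y `&` H) - GA (Y `&` F).

Lemma phiE Y : phi Y + GA (Y `&` F) = GA (Y `&` A) + GH (Y `&` H).
Proof.
rewrite subnK //; apply: leq_trans (leq_addr _ _).
by apply: dim_mono; fset_bool.
Qed.

Lemma phi_geA Y : GA (Y `&` A) <= phi Y.
Proof.
have := phiE Y; rewrite agree ?fsubsetIr //.
have : GH (Y `&` F) <= GH (Y `&` H) by apply: dim_mono; fset_bool.
by clear; lia.
Qed.

Lemma phi_geH Y : GH (Y `&` H) <= phi Y.
Proof.
have := phiE Y; have : GA (Y `&` F) <= GA (Y `&` A) by apply: dim_mono; fset_bool.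
by clear; lia.
Qed.

Lemma phi_U1A Y x : x \in A -> GA (x |` (Y `&` A)) = GA (Y `&` A) ->
  phi (x |` Y) <= phi Y.
Proof.
move=> xA e; have := phiE Y; have := phiE (x |` Y).
have -> : (x |` Y) `&` A = x |` (Y `&` A).
  by apply/fsetP => y; rewrite !inE; case: eqP => // ->.
rewrite e; case: (boolP (x \in H)) => xH.
  have -> : (x |` Y) `&` F = x |` (Y `&` F).
    by apply/fsetP => y; rewrite !inE; case: eqP => // ->; rewrite xA xH.
  have -> : (x |` Y) `&` H = x |` (Y `&` H).
    by apply/fsetP => y; rewrite !inE; case: eqP => // ->.
  have FH : Y `&` F `<=` Y `&` H by fset_bool.
  have := dim_marginal GH x FH.
  have <- := agree (fsubsetIr Y F); have <- : GA (x |` (Y `&` F)) = GH (x |` (Y `&` F)).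
    by apply: agree; rewrite fsubUset fsub1set inE xA xH fsubsetIr.
  by clear; lia.
have nx V : V `<=` H -> (x |` Y) `&` V = Y `&` V.
  move=> VH; apply/fsetP => y; rewrite !inE; case: eqP => // -> /=.
  by case: (boolP (x \in V)) => [/(fsubsetP VH)|]; rewrite ?(negPf xH) ?andbF.
by rewrite !nx ?fsubsetIr //; clear; lia.
Qed.

Lemma phi_U1H Y x : x \in H -> GH (x |` (Y `&` H)) = GH (Y `&` H) ->
  phi (x |` Y) <= phi Y.
Proof.
move=> xH e; have := phiE Y; have := phiE (x |` Y).
have -> : (x |` Y) `&` H = x |` (Y `&` H).
  by apply/fsetP => y; rewrite !inE; case: eqP => // ->.
rewrite e; case: (boolP (x \in A)) => xA.
  have -> : (x |` Y) `&` F = x |` (Y `&` F).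
    by apply/fsetP => y; rewrite !inE; case: eqP => // ->; rewrite xA xH.
  have -> : (x |` Y) `&` A = x |` (Y `&` A).
    by apply/fsetP => y; rewrite !inE; case: eqP => // ->.
  have FA : Y `&` F `<=` Y `&` A by fset_bool.
  by have := dim_marginal GA x FA; clear; lia.
have nx V : V `<=` A -> (x |` Y) `&` V = Y `&` V.
  move=> VA; apply/fsetP => y; rewrite !inE; case: eqP => // -> /=.
  by case: (boolP (x \in V)) => [/(fsubsetP VA)|]; rewrite ?(negPf xA) ?andbF.
by rewrite !nx ?fsubsetIl //; clear; lia.
Qed.

Lemma phi_U1 Y x : x \in U -> phi (x |` Y) <= (phi Y).+1.
Proof.
have mA := dim_fsetU1 GA (Y `&` A) x; have mH := dim_fsetU1 GH (Y `&` H) x.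
case: (boolP (x \in A)) => xA.
  case: (eqVneq (GA (x |` (Y `&` A))) (GA (Y `&` A))) => [/(phi_U1A xA) h|neA] _.
    exact: leqW.
  have := phiE Y; have := phiE (x |` Y).
  have -> : (x |` Y) `&` A = x |` (Y `&` A).
    by apply/fsetP => y; rewrite !inE; case: eqP => // ->.
  case: (boolP (x \in H)) => xH.
    have -> : (x |` Y) `&` F = x |` (Y `&` F).
      by apply/fsetP => y; rewrite !inE; case: eqP => // ->; rewrite xA xH.
    have -> : (x |` Y) `&` H = x |` (Y `&` H).
      by apply/fsetP => y; rewrite !inE; case: eqP => // ->.
    have FA : Y `&` F `<=` Y `&` A by fset_bool.
    have := dim_marginal GA x FA.
    have FH : Y `&` F `<=` Y `&` H by fset_bool.
    by move: mA mH neA; clear; lia.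
  have nx V : V `<=` H -> (x |` Y) `&` V = Y `&` V.
    move=> VH; apply/fsetP => y; rewrite !inE; case: eqP => // -> /=.
    by case: (boolP (x \in V)) => [/(fsubsetP VH)|]; rewrite ?(negPf xH) ?andbF.
  by rewrite !nx ?fsubsetIr //; move: mA; clear; lia.
rewrite inE (negPf xA) /= => xH.
have := phiE Y; have := phiE (x |` Y).
have -> : (x |` Y) `&` H = x |` (Y `&` H).
  by apply/fsetP => y; rewrite !inE; case: eqP => // ->.
have nx V : V `<=` A -> (x |` Y) `&` V = Y `&` V.
  move=> VA; apply/fsetP => y; rewrite !inE; case: eqP => // -> /=.
  by case: (boolP (x \in V)) => [/(fsubsetP VA)|]; rewrite ?(negPf xA) ?andbF.
by rewrite !nx ?fsubsetIl //; move: mH; clear; lia.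
Qed.

Definition biclosed Y : bool :=
  [&& Y `<=` U, rclosed GA A (Y `&` A) & rclosed GH H (Y `&` H)].

(** The traces on [A] are replaced by the single flat [E0] that they generate,
    which costs nothing as [A] is flat.  The trace of [E0] on the common part
    generates a flat [C] of [H]; since the common part is strong in [H], adding
    [C] to the traces on [H] costs at most what the sum over the common part gains
    when its members are replaced by the trace of [E0].  Finally flatness of [H]
    replaces the enlarged family in [H] by the flat [EH] that it generates, and
    submodularity in [A] compares the result with [phi] of the union. *)
Lemma amalgam_flat SS : all biclosed SS ->
  exists Y, [/\ fcup SS `<=` Y, Y `<=` U
    & ((phi Y)%:Z <= msr GA A SS + msr GH H SS - msr GA F SS)%R].
Proof.
move=> bSS.
pose SA := [seq V `&` A | V <- SS]; pose SH := [seq V `&` H | V <- SS].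
have cSA : all (rclosed GA A) SA.
  by apply/allP => _ /mapP[V /(allP bSS)/and3P[_ cV _] ->].
have cSH : all (rclosed GH H) SH.
  by apply/allP => _ /mapP[V /(allP bSS)/and3P[_ _ cV] ->].
have sSA : fcup SA `<=` A.
  by rewrite fcup_sub; apply/allP => V /(allP cSA)/rclosed_sub.
have sSH : fcup SH `<=` H.
  by rewrite fcup_sub; apply/allP => V /(allP cSH)/rclosed_sub.
pose E0 := rcl GA A (fcup SA); have cE0 : rclosed GA A E0 := rclosed_rcl _ sSA.
have E0A := rclosed_sub cE0.
have hA : ((GA E0)%:Z <= msr GA A SS)%R.
  by rewrite dim_rcl // -(@msr_trace _ _ A A) //; apply: flatA.
pose C := rcl GH H (E0 `&` F).
have E0F : E0 `&` F `<=` H by fset_bool.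
have cC : rclosed GH H C := rclosed_rcl _ E0F.
have GC : GH C = GA (E0 `&` F) by rewrite dim_rcl // agree // fsubsetIr.
have CH := rclosed_sub cC.
have E0C : E0 `&` F `<=` C := sub_rcl _ E0F.
have cCSH : all (rclosed GH H) (C :: SH) by rewrite /= cC cSH.
have hC : (msr GH H (C :: SH) <= (GA (E0 `&` F))%:Z + msr GH H SS - msr GA F SS)%R.
  rewrite msr_cons (fsetIidPl CH) GC (@msr_trace _ _ H H) //.
  have [cTT ->] := msr_narrow cC cSH; have := strongF cTT.
  set TT := map _ SH; suff -> : msr GH F TT = msr GA F SS by clear; lia.
  rewrite (agree_msr agree SS (fsubset_refl F)); apply: eq_msr => B BF.
  rewrite !cover_map; have -> /= : B `<=` H.
    by apply: fsubset_trans BF (fsubsetIr _ _).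
  apply: andb_idl => /hasP[V VSS BV]; apply: fsubset_trans E0C.
  have BA := fsubset_trans BF (fsubsetIl _ _).
  rewrite fsubsetI BF andbT; apply: fsubset_trans (sub_rcl _ sSA).
  have : B `<=` V `&` A by rewrite fsubsetI BV BA.
  move=> /fsubset_trans; apply.
  by apply: fcup_sup; apply: (map_f (fun V => V `&` A)).
have sCH : fcup (C :: SH) `<=` H.
  by rewrite fcup_sub; apply/allP => V /(allP cCSH)/rclosed_sub.
pose EH := rcl GH H (fcup (C :: SH)).
have cEH : rclosed GH H EH := rclosed_rcl _ sCH.
have hH : ((GH EH)%:Z <= msr GH H (C :: SH))%R by rewrite dim_rcl //; apply: flatH.
have EHH := rclosed_sub cEH.
have CEH : C `<=` EH.
  by apply: fsubset_trans (sub_rcl _ sCH); apply: fcup_sup; apply: mem_head.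
exists (E0 `|` EH); split.
- rewrite fcup_sub; apply/allP => V VSS; have /and3P[VU _ _] := allP bSS _ VSS.
  have VA : V `&` A `<=` E0.
    apply: fsubset_trans (sub_rcl _ sSA).
    by apply: fcup_sup; apply: (map_f (fun V => V `&` A)).
  have VH : V `&` H `<=` EH.
    apply: fsubset_trans (sub_rcl _ sCH); apply: fcup_sup.
    by rewrite inE (map_f (fun V => V `&` H)) ?orbT.
  by clear -VU VA VH; fset_bool.
- by clear -E0A EHH; fset_bool.
have eA : (E0 `|` EH) `&` A = E0 `|` (EH `&` F) by clear -E0A EHH; fset_bool.
have eH : (E0 `|` EH) `&` H = EH by clear -E0A EHH E0C CEH; fset_bool.
have eF : (E0 `|` EH) `&` F = EH `&` F by clear -E0A EHH E0C CEH; fset_bool.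
have := phiE (E0 `|` EH); rewrite eA eH eF.
have S1 : E0 `&` F `<=` E0 by exact: fsubsetIl.
have S2 : E0 `&` F `<=` EH `&` F by clear -E0C CEH; fset_bool.
by have := dim_submod_sub GA S1 S2; move: hA hC hH; clear; lia.
Qed.

(** A minimiser of largest cardinality has closed traces, because absorbing a
    point of the closure of a trace does not increase [phi]. *)
Lemma phi_min X : exists Y, [/\ biclosed Y, X `&` U `<=` Y
  & forall Y', X `&` U `<=` Y' -> Y' `<=` U -> phi Y <= phi Y'].
Proof.
pose P Y := X `&` U `<=` Y /\ Y `<=` U.
pose Q Y := P Y /\ forall Y', P Y' -> phi Y <= phi Y'.
have [|Y0 [P0 min0]] := @exists_min _ P phi.
  by exists U; split; [apply: fsubsetIr|].
have [|Y [[[XY YU] minY] maxY]] := @exists_min _ Q (fun Y => #|` U| - #|` Y|).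
  by exists Y0.
exists Y; split => //; last by move=> Y' h1 h2; apply: minY.
have absorb x : x \in U -> phi (x |` Y) <= phi Y -> x \in Y.
  move=> xU le; apply: contraT => xY.
  have P1 : P (x |` Y).
    split; first by apply: fsubset_trans XY (fsubsetU1 _ _).
    by rewrite fsubUset fsub1set xU.
  have Q1 : Q (x |` Y) by split => // Y' /minY; apply: leq_trans.
  have := maxY _ Q1; have := fsubset_leq_card (proj2 P1).
  by rewrite cardfsU1 xY /=; clear; lia.
rewrite /biclosed YU /= /rclosed !fsubsetIr /=; apply/andP.
split; apply/fsubsetP => x; rewrite in_rcl => /andP[xZ /eqP e]; rewrite inE xZ andbT.
  by apply: absorb; rewrite ?inE ?xZ // phi_U1A.
by apply: absorb; rewrite ?inE ?xZ ?orbT // phi_U1H.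
Qed.

Definition best X : {fset K} := projT1 (cid (phi_min X)).

Lemma bestP X : [/\ biclosed (best X), X `&` U `<=` best X
  & forall Y', X `&` U `<=` Y' -> Y' `<=` U -> phi (best X) <= phi Y'].
Proof. exact: (projT2 (cid (phi_min X))). Qed.

Definition am_dim X := phi (best X).

Lemma am_dim_le X Y : X `&` U `<=` Y -> Y `<=` U -> am_dim X <= phi Y.
Proof. by have [_ _] := bestP X; apply. Qed.

Lemma best_sub X : best X `<=` U.
Proof. by have [/and3P[]] := bestP X. Qed.

Lemma sub_best X : X `&` U `<=` best X.
Proof. by have [] := bestP X. Qed.

Lemma am_dim0 : am_dim fset0 = 0.
Proof.
apply/eqP; rewrite -leqn0; apply: leq_trans (@am_dim_le _ fset0 _ _) _ => //.
  by rewrite fset0I.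
by rewrite /phi !fset0I !dim_fset0.
Qed.

Lemma am_dimU1 X x : am_dim X <= am_dim (x |` X) <= (am_dim X).+1.
Proof.
apply/andP; split.
  apply: am_dim_le (best_sub _); apply: fsubset_trans (sub_best _).
  exact/fsetSI/fsubsetU1.
case: (boolP (x \in U)) => xU.
  apply: leq_trans (phi_U1 (best X) xU); apply: am_dim_le; last first.
    by rewrite fsubUset fsub1set xU best_sub.
  apply: fsubset_trans (fsetUS _ (sub_best X)).
  by apply/fsubsetP => y; rewrite !inE => /andP[/orP[->//|->] ->]; rewrite orbT.
apply: leqW; apply: am_dim_le (best_sub _); apply: fsubset_trans (sub_best X).
apply/fsubsetP => y; rewrite inE => /andP[]; rewrite inE => /orP[|yX yU].
  by rewrite inE => /eqP ->; rewrite (negPf xU).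
by rewrite inE yX.
Qed.

Lemma am_submod X Y :
  am_dim (X `|` Y) + am_dim (X `&` Y) <= am_dim X + am_dim Y.
Proof.
pose V := best X; pose W := best Y.
have bSS : all biclosed [:: V; W].
  by have [+ _ _] := bestP X; have [+ _ _] := bestP Y; rewrite /= => -> ->.
have [T [VWT TU hT]] := amalgam_flat bSS.
have h1 : am_dim (X `|` Y) <= phi T.
  apply: am_dim_le TU; apply: fsubset_trans VWT.
  have := fcup_sup (mem_head V [:: W]).
  have /fcup_sup : W \in [:: V; W] by rewrite !inE eqxx orbT.
  have := sub_best X; have := sub_best Y; rewrite -/V -/W.
  by move=> a1 a2 a3 a4; clear -a1 a2 a3 a4; fset_bool.
have h2 : am_dim (X `&` Y) <= phi (V `&` W).
  have := sub_best X; have := sub_best Y; have := best_sub X.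
  rewrite -/V -/W => a1 a2 a3; apply: am_dim_le; clear -a1 a2 a3; fset_bool.
have := phiE V; have := phiE W; have := phiE (V `&` W).
move: hT h1 h2; rewrite !msr2 /am_dim -/V -/W; clear.
have e B : V `&` W `&` B = V `&` W `&` B by []. lia.
Qed.

Definition amalgam : pregeom K := Pregeom am_dim0 am_dimU1 am_submod.
Local Notation D := amalgam.

Lemma amalgam_le Y : Y `<=` U -> D Y <= phi Y.
Proof. by move=> YU; apply: am_dim_le => //; apply: fsubsetIl. Qed.

Lemma amalgamA X : X `<=` A -> D X = GA X.
Proof.
move=> XA; apply/eqP; rewrite eqn_leq; apply/andP; split.
  apply: leq_trans (amalgam_le _) _; first by clear -XA; fset_bool.
  have := phiE X; rewrite (fsetIidPl XA).
  have -> : X `&` F = X `&` H by clear -XA; fset_bool.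
  by rewrite (agree (X := X `&` H)); [clear; lia|clear -XA; fset_bool].
apply: leq_trans (phi_geA (best X)); apply: dim_mono.
by have := sub_best X => h; clear -h XA; fset_bool.
Qed.

Lemma amalgamH X : X `<=` H -> D X = GH X.
Proof.
move=> XH; apply/eqP; rewrite eqn_leq; apply/andP; split.
  apply: leq_trans (amalgam_le _) _; first by clear -XH; fset_bool.
  have := phiE X; rewrite (fsetIidPl XH).
  have -> : X `&` F = X `&` A by clear -XH; fset_bool.
  by clear; lia.
apply: leq_trans (phi_geH (best X)); apply: dim_mono.
by have := sub_best X => h; clear -h XH; fset_bool.
Qed.

Lemma amalgam_rank : modular_over D A H.
Proof.
move=> E cE; have EU := rclosed_sub cE.
have eE : E = best E.
  apply: rclosed_eq cE (best_sub E) _ _.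
    by have := sub_best E; rewrite (fsetIidPl EU).
  apply/eqP; rewrite eqn_leq (amalgam_le (best_sub E)) andbT.
  by apply: dim_mono; have := sub_best E; rewrite (fsetIidPl EU).
have -> : D E = phi E by rewrite {2}eE.
have FA : E `&` F `<=` A by clear; fset_bool.
by rewrite (amalgamA FA) phiE amalgamA ?fsubsetIr // amalgamH ?fsubsetIr.
Qed.

Lemma amalgam_msr SS : all (rclosed D U) SS ->
  (msr D U SS = msr D A SS + msr D H SS - msr D F SS)%R.
Proof. exact: modular_msr amalgam_rank SS. Qed.

Lemma amalgam_biclosed E : rclosed D U E -> biclosed E.
Proof.
move=> cE; have EU := rclosed_sub cE; rewrite /biclosed EU.
have eA X : X `<=` A -> D X = GA X := @amalgamA X.
have eH X : X `<=` H -> D X = GH X := @amalgamH X.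
rewrite -(agree_rclosed eA) -(agree_rclosed eH).
by rewrite !(rclosed_trace _ cE) ?fsubsetUl ?fsubsetUr.
Qed.

Lemma amalgam_fflat : fflat D U.
Proof.
move=> SS cSS; have bSS : all biclosed SS.
  by apply/allP => E /(allP cSS); apply: amalgam_biclosed.
have [Y [SY YU hY]] := amalgam_flat bSS.
have eA X : X `<=` A -> D X = GA X := @amalgamA X.
have eH X : X `<=` H -> D X = GH X := @amalgamH X.
rewrite amalgam_msr // (agree_msr eA) // (agree_msr eH) // (agree_msr eA) ?fsubsetIl //.
by have := leq_trans (dim_mono D SY) (amalgam_le YU); move: hY; clear; lia.
Qed.

(** By [amalgam_msr] the two sums differ by the quantity that is nonnegative
    because the common part is strong in [H]. *)
Lemma amalgam_fstrongA : fstrong D A U.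
Proof.
move=> SS cSS; rewrite amalgam_msr //.
have eH X : X `<=` H -> GH X = D X by move=> XH; rewrite amalgamH.
have sF := agree_fstrong eH (fsubsetIr _ _) strongF.
have := sF _ (rclosed_traces (fsubsetUr A H) cSS).
by rewrite !msr_trace ?fsubsetIr //; clear; lia.
Qed.

Lemma amalgam_fstrongH : fstrong GA F A -> fstrong D H U.
Proof.
move=> strongFA SS cSS; rewrite amalgam_msr //.
have eA X : X `<=` A -> GA X = D X by move=> XH; rewrite amalgamA.
have sF := agree_fstrong eA (fsubsetIl _ _) strongFA.
have := sF _ (rclosed_traces (fsubsetUl A H) cSS).
by rewrite !msr_trace ?fsubsetIl //; clear; lia.
Qed.

(** By the rank formula, a flat spanned by [H] traces on [A] a flat spanned by the
    common part, so that intersections are controlled inside [A]. *)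
Lemma amalgam_fstarH : fstar GA F A -> fstar D H U.
Proof.
move=> starFA; have eA X : X `<=` A -> GA X = D X by move=> XH; rewrite amalgamA.
have sF := agree_fstar eA (fsubsetIl _ _) starFA.
have tr W : W `&` A `&` F = W `&` F by clear; fset_bool.
have sA W : rclosed D U W -> spanned D H W -> spanned D F (W `&` A).
  move=> cW /eqP sW; apply/eqP; rewrite tr.
  by have := amalgam_rank cW; rewrite sW; clear; lia.
move=> W1 W2 c1 c2 s1 s2.
have AU : A `<=` U by exact: fsubsetUl.
have := sF _ _ (rclosed_trace AU c1) (rclosed_trace AU c2) (sA _ c1 s1) (sA _ c2 s2).
have -> : W1 `&` A `&` (W2 `&` A) = W1 `&` W2 `&` A by clear; fset_bool.
rewrite /spanned tr => /eqP e; apply/eqP.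
by have := amalgam_rank (rclosedI c1 c2); rewrite e; clear; lia.
Qed.
End Amalgam.

(** * Transport along maps *)

Section Transport.
Variables (K M : choiceType) (f : K -> M) (D : pregeom K) (G : pregeom M).
Variable Z : {fset K}.
Hypothesis f_inj : {in Z &, injective f}.
Hypothesis f_dim : forall X, X `<=` Z -> G (f @` X) = D X.
Implicit Types (A B S T U V W X Y F : {fset K}).

Lemma im_sub X Y : X `<=` Z -> Y `<=` Z -> (f @` X `<=` f @` Y) = (X `<=` Y).
Proof.
move=> XZ YZ; apply/fsubsetP/fsubsetP => [h x xX|h y].
  have /h/imfsetP[/= x' x'Y e] : f x \in f @` X by apply: in_imfset.
  by have -> := f_inj (fsubsetP XZ _ xX) (fsubsetP YZ _ x'Y) e.
by move=> /imfsetP[/= x /h xY ->]; apply: in_imfset.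
Qed.

Lemma im_subZ X : X `<=` Z -> f @` X `<=` f @` Z.
Proof. by move=> XZ; rewrite im_sub. Qed.

Lemma imI X Y : X `<=` Z -> Y `<=` Z -> f @` (X `&` Y) = f @` X `&` f @` Y.
Proof.
move=> XZ YZ; apply: imfsetI => x y xX yY; apply: f_inj.
  exact: (fsubsetP XZ).
exact: (fsubsetP YZ).
Qed.

Lemma preim (T : {fset M}) : T `<=` f @` Z -> exists2 X, X `<=` Z & T = f @` X.
Proof.
move=> WZ; exists [fset x in Z | f x \in T]; first exact: fset_sub.
apply/fsetP => y; apply/idP/imfsetP => [yW|[/= x + ->]]; last first.
  by rewrite inE => /andP[].
have /imfsetP[/= x xZ e] := fsubsetP WZ y yW.
by exists x => //; rewrite /= !inE xZ -e.
Qed.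

Lemma transport_msr U SS : U `<=` Z -> all (fun V => V `<=` Z) SS ->
  msr G (f @` U) [seq f @` (V : {fset K}) | V <- SS] = msr D U SS.
Proof.
elim: SS U => [|V SS IH] U UZ /=; first by rewrite !msr_nil.
move=> /andP[VZ SSZ]; have VU : V `&` U `<=` Z by apply: fsubset_trans (fsubsetIr _ _) UZ.
by rewrite !msr_cons -imI // f_dim // !IH.
Qed.

Lemma transport_rclosed S : S `<=` Z -> rclosed G (f @` Z) (f @` S) = rclosed D Z S.
Proof.
move=> SZ; rewrite /rclosed im_sub // SZ /=.
have e x : x \in Z -> (G (f x |` f @` S) == G (f @` S)) = (D (x |` S) == D S).
  move=> xZ; rewrite -imfsetU1 !f_dim //.
  by rewrite fsubUset fsub1set xZ.
apply/fsubsetP/fsubsetP => [h x|h y]; rewrite in_rcl => /andP[].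
  move=> xZ; rewrite -e // => ex.
  have /imfsetP[/= x' x'S] : f x \in f @` S by apply: h; rewrite in_rcl ex in_imfset.
  by move=> /f_inj -> //; apply: (fsubsetP SZ).
move=> /imfsetP[/= x xZ ->]; rewrite e // => ex.
by apply: in_imfset; apply: h; rewrite in_rcl xZ.
Qed.

Lemma all_im_rclosed SS : all (fun V => V `<=` Z) SS ->
  all (rclosed G (f @` Z)) [seq f @` (V : {fset K}) | V <- SS] = all (rclosed D Z) SS.
Proof.
move=> /allP sSS; rewrite all_map; apply: eq_in_all => V /sSS VZ /=.
exact: transport_rclosed.
Qed.

Lemma preim_fam TT : all (rclosed G (f @` Z)) TT ->
  exists2 SS, all (rclosed D Z) SS & TT = [seq f @` (V : {fset K}) | V <- SS].
Proof.
elim: TT => [|T TT IH] /=; first by exists [::].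
case/andP=> cT /IH[SS cSS ->].
have [V VZ eT] := preim (rclosed_sub cT).
by exists (V :: SS); rewrite ?eT //= cSS -transport_rclosed // -eT cT.
Qed.

Lemma fam_sub SS : all (rclosed D Z) SS -> all (fun V => V `<=` Z) SS.
Proof. by apply: sub_all => V /rclosed_sub. Qed.

Lemma fcup_im SS : fcup [seq f @` (V : {fset K}) | V <- SS] = f @` fcup SS.
Proof.
elim: SS => [|V SS IH]; first by rewrite /fcup !big_nil imfset0.
by move: IH; rewrite /fcup /= !big_cons imfsetU => ->.
Qed.

Lemma transport_fflat : fflat D Z <-> fflat G (f @` Z).
Proof.
split=> [fD TT /preim_fam[SS cSS ->]|fG SS cSS]; have sSS := fam_sub cSS.
  rewrite transport_msr // fcup_im f_dim ?fcup_sub //; exact: fD.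
have := fG [seq f @` (V : {fset K}) | V <- SS].
by rewrite all_im_rclosed // transport_msr // fcup_im f_dim ?fcup_sub //; apply.
Qed.

Lemma transport_fstrong F : F `<=` Z ->
  fstrong D F Z <-> fstrong G (f @` F) (f @` Z).
Proof.
move=> FZ; split=> [fD TT /preim_fam[SS cSS ->]|fG SS cSS]; have sSS := fam_sub cSS.
  rewrite !transport_msr //; exact: fD.
have := fG [seq f @` (V : {fset K}) | V <- SS].
by rewrite all_im_rclosed // !transport_msr //; apply.
Qed.

Lemma transport_spanned F W : F `<=` Z -> W `<=` Z ->
  spanned G (f @` F) (f @` W) = spanned D F W.
Proof.
by move=> FZ WZ; rewrite /spanned -imI // !f_dim // (fsubset_trans (fsubsetIl _ _)).
Qed.

Lemma transport_fstar F : F `<=` Z -> fstar D F Z <-> fstar G (f @` F) (f @` Z).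
Proof.
have IZ V W : V `<=` Z -> V `&` W `<=` Z by apply/fsubset_trans/fsubsetIl.
move=> FZ; split=> [sD T1 T2 c1 c2|sG W1 W2 c1 c2 s1 s2].
  have [V1 Z1 e1] := preim (rclosed_sub c1).
  have [V2 Z2 e2] := preim (rclosed_sub c2).
  move: c1 c2; rewrite e1 e2 !transport_rclosed // -imI // !transport_spanned ?IZ //.
  exact: sD.
have Z1 := rclosed_sub c1; have Z2 := rclosed_sub c2.
have := sG (f @` W1) (f @` W2).
by rewrite !transport_rclosed // -imI // !transport_spanned ?IZ //; apply.
Qed.

End Transport.

(** The pregeometry induced through a partial map; the elements outside its
domain become loops. *)
Section Pull.
Variables (K M : choiceType) (p : K -> option M) (G : pregeom M).
Implicit Types X Y : {fset K}.

Definition pimage X : {fset M} := [fset y | y in pmap p X].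

Lemma in_pimage X y : (y \in pimage X) = (Some y \in map p X).
Proof. by rewrite inE /= mem_pmap. Qed.

Lemma pimageP X y : reflect (exists2 x, x \in X & p x = Some y) (y \in pimage X).
Proof.
rewrite in_pimage; apply: (iffP mapP) => -[x xX e]; exists x => //.
Qed.

Lemma pull_dim0 : G (pimage fset0) = 0.
Proof.
rewrite (_ : pimage _ = fset0) ?dim_fset0 //.
by apply/fsetP => y; rewrite inE; apply/negbTE/negP => /pimageP[].
Qed.

Lemma pimageU X Y : pimage (X `|` Y) = pimage X `|` pimage Y.
Proof.
apply/fsetP => y; rewrite inE; apply/pimageP/orP.
  by case=> x; rewrite inE => /orP[xX|xY] e; [left|right]; apply/pimageP; exists x.
by case=> /pimageP[x xX e]; exists x; rewrite // inE xX ?orbT.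
Qed.

Lemma pull_dimU1 X x : G (pimage X) <= G (pimage (x |` X)) <= (G (pimage X)).+1.
Proof.
rewrite pimageU; case e: (p x) => [y|].
  rewrite (_ : pimage [fset x] = [fset y]) ?dim_fsetU1 //.
  apply/fsetP => z; rewrite inE; apply/pimageP/eqP => [[x']|->].
    by rewrite inE => /eqP ->; rewrite e => -[].
  by exists x; rewrite ?inE.
rewrite (_ : pimage [fset x] = fset0) ?fset0U ?leqnn ?leqnSn //.
apply/fsetP => z; rewrite inE; apply/negbTE/negP => /pimageP[x'].
by rewrite inE => /eqP ->; rewrite e.
Qed.

Lemma pull_submod X Y :
  G (pimage (X `|` Y)) + G (pimage (X `&` Y)) <= G (pimage X) + G (pimage Y).
Proof.
rewrite pimageU; apply: dim_submod_sub; apply/fsubsetP => y /pimageP[x];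
  by rewrite inE => /andP[xX xY] e; apply/pimageP; exists x.
Qed.

Definition pull : pregeom K := Pregeom pull_dim0 pull_dimU1 pull_submod.

End Pull.

Section Push.
Variables (N : finType) (K : choiceType) (f : N -> K) (H : pregeom N).
Hypothesis f_inj : injective f.

Definition push : pregeom K := pull (fun k => [pick x | f x == k]) H.

Lemma push_dim (X : {fset N}) : push (f @` X) = H X.
Proof.
rewrite /push /=; congr (H _); apply/fsetP => y; apply/pimageP/idP.
  case=> _ /imfsetP[/= x xX ->]; case: pickP => // x' /eqP/f_inj -> [<-].
  exact: xX.
move=> yX; exists (f y); first exact: in_imfset.
by case: pickP => [x' /eqP/f_inj ->|/(_ y)]; rewrite ?eqxx.
Qed.
End Push.

(** * Alternating sums and flatness in infinite pregeometries *)

Section Infinite.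
Variables (M : choiceType) (G : pregeom M).
Implicit Types (A B C D X Y Z : {fset M}) (E : set M).

Local Notation "A `<=s` E" := ([set` A] `<=` E)%classic (at level 70).

Definition trace Z E : {fset M} := [fset x in Z | `[<E x>]].

Lemma in_trace Z E x : (x \in trace Z E) = (x \in Z) && `[<E x>].
Proof. by rewrite !inE. Qed.

Lemma trace_sub Z E : trace Z E `<=` Z.
Proof. exact: fset_sub. Qed.

Lemma trace_subs Z E : trace Z E `<=s` E.
Proof. by move=> x /=; rewrite in_trace => /andP[_ /asboolP]. Qed.

Lemma sub_trace Z E A : A `<=` Z -> A `<=s` E -> A `<=` trace Z E.
Proof.
move=> AZ AE; apply/fsubsetP => x xA; rewrite in_trace (fsubsetP AZ) //=.
by apply/asboolP; apply: AE.
Qed.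

Lemma trace_narrow Y Z E : Y `<=` Z -> trace Z E `&` Y = trace Y E.
Proof.
move=> YZ; apply/fsetP => x; rewrite inE !in_trace.
by case xY: (x \in Y); rewrite ?andbF // andbT (fsubsetP YZ).
Qed.

Definition maximal_in B E := B `<=s` E /\ forall C, C `<=s` E -> G C <= G B.

Lemma maximal_dimS B E : maximal_in B E -> findim G E /\ dimS G E = G B.
Proof.
move=> [BE Bmax]; have ub : ubound (indep_sizes G E) (G B).
  by move=> _ [A [AE iA <-]]; rewrite leEnat -iA; apply: Bmax.
have mem : indep_sizes G E (G B).
  have [B' [B'B e c]] := basis_exists G B; exists B'; split=> //.
    by move=> x /= /(fsubsetP B'B) /BE.
  by rewrite /indep e c.
split; first by exists (G B).
have sup : supremums (indep_sizes G E) (G B) by split => // n /(_ _ mem).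
rewrite /dimS /supremum; case: ifPn => [/eqP e|_]; first by move: mem; rewrite e.
exact: xget_subset1 sup (@is_subset1_supremums _ _ _).
Qed.

Lemma maximal_exists E : findim G E -> exists B, maximal_in B E.
Proof.
move=> [n ub]; have bound C : C `<=s` E -> G C <= n.
  move=> CE; have [C' [C'C e c]] := basis_exists G C.
  rewrite -leEnat; apply: ub; exists C'; split=> //; last by rewrite /indep e c.
  by move=> x /= /(fsubsetP C'C) /CE.
have [|B [BE Bmin]] := @exists_min _ (fun C => C `<=s` E) (fun C => n - G C).
  by exists fset0 => x.
exists B; split=> // C CE; have := Bmin C CE; have := bound C CE; have := bound B BE.
by clear; lia.
Qed.

Lemma maximal_trace B E Z : maximal_in B E -> B `<=` Z -> G (trace Z E) = dimS G E.
Proof.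
move=> mB BZ; have [_ ->] := maximal_dimS mB; case: mB => BE Bmax.
apply/eqP; rewrite eqn_leq Bmax ?dim_mono //; last exact: trace_subs.
exact: sub_trace.
Qed.

Lemma findim_sub E E' : (E' `<=` E)%classic -> findim G E -> findim G E'.
Proof.
move=> E'E [n ub]; exists n => m [A [AE iA cA]]; apply: ub; exists A; split=> //.
exact: subset_trans E'E.
Qed.

Lemma dimS_fset A : findim G [set` A] /\ dimS G [set` A] = G A.
Proof. by apply: maximal_dimS; split=> // C /fsubsetP; apply: dim_mono. Qed.

(** Finitely many intersections of finite rank are involved, and one finite set
    contains bases of all of them. *)
Lemma dimS_large k (E : 'I_k -> set M) : (forall i, findim G (E i)) ->
  exists Z0, forall Z, Z0 `<=` Z -> forall s : {set 'I_k}, s != finset.set0 ->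
    dimS G (\bigcap_(i in [set` s]) E i) = G (trace Z (\bigcap_(i in [set` s]) E i)).
Proof.
move=> fE.
have h (s : {set 'I_k}) : exists B, s != finset.set0 ->
    maximal_in B (\bigcap_(i in [set` s]) E i)%classic.
  have [->|/finset.set0Pn[i si]] := eqVneq s finset.set0; first by exists fset0.
  have [|B mB] := @maximal_exists (\bigcap_(i in [set` s]) E i)%classic.
    by apply: findim_sub (fE i) => x; apply.
  by exists B.
have [B hB] := choice h; exists (\big[@fsetU M/fset0]_(s : {set 'I_k}) B s) => Z BZ s s0.
apply/esym/(maximal_trace (hB s s0)); apply: fsubset_trans BZ.
by apply: bigfcup_sup => //; rewrite mem_index_enum.
Qed.

Lemma Delta_trace k (E : 'I_k -> set M) Z :
  (forall s : {set 'I_k}, s != finset.set0 ->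
    dimS G (\bigcap_(i in [set` s]) E i) = G (trace Z (\bigcap_(i in [set` s]) E i))) ->
  Delta G E = msr G Z [seq trace Z (E i) | i <- enum 'I_k].
Proof.
move=> h; rewrite /msr /mu -(@inclusion_exclusion _ _ Z k (fun i => trace Z (E i))
  (fun s => trace Z (\bigcap_(i in [set` s]) E i)%classic)).
  by rewrite /Delta; apply: eq_bigr => s s0; rewrite h.
move=> s x; rewrite in_trace; case xZ: (x \in Z) => //=.
apply/asboolP/forall_inP => [hx i si|hx i /= si].
  by rewrite in_trace xZ /=; apply/asboolP/hx.
by have := hx i si; rewrite in_trace xZ => /asboolP.
Qed.

Lemma closed_trace E Z : closed G E -> rclosed G Z (trace Z E).
Proof.
move=> cE; rewrite /rclosed trace_sub; apply/fsubsetP => x.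
rewrite in_rcl in_trace => /andP[-> /eqP e] /=; apply/asboolP.
by rewrite -cE; exists (trace Z E) => //; apply: trace_subs.
Qed.

Definition clf A : set M := [set x | G (x |` A) = G A].

Lemma cl_fset A : cl G [set` A] = clf A.
Proof.
apply/seteqP; split=> x; last by exists A.
by move=> [B /= /fsubsetP BA e]; apply: dim_absorb_mono e.
Qed.

Lemma trace_clf Z A : trace Z (clf A) = rcl G Z A.
Proof.
apply/fsetP => x; rewrite in_trace in_rcl; congr (_ && _).
by apply/asboolP/eqP.
Qed.

Lemma clf_sub A C : C `<=s` clf A -> G (C `|` A) = G A.
Proof. by move=> CA; apply: dim_absorb => x xC; apply: CA. Qed.

Lemma sub_clf A : A `<=s` clf A.
Proof. by move=> x /= xA; rewrite /clf /= mem_fset1U. Qed.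

Lemma closed_clf A : closed G (clf A).
Proof.
apply/seteqP; split=> x.
  move=> [C /= CA e]; apply/eqP; rewrite eqn_leq (dim_mono G (fsubsetU1 x A)) andbT.
  rewrite -(clf_sub CA); apply: (@leq_trans (G (x |` (C `|` A)))).
    by apply/dim_mono/fsetUS/fsubsetUr.
  by rewrite (dim_absorb_mono (fsubsetUl C A) e).
by move=> xA; exists [fset x] => /=; [move=> y /=; rewrite inE => /eqP ->|
  rewrite /cl_fin /= fsetUid].
Qed.

Lemma maximal_clf A : maximal_in A (clf A).
Proof.
split; first exact: sub_clf.
by move=> C /clf_sub <-; apply/dim_mono/fsubsetUl.
Qed.

Lemma findim_closed_clf k (S : 'I_k -> {fset M}) : findim_closed G (fun i => clf (S i)).
Proof.
move=> i; split; first exact: closed_clf.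
by have [] := maximal_dimS (maximal_clf (S i)).
Qed.

(** Delta and the rank of the union are both computed in one large finite set. *)
Lemma flat_cofinal :
  (forall Z0, exists2 Z, Z0 `<=` Z & fflat G Z) -> flat G.
Proof.
move=> cof k E fcE; have fE i : findim G (E i) by case: (fcE i).
have [Z0 hZ0] := dimS_large fE.
have [B hB] : exists B, maximal_in B (\bigcup_i E i)%classic.
  apply: maximal_exists; have mi i := maximal_exists (fE i).
  have [b hb] := choice mi; exists (\sum_i G (b i)) => _ [A [AE iA <-]].
  rewrite leEnat -iA.
  have -> : A = \big[@fsetU M/fset0]_(i : 'I_k) trace A (E i).
    apply/fsetP => x; apply/idP/bigfcupP => [xA|[i _]]; last first.
      by rewrite in_trace => /andP[].
    have [i _ Ex] := AE x xA; exists i; first by rewrite mem_index_enum.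
    by rewrite in_trace xA; apply/asboolP.
  apply: (@leq_trans (\sum_(i : 'I_k) G (trace A (E i)))).
    elim/big_rec2: _ => [|i m X _ h]; first by rewrite dim_fset0.
    by apply: leq_trans (dimU_le _ _ _) _; rewrite leq_add2l.
  by apply: leq_sum => i _; have [_] := hb i; apply; apply: trace_subs.
have [Z ZZ fZ] := cof (Z0 `|` B).
have Z0Z : Z0 `<=` Z by apply: fsubset_trans ZZ; apply: fsubsetUl.
have BZ : B `<=` Z by apply: fsubset_trans ZZ; apply: fsubsetUr.
rewrite (Delta_trace (hZ0 Z Z0Z)) -(maximal_trace hB BZ).
have c : all (rclosed G Z) [seq trace Z (E i) | i <- enum 'I_k].
  by apply/allP => _ /mapP[i _ ->]; apply: closed_trace; case: (fcE i).
apply: le_trans (fZ _ c); rewrite lez_nat; apply: dim_mono; apply/fsubsetP => x.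
rewrite in_trace => /andP[xZ /asboolP[i _ Ex]]; rewrite in_fcup; apply/hasP.
exists (trace Z (E i)); first by rewrite (map_f (fun i => trace Z (E i))) ?mem_enum.
by rewrite in_trace xZ; apply/asboolP.
Qed.

Section Full.
Variable W : {fset M}.
Hypothesis fullW : forall x, x \in W.

Lemma full_sub Z : Z `<=` W.
Proof. by apply/fsubsetP => x _. Qed.

Lemma dimS_full E : findim G E /\ dimS G E = G (trace W E).
Proof.
have -> : E = [set` trace W E]%classic.
  apply/seteqP; split=> x /=; rewrite in_trace fullW /=; by move/asboolP.
have [fE ->] := dimS_fset (trace W E); split=> //; congr (G _).
by apply/fsetP => x; rewrite !in_trace fullW /= asboolb in_trace fullW.
Qed.

Lemma Delta_full k (E : 'I_k -> set M) :
  Delta G E = msr G W [seq trace W (E i) | i <- enum 'I_k].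
Proof.
apply: Delta_trace => s _.
by have [] := dimS_full (\bigcap_(i in [set` s]) E i)%classic.
Qed.

Lemma closed_full E : closed G E <-> rclosed G W (trace W E).
Proof.
split=> [|cE]; first exact: closed_trace.
apply/seteqP; split=> x; last first.
  by move=> Ex; exists [fset x] => /=; [move=> y /=; rewrite inE => /eqP ->|
    rewrite /cl_fin /= fsetUid].
move=> [A /= AE e]; have := rclosedP cE (fullW x).
have /dim_absorb_mono/(_ e) h : A `<=` trace W E by apply: sub_trace (full_sub A) AE.
by move=> /(_ h); rewrite in_trace => /andP[_ /asboolP].
Qed.

Lemma flat_full : flat G <-> fflat G W.
Proof.
split=> [fG SS cSS|fW]; last first.
  by apply: flat_cofinal => Z0; exists W => //; apply: full_sub.
pose E (i : 'I_(size SS)) := [set` nth fset0 SS i]%classic.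
have tE i : trace W (E i) = nth fset0 SS i.
  by apply/fsetP => x; rewrite in_trace fullW /= asboolb.
have fcE : findim_closed G E.
  move=> i; split; last by have [] := dimS_fset (nth fset0 SS i).
  by apply/closed_full; rewrite tE (allP cSS) // mem_nth.
have := fG _ E fcE; have [_ ->] := dimS_full (\bigcup_i E i)%classic.
rewrite Delta_full.
have eSS : [seq trace W (E i) | i <- enum 'I_(size SS)] = SS.
  under eq_map do rewrite tE.
  by rewrite (map_comp (nth fset0 SS) val) val_enum_ord map_nth_iota0 // take_size.
rewrite eSS; suff -> : trace W (\bigcup_i E i)%classic = fcup SS by [].
apply/fsetP => x; rewrite in_trace fullW in_fcup /=.
apply/asboolP/hasP => [[i _ Ex]|[V VSS xV]].
  by exists (nth fset0 SS i); rewrite ?mem_nth.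
have lt : index V SS < size SS by rewrite index_mem.
by exists (Ordinal lt) => //; rewrite /E /= nth_index.
Qed.

End Full.
End Infinite.

(** * Embeddings of finite sets in infinite pregeometries *)

Section Embed.
Variables (M : choiceType) (G : pregeom M).
Implicit Types (A B C D V W X Y Z : {fset M}) (SS : seq {fset M}).

Lemma sub_carrier D : exists W : {fset [set` D]%classic},
  (forall x, x \in W) /\ [fset val x | x in W] = D.
Proof.
pose W : {fset [set` D]%classic} := [fset x | x in pmap insub D].
have full x : x \in W.
  rewrite inE /= mem_pmap; apply/mapP; exists (val x); last by rewrite valK.
  by have := valP x; rewrite inE.
exists W; split=> //; apply/fsetP => y; apply/imfsetP/idP => [[/= x _ ->]|yD].
  by have := valP x; rewrite inE.
have yD' : y \in [set` D]%classic by rewrite inE.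
by exists (Sub y yD') => //=; rewrite SubK.
Qed.

Section Carrier.
Variables (D : {fset M}) (W : {fset [set` D]%classic}).
Hypothesis fullW : forall x, x \in W.
Hypothesis imW : [fset val x | x in W] = D.
Local Notation P := (subgeom G [set` D]%classic).

Lemma P_dim (X : {fset [set` D]%classic}) : X `<=` W -> G (val @` X) = P X.
Proof. by []. Qed.

Lemma P_inj : {in W &, injective (val : [set` D]%classic -> M)}.
Proof. by move=> x y _ _; apply: val_inj. Qed.

Lemma val_trace (S : set [set` D]%classic) :
  [set` (val @` trace W S)%fset]%classic = (val @` S)%classic.
Proof.
apply/seteqP; split=> y /=.
  by move=> /imfsetP[/= x]; rewrite in_trace => /andP[_ /asboolP Sx] ->; exists x.
move=> [x Sx <-]; apply: in_imfset => /=; rewrite in_trace fullW /=.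
exact/asboolP.
Qed.

Lemma val_trace_preim (E : set M) : val @` trace W (val @^-1` E) = trace D E.
Proof.
apply/fsetP => y; apply/imfsetP/idP => [[/= x]|].
  rewrite !in_trace => /andP[xW /asboolP Ex] ->; apply/andP; split.
    have : val x \in (val @` W)%fset by apply: in_imfset.
    by rewrite imW.
  exact/asboolP.
rewrite in_trace => /andP[]; rewrite -{1}imW => /imfsetP[/= x xW ->] /asboolP Ex.
by exists x => //=; rewrite in_trace xW; apply/asboolP.
Qed.

Lemma val_traceI (S1 S2 : set [set` D]%classic) :
  val @` trace W (S1 `&` S2)%classic = (val @` trace W S1) `&` (val @` trace W S2).
Proof.
rewrite -(imI P_inj) ?trace_sub //.
suff -> : trace W (S1 `&` S2)%classic = trace W S1 `&` trace W S2 by [].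
apply/fsetP => x; rewrite inE !in_trace fullW /=.
by apply/asboolP/andP => -[/= h1 h2]; split; apply/asboolP.
Qed.

Lemma sub_dimx (S : set [set` D]%classic) : dimx P S = Some (G (val @` trace W S)).
Proof.
have [fS dS] := dimS_full P fullW S.
by rewrite /dimx; case: asboolP => //; rewrite dS.
Qed.

Lemma sub_closed (S : set [set` D]%classic) :
  closed P S <-> rclosed G D (val @` trace W S).
Proof.
rewrite (closed_full P fullW) -(transport_rclosed P_inj P_dim (trace_sub W S)).
by rewrite imW.
Qed.

End Carrier.

Lemma Delta_sub D k (E : 'I_k -> set M) :
  Delta (subgeom G [set` D]%classic) (fun i => val @^-1` E i)%classic
    = msr G D [seq trace D (E i) | i <- enum 'I_k].
Proof.
have [W [fullW imW]] := sub_carrier D.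
rewrite (Delta_full _ fullW).
rewrite -(transport_msr (@P_inj D W) (@P_dim D W)) //.
  rewrite imW; congr (msr G _ _); rewrite -map_comp; apply: eq_map => i /=.
  by rewrite (val_trace_preim imW).
by apply/allP => _ /mapP[i _ ->]; apply: trace_sub.
Qed.

Lemma msr_traces Y Z k (E : 'I_k -> set M) : Y `<=` Z ->
  msr G Y [seq trace Y (E i) | i <- enum 'I_k]
    = msr G Y [seq trace Z (E i) | i <- enum 'I_k].
Proof.
move=> YZ; rewrite -[RHS](@msr_trace _ _ Y) // -map_comp; congr msr.
by apply: eq_map => i /=; rewrite trace_narrow.
Qed.

Lemma sqsub_cofinal D :
  (forall Z0, exists2 Z, Z0 `<=` Z & fstrong G D Z) -> sqsub G [set` D]%classic.
Proof.
move=> cof k E fcE; have fE i : findim G (E i) by case: (fcE i).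
have [Z0 hZ0] := dimS_large fE; have [Z ZZ sDZ] := cof (Z0 `|` D).
have Z0Z : Z0 `<=` Z by apply: fsubset_trans ZZ; apply: fsubsetUl.
have DZ : D `<=` Z by apply: fsubset_trans ZZ; apply: fsubsetUr.
rewrite Delta_sub (Delta_trace (hZ0 Z Z0Z)) (msr_traces _ DZ); apply: sDZ.
by apply/allP => _ /mapP[i _ ->]; apply: closed_trace; case: (fcE i).
Qed.

(** Strength is applied to the closures of the members in the whole pregeometry,
    whose alternating sum is computed in every large finite set. *)
Lemma sqsub_large D SS : sqsub G [set` D]%classic ->
  exists Z1, forall Z, Z1 `<=` Z ->
    (msr G D [seq rcl G Z V | V <- SS] <= msr G Z [seq rcl G Z V | V <- SS])%R.
Proof.
move=> sD; pose E (i : 'I_(size SS)) := clf G (nth fset0 SS i).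
have fcE : findim_closed G E := @findim_closed_clf _ G _ (fun i => nth fset0 SS i).
have [Z0 hZ0] := dimS_large (fun i => proj2 (fcE i)).
exists (Z0 `|` D) => Z ZZ.
have Z0Z : Z0 `<=` Z by apply: fsubset_trans ZZ; apply: fsubsetUl.
have DZ : D `<=` Z by apply: fsubset_trans ZZ; apply: fsubsetUr.
have := sD _ E fcE; rewrite Delta_sub (Delta_trace (hZ0 Z Z0Z)) (msr_traces _ DZ).
suff -> : [seq trace Z (E i) | i <- enum 'I_(size SS)] = [seq rcl G Z V | V <- SS] by [].
rewrite -[in RHS](mkseq_nth fset0 SS) /mkseq -val_enum_ord -!map_comp; apply: eq_map => i /=.
by rewrite trace_clf.
Qed.

(** For two flats Delta is the sum of the ranks minus the rank of the
    intersection, and the first two terms agree for flats spanned by [D]. *)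
Lemma sqsub_fstar D Z : sqsub G [set` D]%classic -> D `<=` Z -> fstar G D Z.
Proof.
move=> sD DZ W1 W2 c1 c2 s1 s2.
have [Z1 hZ1] := sqsub_large [:: W1 `&` D; W2 `&` D] sD.
pose Z' := Z1 `|` Z; have ZZ' : Z `<=` Z' by apply: fsubsetUr.
have DZ' := fsubset_trans DZ ZZ'.
have := hZ1 Z' (fsubsetUl _ _) => /=; rewrite !msr2.
have R_D W : rclosed G Z W -> spanned G D W -> rcl G Z' (W `&` D) `&` D = W `&` D.
  by move=> cW sW; rewrite rcl_trace // (rclosed_trace DZ cW).
have W_R W : rclosed G Z W -> spanned G D W -> W `<=` rcl G Z' (W `&` D).
  move=> cW sW; rewrite -{1}(spannedP cW DZ sW); apply/fsubsetP => x.
  by rewrite !in_rcl => /andP[/(fsubsetP ZZ') -> ->].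
have := R_D _ c1 s1; have := R_D _ c2 s2.
have := W_R _ c1 s1; have := W_R _ c2 s2.
have dR W : rclosed G Z W -> G (rcl G Z' (W `&` D)) = G (W `&` D).
  by move=> cW; apply: dim_rcl; apply: fsubset_trans (fsubsetIr _ _) DZ'.
have := dR _ c1; have := dR _ c2.
set R1 := rcl _ _ (W1 `&` D); set R2 := rcl _ _ (W2 `&` D).
move=> d2 d1 h2 h1 e2 e1; rewrite e1 e2.
have RZ : R1 `<=` Z' := rcl_subl _ _ _; have RZ2 : R2 `<=` Z' := rcl_subl _ _ _.
rewrite (fsetIidPl RZ) (fsetIidPl RZ2) d1 d2.
have -> : R1 `&` R2 `&` Z' = R1 `&` R2 by clear -RZ; fset_bool.
have -> : R1 `&` R2 `&` D = W1 `&` W2 `&` D.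
  rewrite -fsetIA e2 fsetIA -[LHS]fsetIA [W2 `&` D]fsetIC fsetIA e1.
  by rewrite -fsetIA [D `&` W2]fsetIC fsetIA.
have WR : W1 `&` W2 `<=` R1 `&` R2 by apply: fsetISS.
have := dim_mono G WR; have := dim_mono G (fsubsetIl (W1 `&` W2) D).
by rewrite /spanned; clear; lia.
Qed.

Lemma sqsub_fstrong D Z : sqsub G [set` D]%classic -> D `<=` Z ->
  (forall Z', Z `<=` Z' -> fstar G Z Z') -> fstrong G D Z.
Proof.
move=> sD DZ sZ SS cSS; have [Z1 hZ1] := sqsub_large SS sD.
pose Z' := Z1 `|` Z; have ZZ' : Z `<=` Z' by apply: fsubsetUr.
have := hZ1 Z' (fsubsetUl _ _); rewrite (star_msr_rcl ZZ' (sZ _ ZZ') cSS).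
have [_ _ eSS] := rcl_fam ZZ' cSS.
by rewrite -[in X in (X <= _)%R -> _](@msr_trace _ _ Z) // eSS.
Qed.

Lemma fstar_cofinal X : (forall Z0, exists2 Z, Z0 `<=` Z & fstar G X Z) ->
  forall Z, X `<=` Z -> fstar G X Z.
Proof.
by move=> cof Z XZ; have [Z' ZZ' sX] := cof Z; apply: fstar_narrow sX.
Qed.

(** Only the ranks of finite subsets of an intersection of closures matter, and
    each of these is seen in a finite set [Z]. *)
Lemma sqsub_starP X :
  sqsub_star G [set` X]%classic <-> forall Z, X `<=` Z -> fstar G X Z.
Proof.
have [W [fullW imW]] := sub_carrier X; split=> [sX Z XZ W1 W2 c1 c2 s1 s2|sX X1 X2].
  pose X1 := (val @^-1` [set` W1] : set [set` X])%classic.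
  pose X2 := (val @^-1` [set` W2] : set [set` X])%classic.
  have t V : trace X [set` V]%classic = V `&` X.
    by apply/fsetP => x; rewrite in_trace inE andbC /= asboolb.
  have c V : rclosed G Z V ->
      closed (subgeom G [set` X]%classic) (val @^-1` [set` V])%classic.
    move=> cV; apply/(sub_closed fullW imW); rewrite (val_trace_preim imW) t.
    exact: rclosed_trace XZ cV.
  have := sX X1 X2 (c _ c1) (c _ c2).
  rewrite (sub_dimx fullW) (val_traceI fullW) -!(val_trace fullW) !(val_trace_preim imW).
  rewrite !t !cl_fset /dimx; case: asboolP => // fE [].
  have [B mB] := maximal_exists fE; have [_ ->] := maximal_dimS mB.
  have [_ Bmax] := mB; move=> e; rewrite /spanned eqn_leq dim_mono ?fsubsetIl //=.
  have -> : W1 `&` W2 `&` X = W1 `&` X `&` (W2 `&` X) by clear; fset_bool.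
  rewrite e; apply: Bmax => x /=; rewrite inE => /andP[x1 x2].
  have cl V : rclosed G Z V -> spanned G X V -> x \in V -> clf G (V `&` X) x.
    by move=> cV sV; rewrite -{1}(spannedP cV XZ sV) in_rcl => /andP[_ /eqP].
  by split; apply: cl.
move=> /(sub_closed fullW imW) c1 /(sub_closed fullW imW) c2.
rewrite (sub_dimx fullW) (val_traceI fullW) -!(val_trace fullW) !cl_fset.
move: c1 c2; set S1 := (val @` _)%fset; set S2 := (val @` _)%fset => c1 c2.
have S1X := rclosed_sub c1; have S2X := rclosed_sub c2.
have mx : maximal_in G (S1 `&` S2) (clf G S1 `&` clf G S2)%classic.
  split=> [x /=|C CS].
    by rewrite inE => /andP[x1 x2]; split; apply: sub_clf.
  pose Z := X `|` C; have XZ : X `<=` Z by apply: fsubsetUl.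
  have cR V : V `<=` X -> rclosed G Z (rcl G Z V).
    by move=> VX; apply: rclosed_rcl; apply: fsubset_trans VX XZ.
  have sR V : rclosed G X V -> spanned G X (rcl G Z V).
    move=> cV; rewrite /spanned rcl_trace // dim_rcl //.
    by apply: fsubset_trans (rclosed_sub cV) XZ.
  have := sX Z XZ _ _ (cR _ S1X) (cR _ S2X) (sR _ c1) (sR _ c2).
  have -> : G (S1 `&` S2) = G (rcl G Z S1 `&` rcl G Z S2 `&` X).
    rewrite -[in LHS](rcl_trace XZ c1) -[in LHS](rcl_trace XZ c2); congr (G _).
    by move: (rcl G Z S1) (rcl G Z S2) => R1 R2; clear; fset_bool.
  move=> /eqP ->; apply: dim_mono; apply/fsubsetP => x xC.
  have [/= h1 h2] := CS x xC.
  by rewrite inE !in_rcl /Z inE xC orbT h1 h2 !eqxx.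
by have [fE dE] := maximal_dimS mx; rewrite /dimx; case: asboolP => //; rewrite dE.
Qed.

Lemma sqsub_full W D : (forall x, x \in W) ->
  sqsub G [set` D]%classic <-> fstrong G D W.
Proof.
move=> fullW; have sW Z : Z `<=` W by apply: full_sub.
split=> [sD|sD]; last by apply: sqsub_cofinal => Z0; exists W.
apply: sqsub_fstrong => // Z WZ; suff -> : Z = W by apply: rclosed_star; apply: rclosed_full.
by apply/eqP; rewrite eqEfsubset WZ sW.
Qed.

End Embed.

Lemma sqsub_sub (M : choiceType) (G : pregeom M) (X Y : {fset M}) : X `<=` Y ->
  sqsub (subgeom G [set` Y]%classic) (val @^-1` [set` X])%classic <-> fstrong G X Y.
Proof.
move=> XY; have [W [fullW imW]] := sub_carrier Y.
set P := subgeom _ _; set S := (_ @^-1` _)%classic.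
have -> : S = [set` trace W S]%classic.
  by apply/seteqP; split=> x /=; rewrite in_trace fullW /= => /asboolP.
rewrite (sqsub_full _ _ fullW).
rewrite (transport_fstrong (@P_inj _ Y W) (@P_dim _ G Y W)) ?trace_sub //.
rewrite imW (val_trace_preim imW).
suff -> : trace Y [set` X]%classic = X by [].
apply/fsetP => x; rewrite in_trace /= asboolb andbC.
by case xX: (x \in X); rewrite //= (fsubsetP XY).
Qed.

(** * Bounded strength in an amalgam *)

(** Since the amalgam is strong in [Z] and modular, it is enough to compare the
    sums over [A] and over the common part, for the traces of the closures in [Z]
    of flats of [Y].  At most [2 ^ m] traces occur, each of rank at most [m], so a
    starred subset [Y'] of [A] of bounded size spans all of them; the sum over [A]
    can then be computed in [Y'], where the common part is strong. *)
Lemma amalgam_nstrong (M : choiceType) (G : pregeom M) (A H Y Z : {fset M}) m b :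
  A `|` H `<=` Z -> fstrong G (A `|` H) Z -> modular_over G A H ->
  H `<=` Y -> Y `<=` Z -> fstar G Y Z -> #|` Y| <= m ->
  (forall X, X `<=` A -> #|` X| <= m + 2 ^ m * m ->
     exists Y', [/\ X `<=` Y', Y' `<=` A, fstar G Y' A & #|` Y'| <= b]) ->
  (forall Y', A `&` H `<=` Y' -> Y' `<=` A -> fstar G Y' A -> #|` Y'| <= b ->
     fstrong G (A `&` H) Y') ->
  fstrong G H Y.
Proof.
set U := A `|` H; set F := A `&` H.
move=> UZ sUZ modU HY YZ sYZ cY hull Fn SS cSS.
have AU : A `<=` U by apply: fsubsetUl.
have HU : H `<=` U by apply: fsubsetUr.
have FA : F `<=` A by apply: fsubsetIl.
have FH : F `<=` H by apply: fsubsetIr.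
have AZ := fsubset_trans AU UZ.
have [cTT _ eSS] := rcl_fam YZ cSS; set TT := map _ SS in cTT eSS.
rewrite -(star_msr_rcl YZ sYZ cSS) -/TT.
have -> : msr G H SS = msr G H TT by rewrite -eSS msr_trace.
apply: le_trans (sUZ _ cTT).
have cU := rclosed_traces UZ cTT.
have := modular_msr modU cU; rewrite -/U -/F !(@msr_trace _ _ U) //; last first.
  exact: fsubset_trans FA AU.
suff : (msr G F TT <= msr G A TT)%R by clear; lia.
pose T V := bas G (rcl G Z V `&` A).
have TA V : T V `<=` A.
  by have [h _ _] := basP G (rcl G Z V `&` A); apply: fsubset_trans h (fsubsetIr _ _).
pose X := F `|` fcup [seq T V | V <- fpowerset Y].
have XA : X `<=` A.
  by rewrite fsubUset FA fcup_sub; apply/allP => _ /mapP[V _ ->].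
have cX : #|` X| <= m + 2 ^ m * m.
  apply: leq_trans (leq_card_fsetU _ _) _; apply: leq_add.
    apply: leq_trans cY; apply: fsubset_leq_card.
    exact: fsubset_trans FH HY.
  apply: (@leq_trans (size (fpowerset Y) * m)).
    apply: card_fcup => V; rewrite fpowersetE => VY.
    have [_ _ ->] := basP G (rcl G Z V `&` A).
    apply: leq_trans (dim_mono G (fsubsetIl _ _)) _.
    rewrite dim_rcl ?(fsubset_trans VY) //.
    apply: leq_trans (dim_card _ _) (leq_trans _ cY).
    exact: fsubset_leq_card.
  by rewrite leq_mul2r card_fpowerset leq_exp2l // cY orbT.
have [Y' [XY' Y'A sY' cY']] := hull X XA cX.
have FY' : F `<=` Y' by apply: fsubset_trans XY'; apply: fsubsetUl.
have cA := rclosed_traces AZ cTT.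
rewrite -(@msr_trace _ _ A A) // (star_msr Y'A sY' cA); last first.
  apply/allP => _ /mapP[_ /mapP[V VSS ->] ->].
  have [_ e _] := basP G (rcl G Z V `&` A).
  rewrite /spanned eqn_leq dim_mono ?fsubsetIl //= -{1}e; apply: dim_mono.
  rewrite fsubsetI; have [-> _ _] := basP G (rcl G Z V `&` A) => /=.
  apply: fsubset_trans XY'; apply: fsubset_trans (fsubsetUr _ _).
  apply: fcup_sup; apply: (map_f T); rewrite fpowersetE.
  exact: rclosed_sub (allP cSS _ VSS).
rewrite (@msr_trace _ _ A) // -(@msr_trace _ _ Y' Y') //.
rewrite -(@msr_trace _ _ Y' F) //; apply: Fn => //.
by apply: rclosed_traces cTT; apply: fsubset_trans Y'A AZ.
Qed.

(** * First properties of generic pregeometries *)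

Definition fullset (N : finType) : {fset N} := [fset x in N].

Lemma in_fullset (N : finType) (x : N) : x \in fullset N.
Proof. by rewrite inE. Qed.

Lemma embedding_transport (N : finType) (M : choiceType) (H : pregeom N)
    (G : pregeom M) (f : N -> M) : embedding H G f ->
  {in fullset N &, injective f}
  /\ forall X, X `<=` fullset N -> G (f @` X) = H X.
Proof. by case=> finj fdim; split=> [x y _ _ /finj|X _] //. Qed.

Lemma set_range (N : finType) (M : choiceType) (f : N -> M) :
  range f = [set` (f @` fullset N)%fset]%classic.
Proof.
apply/seteqP; split=> y /= => [[x _ <-]|/imfsetP[/= x _ ->]]; last by exists x.
by apply: in_imfset; apply: in_fullset.
Qed.

Section Free.
Variable K : choiceType.
Implicit Types (A B : {fset K}).

Lemma free_dimU1 A x : #|` A| <= #|` x |` A| <= #|` A|.+1.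
Proof. by rewrite cardfsU1; case: (x \in A); rewrite /= ?add0n ?add1n leqnn ?leqnSn. Qed.

Lemma free_submod A B : #|` A `|` B| + #|` A `&` B| <= #|` A| + #|` B|.
Proof. by rewrite cardfsUI. Qed.

Definition free : pregeom K := Pregeom (cardfs0 K) free_dimU1 free_submod.

Lemma free_msr Z SS : msr free Z SS = (#|` fcup SS `&` Z|%:Z)%R.
Proof.
elim: SS Z => [|V SS IH] Z; first by rewrite msr_nil /fcup big_nil fset0I cardfs0.
have e : fcup (V :: SS) = V `|` fcup SS by rewrite /fcup big_cons.
rewrite msr_cons !IH e /= fsetIUl; have := cardfsUI (V `&` Z) (fcup SS `&` Z).
have -> : V `&` Z `&` (fcup SS `&` Z) = fcup SS `&` (V `&` Z).
  by move: (fcup SS) => W; clear; fset_bool.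
by clear; lia.
Qed.

Lemma free_fflat Z : fflat free Z.
Proof.
move=> SS cSS; rewrite free_msr (fsetIidPl _) //.
by rewrite fcup_sub; apply/allP => V /(allP cSS)/rclosed_sub.
Qed.
End Free.

Section Generic.
Variables (M : choiceType) (G : pregeom M).
Hypothesis genG : generic G.
Implicit Types (A B C X Y Z : {fset M}).

Lemma generic_hull X : exists2 A, X `<=` A & sqsub G [set` A]%classic.
Proof.
have [A [finA XA sA]] := generic_cofinal genG (finite_fset X).
have /finite_fsetP[A' eA] := finA; exists A'; last by rewrite -eA.
by apply/fsubsetP => x xX; have := XA x xX; rewrite eA.
Qed.

Lemma generic_fflat A : sqsub G [set` A]%classic -> fflat G A.
Proof.
move=> sA; have [N [H [f [fH eH rf]]]] := generic_age genG (finite_fset A) sA.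
have [finj fdim] := embedding_transport eH.
have -> : A = f @` fullset N.
  by apply/fsetP => x; move: rf; rewrite set_range => /predeqP/(_ x) /= h;
    apply/idP/idP => /h.
by apply/(transport_fflat finj fdim)/(flat_full H (@in_fullset N)).
Qed.

Lemma generic_flat : flat G.
Proof.
apply: flat_cofinal => X; have [A XA sA] := generic_hull X.
by exists A => //; apply: generic_fflat.
Qed.

Lemma generic_free n : exists A, G A = n.
Proof.
have ff : flat (free 'I_n) by apply/(flat_full _ (@in_fullset _))/free_fflat.
have [f [[finj fdim] _]] := generic_universal genG ff.
exists (f @` fullset 'I_n); rewrite fdim /=.
by rewrite card_finset card_ord.
Qed.

Lemma generic_infinite : ~ findim G [set: M].
Proof.
move=> /maximal_exists[B [_ maxB]]; have [A eA] := generic_free (G B).+1.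
by have := maxB A (@subsetT _ _); rewrite eA ltnn.
Qed.

Lemma generic_point : exists x : M, True.
Proof.
have [A eA] := generic_free 1; have [A0|[x _]] := fset_0Vmem A; last by exists x.
by move: eA; rewrite A0 dim_fset0.
Qed.

Lemma generic_ext_fset (K : choiceType) (D : pregeom K) (U : {fset K}) A (a : M -> K) :
  sqsub G [set` A]%classic -> injective a -> a @` A `<=` U ->
  (forall X, X `<=` A -> D (a @` X) = G X) -> fflat D U -> fstrong D (a @` A) U ->
  exists e : K -> M, [/\ {in U &, injective e},
    forall V : {fset K}, V `<=` U -> G (e @` V) = D V, {in A, forall x, e (a x) = x}
    & sqsub G [set` (e @` U)%fset]%classic].
Proof.
move=> sA ainj AU adim fU sAU; have [x0 _] := generic_point.
pose W := fullset U; pose B := pull (fun z : U => Some (val z)) D.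
have imB (X : {fset U}) : D (val @` X) = B X.
  rewrite /B /=; congr (D _); apply/fsetP => y.
  by apply/imfsetP/pimageP => -[/= z zX e]; exists z => //; [rewrite e|case: e].
have vinj : {in W &, injective (val : U -> K)} by move=> x y _ _; apply: val_inj.
have vdim (X : {fset U}) : X `<=` W -> D (val @` X) = B X by [].
have vW : val @` W = U.
  apply/fsetP => y; apply/imfsetP/idP => [[/= z _ ->]|yU]; first exact: valP.
  by exists [` yU] => //; apply: in_fullset.
have flatB : flat B.
  by apply/(flat_full _ (@in_fullset _))/(transport_fflat vinj vdim); rewrite vW.
have jU (x : [set` A]%classic) : a (val x) \in U.
  apply: (fsubsetP AU); apply: in_imfset => /=.
  by have := valP x; rewrite inE.
pose j (x : [set` A]%classic) : U := [` jU x].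
have embj : embedding (subgeom G [set` A]%classic) B j.
  split=> [x y /(congr1 val) /= /ainj/val_inj //|X].
  rewrite -imB -imfset_comp.
  have -> : [fset (val \o j) x | x in X] = a @` (val @` X) by rewrite -imfset_comp.
  rewrite adim //; apply/fsubsetP => _ /imfsetP[/= x _ ->].
  by have := valP x; rewrite inE.
pose S1 := [fset z in W | val z \in a @` A].
have rj : range j = [set` S1]%classic.
  apply/seteqP; split=> z /=.
    move=> [x _ <-]; rewrite !inE /=; apply: in_imfset => /=.
    by have := valP x; rewrite inE.
  rewrite inE => /andP[_ /imfsetP[/= x xA e]].
  have xA' : x \in [set` A]%classic by rewrite inE.
  by exists (Sub x xA') => //; apply: val_inj; rewrite /= e.
have vS1 : val @` S1 = a @` A.
  apply/fsetP => y; apply/imfsetP/idP => [[/= z + ->]|yA].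
    by rewrite inE => /andP[].
  have yU := fsubsetP AU _ yA.
  by exists [` yU] => //=; rewrite !inE.
have sB : sqsub B (range j).
  rewrite rj; apply/(sqsub_full _ _ (@in_fullset _)).
  by apply/(transport_fstrong vinj vdim); rewrite ?fset_sub // vS1 vW.
have [e [[einj edim] ej se]] := generic_extension genG (finite_fset A) sA flatB embj sB.
pose e' k := if insub k is Some z then e z else x0.
have e'E k (kU : k \in U) : e' k = e [` kU] by rewrite /e' insubT.
have e'im (X : {fset U}) : e' @` (val @` X) = e @` X.
  rewrite -imfset_comp; apply: eq_imfset => // z /=.
  by rewrite /e' valK.
have lift (X : {fset K}) : X `<=` U -> exists X' : {fset U}, X = val @` X'.
  by rewrite -{1}vW => /(preim)[X' _ ->]; exists X'.
exists e'; split.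
- move=> x y xU yU; rewrite (e'E _ xU) (e'E _ yU) => /einj.
  by move=> /(congr1 val).
- by move=> X /lift[X' ->]; rewrite e'im edim imB.
- move=> x xA; have xA' : x \in [set` A]%classic by rewrite inE.
  have axU : a x \in U by apply: (fsubsetP AU); apply: in_imfset.
  rewrite (e'E _ axU) -[RHS](ej (Sub x xA')); congr e.
  exact: val_inj.
- have -> : [set` (e' @` U)%fset]%classic = range e by rewrite set_range -(e'im W) vW.
  exact: se.
Qed.

End Generic.

(** * The extension axiom *)

Lemma amalgam_along (K : choiceType) (GA : pregeom K) (A : {fset K})
    (N : finType) (H : pregeom N) (h : N -> K) (S0 : {fset N}) :
  injective h -> (forall x, (h x \in A) = (x \in S0)) ->
  (forall X, X `<=` S0 -> GA (h @` X) = H X) ->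
  fflat GA A -> flat H -> sqsub H [set` S0]%classic ->
  let Hs := h @` fullset N in
  exists D : pregeom K,
  [/\ forall X, X `<=` A -> D X = GA X, forall X, D (h @` X) = H X,
      fflat D (A `|` Hs) & fstrong D A (A `|` Hs)] /\
  [/\ modular_over D A Hs, A `&` Hs = h @` S0,
      fstrong GA (h @` S0) A -> fstrong D Hs (A `|` Hs)
    & fstar GA (h @` S0) A -> fstar D Hs (A `|` Hs)].
Proof.
move=> hinj hA agree0 fA fH sH Hs; pose GH := push h H.
have GHdim X : GH (h @` X) = H X := push_dim H hinj X.
have hinjW : {in fullset N &, injective h} by move=> x y _ _ /hinj.
have hdimW X : X `<=` fullset N -> GH (h @` X) = H X by [].
have S0W : S0 `<=` fullset N by apply: full_sub; apply: in_fullset.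
have eF : A `&` Hs = h @` S0.
  apply/fsetP => k; rewrite inE; apply/andP/imfsetP => [[kA /imfsetP[/= x _ e]]|].
    by exists x => //=; rewrite -hA -e.
  by case=> /= x xS ->; rewrite hA in_imfset // in_fullset.
have agree X : X `<=` A `&` Hs -> GA X = GH X.
  by rewrite eF => /(preim (Z := S0))[X' X'S ->]; rewrite GHdim agree0.
have fGH : fflat GH Hs.
  by apply/(transport_fflat hinjW hdimW)/(flat_full H (@in_fullset N)).
have sGH : fstrong GH (A `&` Hs) Hs.
  rewrite eF; apply/(transport_fstrong hinjW hdimW S0W).
  exact/(sqsub_full _ _ (@in_fullset N)).
exists (amalgam agree fA fGH sGH); split; split.
- by move=> X XA; rewrite amalgamA.
- move=> X; rewrite amalgamH ?GHdim //; apply: im_subZ => //.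
  by apply: full_sub; apply: in_fullset.
- exact: amalgam_fflat.
- exact: amalgam_fstrongA.
- exact: amalgam_rank.
- exact: eF.
- by rewrite -eF; apply: amalgam_fstrongH.
- by rewrite -eF; apply: amalgam_fstarH.
Qed.

Lemma card_le_fset (M : choiceType) (A B : {fset M}) n :
  (#|` A| <= n)%N -> ([set` A] `\` [set` B] #<= `I_n)%card.
Proof.
move=> An; apply: (@card_le_trans _ _ _ [set` A]%classic).
  by apply: subset_card_le => x [].
apply: (@card_le_trans _ _ _ `I_(#|` A|)); last by rewrite card_le_II.
have : ([set` A] #= `I_(#|` A|))%card by apply/card_eq_fsetP.
by move=> /card_eqPle[].
Qed.

Lemma fset_of_small (M : choiceType) (X : {fset M}) (Y : set M) n :
  ([set` X] `<=` Y)%classic -> (Y `\` [set` X] #<= `I_n)%card ->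
  exists2 Y' : {fset M}, Y = [set` Y']%classic & (#|` Y'| <= #|` X| + n)%N.
Proof.
move=> XY cY; have : finite_set (Y `\` [set` X])%classic by apply/finite_set_leP; exists n.
move=> /finite_fsetP[B eB]; exists (X `|` B).
  apply/seteqP; split=> x /=; rewrite inE.
    move=> Yx; case: (boolP (x \in X)) => //= xX.
    have : (Y `\` [set` X])%classic x by split=> //; apply/negP.
    by rewrite eB.
  case/orP=> [/XY //|xB]; have : [set` B]%classic x by [].
  by rewrite -eB => -[].
apply: leq_trans (leq_card_fsetU _ _) _; rewrite leq_add2l.
rewrite -card_le_II; move: cY; rewrite eB; apply: card_le_trans.
have : ([set` B] #= `I_(#|` B|))%card by apply/card_eq_fsetP.
by rewrite card_eq_sym => /card_eqPle[].
Qed.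

Section T3.
Variable theta : nat -> nat.
Hypothesis thetaP : forall n (K : choiceType) (G : pregeom K) (Z X : {fset K}),
    fflat G Z -> X `<=` Z -> #|` X| <= n ->
  exists Y, [/\ X `<=` Y, Y `<=` Z, fstar G Y Z & #|` Y| <= theta n].

(** An extension with at most [m] points has at most [2 ^ m] flats of rank at most
    [m]; bases of their traces, with [m] further points, are put in a hull.  The first
    summand serves the requirement that [tau m] be at least [m]. *)
Definition tau m := m + theta (m + 2 ^ m * m).

(** [A] is copied into the sum type, where it can be amalgamated with [H] over [F];
    the extension property then realises the amalgam over [A] inside [G]. *)
Lemma generic_T3 (M : choiceType) (G : pregeom M) : generic G -> T3 tau G.
Proof.
move=> genG F0 finF0; have /finite_fsetP[F eF0] := finF0; rewrite {}eF0 {F0 finF0}.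
move=> starF N H i flatH [iinj idim] sH n [_ strongF].
set m := #|N| + n in strongF.
have [A FA sA] := generic_hull genG F.
have fA := generic_fflat genG sA.
pose inA (k : M + N) := if k is inl x then Some x else None.
pose GA : pregeom (M + N)%type := pull inA G.
have GAdim X : GA (inl @` X) = G X.
  rewrite /GA /=; congr (G _); apply/fsetP => y; apply/pimageP/idP.
    by case=> _ /imfsetP[/= x xX ->] [<-].
  by move=> yX; exists (inl y) => //; apply: in_imfset.
have inl_inj : injective (inl : M -> M + N) by move=> x y [].
have linj : {in A &, injective (inl : M -> M + N)} by move=> x y _ _ [].
have ldim X : X `<=` A -> GA (inl @` X) = G X by [].
pose h y : M + N := match pselect (exists u, i u = y) with
  | left e => inl (val (projT1 (cid e))) | right _ => inr y end.
have hi u : h (i u) = inl (val u).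
  rewrite /h; case: pselect => [e|[]]; last by exists u.
  by have := projT2 (cid e) => /= /iinj ->.
have hinj : injective h.
  move=> y z; rewrite /h; case: pselect => [e|ne]; case: pselect => [e'|ne'] //.
    move=> [] /val_inj uu; rewrite -(projT2 (cid e)) -(projT2 (cid e')) /=.
    by rewrite uu.
  by case.
pose S0 := trace (fullset N) (range i).
have S0P y : (y \in S0) = `[< exists u, i u = y >].
  rewrite in_trace in_fullset /=; apply/asboolP/asboolP => [[u _ <-]|[u <-]].
    by exists u.
  by exists u.
pose Ak := (inl : M -> M + N) @` A.
have hA y : (h y \in Ak) = (y \in S0).
  rewrite S0P; apply/idP/asboolP => [|[u <-]].
    rewrite /h; case: pselect => [//|ne] /imfsetP[/= x _ //].
  rewrite hi; apply: in_imfset => /=; apply: (fsubsetP FA).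
  by have := valP u; rewrite inE.
have [W [fullW imW]] := sub_carrier F.
have S0W : S0 = i @` W.
  apply/fsetP => y; rewrite S0P; apply/asboolP/imfsetP => [[u <-]|[/= u _ ->]].
    by exists u => //; apply: fullW.
  by exists u.
have h_i (X : {fset [set` F]%classic}) : h @` (i @` X) = inl @` (val @` X).
  by rewrite -!imfset_comp; apply: eq_imfset => // u /=; rewrite hi.
have agree X : X `<=` S0 -> GA (h @` X) = H X.
  by rewrite S0W => /(preim)[X' _ ->]; rewrite h_i GAdim [RHS]idim.
have hS0 : h @` S0 = inl @` F by rewrite S0W h_i imW.
have fAk : fflat GA Ak by apply/(transport_fflat linj ldim).
have ri : range i = [set` S0]%classic.
  apply/seteqP; split=> y /=; rewrite S0P.
    by move=> [u _ <-]; apply/asboolP; exists u.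
  by move=> /asboolP[u <-]; exists u.
rewrite ri in sH.
have [D [[DA DH fU sAU] [modU eF _ starH]]] := amalgam_along hinj hA agree fAk flatH sH.
set Hs := h @` fullset N in DH fU sAU modU eF starH.
set U := Ak `|` Hs in fU sAU modU eF starH.
have AkU : Ak `<=` U by apply: fsubsetUl.
have HsU : Hs `<=` U by apply: fsubsetUr.
have Dl X : X `<=` A -> D (inl @` X) = G X.
  by move=> XA; rewrite DA ?GAdim // im_subZ.
have [e [einj edim eA sDU]] :=
  generic_ext_fset genG sA inl_inj AkU Dl fU sAU.
pose f y := e (h y).
have hU y : h y \in U by apply: (fsubsetP HsU); apply: in_imfset; apply: in_fullset.
have fim X : f @` X = e @` (h @` X) by rewrite -imfset_comp.
have eAk : e @` Ak = A.
  rewrite -imfset_comp; apply/fsetP => x; apply/imfsetP/idP => [[/= y yA ->]|xA].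
    by rewrite eA.
  by exists x => //=; rewrite eA.
have eFk : e @` (h @` S0) = F.
  rewrite hS0 -imfset_comp; apply/fsetP => x; apply/imfsetP/idP => [[/= y yF ->]|xF].
    by rewrite eA // (fsubsetP FA).
  by exists x => //=; rewrite eA // (fsubsetP FA).
pose H' := e @` Hs.
have eU : e @` U = A `|` H' by rewrite imfsetU eAk.
have AH' : A `&` H' = F by rewrite -eAk -(imI einj) // eF.
have modG : modular_over G A H'.
  move=> E; rewrite -eU => cE; have [E1 E1U eE] := preim (rclosed_sub cE).
  move: cE; rewrite eE (transport_rclosed einj edim) // => /modU.
  have im V : V `<=` U -> G (e @` E1 `&` e @` V) = D (E1 `&` V).
    by move=> VU; rewrite -(imI einj) // edim // (fsubset_trans (fsubsetIl _ _)).
  have S0U : h @` S0 `<=` U by rewrite -eF; apply: fsubset_trans (fsubsetIl _ _) AkU.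
  by rewrite AH' -(im _ AkU) -(im _ HsU) eF -(im _ S0U) eAk eFk edim.
rewrite eU in sDU.
have AZ' Z : A `|` H' `<=` Z -> fstar G (A `|` H') Z by apply: sqsub_fstar.
have H'U : H' `<=` A `|` H' by apply: fsubsetUr.
have starH' : fstar G H' (A `|` H').
  rewrite -eU; apply/(transport_fstar einj edim HsU)/starH; rewrite hS0.
  by apply/(transport_fstar linj ldim FA); move/sqsub_starP: starF; apply.
have rf : range f = [set` H']%classic by rewrite set_range fim.
have starG : sqsub_star G (range f).
  rewrite rf; apply/sqsub_starP; apply: fstar_cofinal => Z0.
  exists (Z0 `|` (A `|` H')); first exact: fsubsetUl.
  have UZ : A `|` H' `<=` Z0 `|` (A `|` H') by apply: fsubsetUr.
  exact: fstar_trans H'U UZ starH' (AZ' _ UZ).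
exists f; split.
- split=> [y z e_yz|X]; last first.
    rewrite -[LHS]/(G (f @` X)) fim edim ?DH //.
    by apply/fsubsetP => _ /imfsetP[/= y _ ->]; apply: hU.
  by apply: hinj; apply: einj e_yz.
- move=> u; rewrite /f hi eA //; apply: (fsubsetP FA).
  by have := valP u; rewrite inE.
split=> // Y H'Y starY cY; rewrite rf in H'Y cY *.
have [Yf eY cYf] := fset_of_small H'Y cY; rewrite {}eY {Y} in H'Y starY cY *.
have HY : H' `<=` Yf by apply/fsubsetP => x xH; apply: H'Y.
apply/sqsub_sub => //.
have [Z YZ sZ] := generic_hull genG (Yf `|` (A `|` H')).
have YfZ : Yf `<=` Z by apply: fsubset_trans YZ; apply: fsubsetUl.
have UZ : A `|` H' `<=` Z by apply: fsubset_trans YZ; apply: fsubsetUr.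
have cH' : #|` H'| <= #|N|.
  apply: leq_trans (leq_imfset_card _ _ _) _; apply: leq_trans (leq_imfset_card _ _ _) _.
  by rewrite card_finset.
apply: (@amalgam_nstrong _ G A H' Yf Z m (theta (m + 2 ^ m * m))) => //.
- by apply: sqsub_fstrong => // Z' ZZ'; apply: sqsub_fstar.
- by move/sqsub_starP: starY; apply.
- by apply: leq_trans cYf _; rewrite leq_add2r.
- by move=> X XA cX; apply: thetaP.
rewrite AH' => Y' FY' Y'A sY' cY'; apply/sqsub_sub => //; apply: strongF.
- by move=> x /(fsubsetP FY').
- apply/sqsub_starP; apply: fstar_cofinal => Z0.
  exists (Z0 `|` A); first exact: fsubsetUl.
  apply: fstar_trans Y'A (fsubsetUr _ _) sY' _.
  by apply: sqsub_fstar => //; apply: fsubsetUr.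
- by apply: card_le_fset; apply: leq_trans cY' (leq_addl _ _).
Qed.

Lemma generic_models (M : choiceType) (G : pregeom M) :
  generic G -> models_T tau (Lstruct_of G).
Proof.
move=> genG; exists G; split=> //.
- exact: generic_flat.
- exact: generic_infinite.
- exact: generic_T3.
Qed.
End T3.

(** * Existence of a generic pregeometry *)

Definition dom (z : nat) : {fset nat} := [fset k in iota 0 z].

Lemma in_dom z k : (k \in dom z) = (k < z).
Proof. by rewrite !inE /= mem_iota. Qed.

Lemma dom_sub z z' : z <= z' -> dom z `<=` dom z'.
Proof. by move=> zz; apply/fsubsetP => k; rewrite !in_dom => /leq_trans; apply. Qed.

Record stage := Stage {
  sz : nat; geo : pregeom nat; geo_flat : fflat geo (dom sz) }.

Definition ext (s s' : stage) : Prop :=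
  [/\ sz s <= sz s', forall X, X `<=` dom (sz s) -> geo s' X = geo s X
    & fstrong (geo s') (dom (sz s)) (dom (sz s'))].

Lemma ext_refl s : ext s s.
Proof. by split=> // SS cSS. Qed.

Lemma ext_agree_strong s s' F : ext s s' -> F `<=` dom (sz s) ->
  fstrong (geo s) F (dom (sz s)) -> fstrong (geo s') F (dom (sz s')).
Proof.
move=> [le ag st] Fs sF; apply: (fstrong_trans Fs (dom_sub le) _ st).
by apply: (agree_fstrong _ Fs sF) => X /ag.
Qed.

Lemma ext_trans s s' s'' : ext s s' -> ext s' s'' -> ext s s''.
Proof.
move=> e1 e2; have [l1 a1 s1] := e1; have [l2 a2 s2] := e2; split.
- exact: leq_trans l1 l2.
- by move=> X Xs; rewrite a2 ?a1 // (fsubset_trans Xs) // dom_sub.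
- exact: ext_agree_strong e2 (dom_sub l1) s1.
Qed.

(** A pregeometry on ['I_n] enters through the table of its ranks, so that there
    are countably many tasks; the partial map says which of its points are
    already present. *)
Definition task : countType :=
  {n : nat & ({ffun {fset 'I_n} -> nat} * {ffun 'I_n -> option nat})%type}.

Section Tasks.
Variables (n : nat) (H : pregeom 'I_n) (g : {ffun 'I_n -> option nat}).
Definition supp : {fset 'I_n} := [fset y in fullset 'I_n | g y].
Definition gval (y : 'I_n) : nat := odflt 0 (g y).

Definition demand (s : stage) : Prop :=
  [/\ {in supp &, injective gval}, gval @` supp `<=` dom (sz s),
      forall X, X `<=` supp -> geo s (gval @` X) = H X
    & [/\ fstrong (geo s) (gval @` supp) (dom (sz s)), flat H
        & sqsub H [set` supp]%classic]].

Definition realized (s : stage) : Prop :=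
  exists f : 'I_n -> nat, [/\ injective f, f @` fullset 'I_n `<=` dom (sz s),
    forall X, geo s (f @` X) = H X, {in supp, f =1 gval}
    & fstrong (geo s) (f @` fullset 'I_n) (dom (sz s))].

Lemma realized_ext s s' : ext s s' -> realized s -> realized s'.
Proof.
move=> e [f [finj fs fdim fg sf]]; have [le ag _] := e; exists f; split => //.
- by apply: fsubset_trans fs (dom_sub le).
- move=> X; rewrite ag ?fdim //; apply: fsubset_trans fs.
  by apply: subset_imfset => x _; apply: in_fullset.
- exact: ext_agree_strong e fs sf.
Qed.

(** The new points receive the first unused numbers, so that the carrier remains
    an initial segment. *)
Lemma realize s : demand s -> exists s',
  [/\ ext s s', realized s' & sz s' = sz s + #|` fullset 'I_n `\` supp|].
Proof.
move=> [ginj gs gdim [sg fH sH]].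
pose new := enum_fset (fullset 'I_n `\` supp).
have in_new y : (y \in new) = (y \notin supp).
  by have -> : (y \in new) = (y \in fullset 'I_n `\` supp) by []; rewrite inE in_fullset andbT.
pose h y := if y \in supp then gval y else sz s + index y new.
have gd y : y \in supp -> gval y < sz s.
  by move=> ys; rewrite -in_dom; apply: (fsubsetP gs); apply: in_imfset.
have hinj : injective h.
  move=> x y; rewrite /h; case: ifP => xs; case: ifP => ys.
  - exact: ginj.
  - by have := gd x xs; move: (index y new) => i; clear; lia.
  - by have := gd y ys; move: (index x new) => i; clear; lia.
  move=> /addnI e; have xn : x \in new by rewrite in_new xs.
  by rewrite -(nth_index x xn) e nth_index // in_new ys.
have hA y : (h y \in dom (sz s)) = (y \in supp).
  rewrite in_dom /h; case: ifP => [/gd ->//|_].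
  by rewrite ltnNge leq_addr.
have hg X : X `<=` supp -> h @` X = gval @` X.
  move=> Xs; apply: eq_in_imfset => // y yX.
  by rewrite /h (fsubsetP Xs).
have agree X : X `<=` supp -> geo s (h @` X) = H X by move=> Xs; rewrite hg ?gdim.
have [D [[DA DH fU sAU] [_ eF sHU _]]] := amalgam_along hinj hA agree (@geo_flat s) fH sH.
set z' := sz s + #|` fullset 'I_n `\` supp|.
have eU : dom (sz s) `|` h @` fullset 'I_n = dom z'.
  apply/fsetP => k; rewrite inE !in_dom; apply/orP/idP => [[kz|/imfsetP[/= y _ ->]]|kz].
  - by apply: leq_trans kz (leq_addr _ _).
  - rewrite /h; case: ifP => [/gd yz|ys]; first by apply: leq_trans yz (leq_addr _ _).
    by rewrite ltn_add2l index_mem in_new ys.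
  have [lt|ge] := ltnP k (sz s); [by left|right].
  have lt : k - sz s < size new by rewrite ltn_subLR.
  have [y0 _] : exists y : 'I_n, y \in new.
    by case: (new) lt => // y ? _; exists y; apply: mem_head.
  apply/imfsetP; exists (nth y0 new (k - sz s)) => /=; first exact: in_fullset.
  have := mem_nth y0 lt; rewrite in_new /h => /negPf ->.
  by rewrite index_uniq ?fset_uniq // subnKC.
rewrite eU in fU sAU sHU.
exists (@Stage z' D fU); split => //.
- split=> //=; first exact: leq_addr.
exists h; split=> //=.
- rewrite -eU; exact: fsubsetUr.
- by move=> y ys; rewrite /h ys.
- by apply: sHU; rewrite hg.
Qed.
End Tasks.

Lemma grow s : exists s', ext s s' /\ sz s' = (sz s).+1.
Proof.
pose g : {ffun 'I_1 -> option nat} := [ffun=> None].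
have s0 : supp g = fset0.
  by apply/fsetP => y; rewrite !inE ffunE.
have [|s' [e _ ez]] := @realize 1 (free 'I_1) g s.
  rewrite /demand s0 !imfset0; split=> //.
  - by move=> X; rewrite fsubset0 => /eqP ->; rewrite imfset0 !dim_fset0.
  - split; first exact/fstrong0/geo_flat.
      exact/(flat_full _ (@in_fullset _))/free_fflat.
    by apply/(sqsub_full _ _ (@in_fullset _))/fstrong0/free_fflat.
exists s'; split=> //; rewrite ez s0 fsetD0.
by rewrite card_finset card_ord addn1.
Qed.

Definition performs (t : task) (s s' : stage) : Prop :=
  forall H : pregeom 'I_(tag t), (forall X, H X = (tagged t).1 X) ->
    demand H (tagged t).2 s -> realized H (tagged t).2 s'.

Lemma step s (t : option task) : exists s', [/\ ext s s', sz s < sz s'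
  & forall t', t = Some t' -> performs t' s s'].
Proof.
have [s1 [e1 p1]] : exists s1, ext s s1 /\ forall t', t = Some t' -> performs t' s s1.
  case: t => [t'|]; last by exists s; split=> //; apply: ext_refl.
  have [[H [Ht dH]]|no] := pselect (exists H : pregeom 'I_(tag t'),
      (forall X, H X = (tagged t').1 X) /\ demand H (tagged t').2 s); last first.
    exists s; split=> [|_ [<-] H Ht dH]; first exact: ext_refl.
    by case: no; exists H.
  have [s1 [e1 [f [finj fs fdim fg sf]] _]] := realize dH.
  exists s1; split=> // _ [<-] H' Ht' _; exists f; split=> // X.
  by rewrite fdim Ht Ht'.
have [s' [e2 ez]] := grow s1; exists s'; split.
- exact: ext_trans e1 e2.
- by rewrite ez ltnS; case: e1.
- by move=> t' /p1 pt H Ht dH; apply: realized_ext e2 (pt H Ht dH).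
Qed.

(** Stage [k] treats the task in the pair coded by [k]; the other component of the
    pair makes every task come back at arbitrarily late stages, when the points it
    refers to are present. *)
Lemma chain_exists : exists S : nat -> stage, forall k,
  [/\ ext (S k) (S k.+1), sz (S k) < sz (S k.+1)
    & forall t : nat * task, choice.unpickle k = Some t -> performs t.2 (S k) (S k.+1)].
Proof.
have h (x : stage * nat) : exists s', [/\ ext x.1 s', sz x.1 < sz s'
    & forall t : nat * task, choice.unpickle x.2 = Some t -> performs t.2 x.1 s'].
  have [s' [e lt p]] := step x.1 (omap snd (choice.unpickle x.2 : option (nat * task))).
  by exists s'; split=> // t et; apply: p; rewrite et.
have [next hnext] := choice h.
pose S := fix S k := if k is k'.+1 then next (S k', k') else Stage (@free_fflat _ (dom 0)).
by exists S => k; apply: (hnext (S k, k)).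
Qed.


Lemma injective_unbounded (p : nat -> nat) : injective p -> forall m, exists j, m <= p j.
Proof.
move=> pinj m; apply: contrapT => /forallNP h.
have lt j : p j < m by rewrite ltnNge; apply/negP/h.
pose q (j : 'I_m.+1) : 'I_m := Ordinal (lt j).
have qinj : injective q by move=> i j /(congr1 val) /= /pinj/val_inj.
by have := leq_card q qinj; rewrite !card_ord ltnn.
Qed.

Section Limit.
Variable S : nat -> stage.
Hypothesis SP : forall k, [/\ ext (S k) (S k.+1), sz (S k) < sz (S k.+1)
  & forall t : nat * task, choice.unpickle k = Some t -> performs t.2 (S k) (S k.+1)].
Local Notation dm k := (dom (sz (S k))).

Lemma chain_ext j k : j <= k -> ext (S j) (S k).
Proof.
move=> /subnK <-; elim: (k - j) => [|i IH]; first exact: ext_refl.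
by apply: ext_trans IH _; have [] := SP (i + j).
Qed.

Lemma chain_sz k : k <= sz (S k).
Proof. by elim: k => // k IH; have [_ lt _] := SP k; apply: leq_ltn_trans IH lt. Qed.

Definition stage_bound (X : {fset nat}) : nat := \max_(x <- X) x.+1.

Lemma sub_stage X k : stage_bound X <= k -> X `<=` dm k.
Proof.
move=> Xk; apply/fsubsetP => x xX; rewrite in_dom.
apply: leq_trans (leq_trans Xk (chain_sz k)).
by rewrite /stage_bound (big_rem x) //= leq_maxl.
Qed.

Definition lim_dim (X : {fset nat}) : nat := geo (S (stage_bound X)) X.

Lemma lim_dimE X k : X `<=` dm k -> lim_dim X = geo (S k) X.
Proof.
move=> Xk; have Xr := sub_stage (leqnn (stage_bound X)).
have [le|/ltnW le] := leqP (stage_bound X) k.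
  by have [_ ag _] := chain_ext le; rewrite ag.
by have [_ ag _] := chain_ext le; rewrite /lim_dim ag.
Qed.

Lemma lim_dim0 : lim_dim fset0 = 0.
Proof. by rewrite /lim_dim dim_fset0. Qed.

Lemma lim_dimU1 X x : lim_dim X <= lim_dim (x |` X) <= (lim_dim X).+1.
Proof.
have sX := sub_stage (leqnn (stage_bound (x |` X))).
rewrite (lim_dimE sX) (lim_dimE (fsubset_trans (fsubsetU1 _ _) sX)).
exact: dim_fsetU1.
Qed.

Lemma lim_submod X Y :
  lim_dim (X `|` Y) + lim_dim (X `&` Y) <= lim_dim X + lim_dim Y.
Proof.
have sU := sub_stage (leqnn (stage_bound (X `|` Y))).
have sX := fsubset_trans (fsubsetUl X Y) sU.
have sY := fsubset_trans (fsubsetUr X Y) sU.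
have sI := fsubset_trans (fsubsetIl X Y) sX.
by rewrite (lim_dimE sU) (lim_dimE sX) (lim_dimE sY) (lim_dimE sI) dim_submod.
Qed.

Definition lim : pregeom nat := Pregeom lim_dim0 lim_dimU1 lim_submod.

Lemma lim_agree k X : X `<=` dm k -> geo (S k) X = lim X.
Proof. by move=> /lim_dimE. Qed.

Lemma lim_fflat k : fflat lim (dm k).
Proof. exact: (agree_fflat (@lim_agree k) (@geo_flat (S k))). Qed.

Lemma lim_fstrong j k : j <= k -> fstrong lim (dm j) (dm k).
Proof.
move=> jk; have [le _ st] := chain_ext jk.
exact: (agree_fstrong (@lim_agree k) (dom_sub le) st).
Qed.

Lemma lim_sqsub k A : A `<=` dm k -> fstrong lim A (dm k) ->
  sqsub lim [set` A]%classic.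
Proof.
move=> Ak sA; apply: sqsub_cofinal => Z; exists (dm (maxn k (stage_bound Z))).
  by apply/sub_stage/leq_maxr.
apply: fstrong_trans Ak _ sA (lim_fstrong (leq_maxl _ _)).
by apply: dom_sub; have [] := chain_ext (leq_maxl k (stage_bound Z)).
Qed.

Lemma lim_sqsub_stage k : sqsub lim [set` dm k]%classic.
Proof. by apply: (@lim_sqsub k) => // SS cSS. Qed.

Lemma lim_fstar_stage k Z : dm k `<=` Z -> fstar lim (dm k) Z.
Proof. by apply: sqsub_fstar; apply: lim_sqsub_stage. Qed.

Lemma lim_fstrong_stage k A : sqsub lim [set` A]%classic -> A `<=` dm k ->
  fstrong lim A (dm k).
Proof. by move=> sA Ak; apply: sqsub_fstrong => // Z; apply: lim_fstar_stage. Qed.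

Lemma fset_enum_val (N : finType) (X : {fset N}) :
  exists Y : {fset 'I_#|N|}, X = (@enum_val N N) @` Y.
Proof.
exists (enum_rank @` X); rewrite -imfset_comp -[LHS]imfset_id.
by apply: eq_imfset => // x /=; rewrite enum_rankK.
Qed.

(** The pregeometry [H] is carried to ['I_n] to become a task, which is handled at
    some stage containing the image of [S0]. *)
Lemma lim_extension (N : finType) (H : pregeom N) (S0 : {fset N}) (a : N -> nat) :
  flat H -> {in S0 &, injective a} -> (forall X, X `<=` S0 -> lim (a @` X) = H X) ->
  sqsub H [set` S0]%classic -> sqsub lim [set` (a @` S0)%fset]%classic ->
  exists f : N -> nat, [/\ embedding H lim f, {in S0, f =1 a} & sqsub lim (range f)].
Proof.
move=> fH ainj adim sH sA; pose n := #|N|; pose v : 'I_n -> N := @enum_val N N.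
have vinj : injective v by apply: enum_val_inj.
have vinjW : {in fullset 'I_n &, injective v} by move=> x y _ _ /vinj.
have some_v (y : N) : exists x, v x = y by exists (enum_rank y); apply: enum_rankK.
have vfull : v @` fullset 'I_n = fullset N.
  apply/fsetP => y; rewrite in_fullset; apply/imfsetP; have [x <-] := some_v y.
  by exists x => //=; apply: in_fullset.
pose H' : pregeom 'I_n := pull (fun x => Some (v x)) H.
have vdim (X : {fset 'I_n}) : X `<=` fullset 'I_n -> H (v @` X) = H' X.
  move=> _; rewrite /H' /=; congr (H _); apply/fsetP => y.
  by apply/imfsetP/pimageP => -[/= z zX e]; exists z => //; [rewrite e|case: e].
have subfull (X : {fset 'I_n}) : X `<=` fullset 'I_n.
  by apply: full_sub; apply: in_fullset.
pose t : {ffun {fset 'I_n} -> nat} := [ffun X => H' X].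
pose g : {ffun 'I_n -> option nat} :=
  [ffun x => if v x \in S0 then Some (a (v x)) else None].
have in_supp x : (x \in supp g) = (v x \in S0).
  by rewrite !inE /= ffunE; case: ifP.
have gvalE x : x \in supp g -> gval g x = a (v x).
  by rewrite in_supp /gval ffunE => ->.
have vsupp : v @` supp g = S0.
  apply/fsetP => y; apply/imfsetP/idP => [[/= x]|yS]; first by rewrite in_supp => h ->.
  by have [x ex] := some_v y; exists x => //=; rewrite in_supp ex.
have gim (X : {fset 'I_n}) : X `<=` supp g -> gval g @` X = a @` (v @` X).
  move=> Xs; rewrite -imfset_comp; apply: eq_in_imfset => // x xX /=.
  by rewrite gvalE // (fsubsetP Xs).
have gA : gval g @` supp g = a @` S0 by rewrite gim // vsupp.
pose tk : task := existT _ n (t, g).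
pose pk (j : nat) : nat := @choice.pickle (nat * task)%type (j, tk).
have pk_inj : injective pk.
  by move=> i j /(pcan_inj (@choice.pickleK (nat * task)%type)) [].
have [j hj] := injective_unbounded pk_inj (stage_bound (a @` S0)).
set k := pk j in hj.
have [e _ perf] := SP k; have {}perf := perf (j, tk) (choice.pickleK _).
have Ak := sub_stage hj.
have dem : demand H' g (S k).
  split.
  - move=> x y xs ys; rewrite !gvalE // => /ainj; rewrite -!in_supp => h.
    exact: vinj (h xs ys).
  - by rewrite gA.
  - move=> X Xs; rewrite lim_agree; last first.
      by apply: fsubset_trans Ak; rewrite -gA; apply: subset_imfset => x; apply: (fsubsetP Xs).
    rewrite gim // adim ?vdim //.
    by rewrite -vsupp (im_sub vinjW) ?subfull.
  split; rewrite ?gA.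
  - apply: (agree_fstrong (fun X Xk => esym (lim_agree Xk)) Ak).
    exact: lim_fstrong_stage.
  - apply/(flat_full H' (@in_fullset _))/(transport_fflat vinjW vdim).
    by rewrite vfull; apply/(flat_full H (@in_fullset _)).
  - apply/(sqsub_full _ _ (@in_fullset _)).
    apply/(transport_fstrong vinjW vdim (subfull _)).
    by rewrite vfull vsupp; apply/(sqsub_full _ _ (@in_fullset _)).
have [f [finj fs fdim fg sf]] := perf H' (fun X => esym (ffunE _ _)) dem.
pose f' y := f (enum_rank y).
have f'im (X : {fset 'I_n}) : f' @` (v @` X) = f @` X.
  by rewrite -imfset_comp; apply: eq_imfset => // x /=; rewrite /f' enum_valK.
exists f'; split.
- split=> [x y /finj/enum_rank_inj //|X]; have [Y ->] := fset_enum_val X.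
  rewrite -[LHS]/(lim (f' @` (v @` Y))) f'im -(lim_agree (k := k.+1)) ?fdim ?vdim //.
  by apply: fsubset_trans fs; apply: subset_imfset => x _; apply: in_fullset.
- move=> y yS; rewrite /f' fg ?gvalE; rewrite ?in_supp /v ?enum_rankK //.
- rewrite set_range -vfull f'im; apply: (lim_sqsub fs).
  by apply: (agree_fstrong (@lim_agree k.+1) fs sf).
Qed.

Lemma lim_generic : generic lim.
Proof.
split.
- exact: countableP.
- move=> A0 /finite_fsetP[A ->] sA {A0}.
  pose H := pull (fun z : A => Some (val z)) lim.
  have vinj : {in fullset A &, injective (val : A -> nat)} by move=> x y _ _ /val_inj.
  have vdim (X : {fset A}) : X `<=` fullset A -> lim (val @` X) = H X.
    move=> _; rewrite /H [RHS]/=; congr (lim _); apply/fsetP => y.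
    by apply/imfsetP/pimageP => -[/= z zX e]; exists z => //; [rewrite e|case: e].
  have vfull : val @` fullset A = A.
    apply/fsetP => y; apply/imfsetP/idP => [[/= z _ ->]|yA]; first exact: valP.
    by exists [` yA] => //; apply: in_fullset.
  exists A, H, val; split.
  + apply/(flat_full H (@in_fullset A))/(transport_fflat vinj vdim); rewrite vfull.
    have Ak := sub_stage (leqnn (stage_bound A)).
    exact: (fflat_narrow Ak (sqsub_fstar sA Ak) (@lim_fflat _)).
  + split; first exact: val_inj.
    by move=> X; apply: vdim; apply: full_sub; apply: in_fullset.
  + by rewrite set_range vfull.
- move=> N H fH; have [||||f [ef _ sf]] := @lim_extension N H fset0 (fun=> 0) fH.
  + by move=> x y.
  + by move=> X; rewrite fsubset0 => /eqP ->; rewrite imfset0 !dim_fset0.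
  + apply/(sqsub_full _ _ (@in_fullset _))/fstrong0.
    exact/(flat_full H (@in_fullset _)).
  + by rewrite imfset0; apply: (@lim_sqsub 0) => //; apply/fstrong0/lim_fflat.
  + by exists f.
- move=> A0 /finite_fsetP[A ->] sA N B i fB [iinj idim] sB {A0}.
  have [W [fullW imW]] := sub_carrier A.
  pose S0 := i @` W.
  pose a y := if pselect (exists u, i u = y) is left e then val (projT1 (cid e)) else 0.
  have ai u : a (i u) = val u.
    rewrite /a; case: pselect => [e|[]]; last by exists u.
    by have := projT2 (cid e) => /= /iinj ->.
  have aim (X : {fset [set` A]%classic}) : a @` (i @` X) = val @` X.
    by rewrite -imfset_comp; apply: eq_imfset => // u /=; rewrite ai.
  have ri : range i = [set` S0]%classic.
    apply/seteqP; split=> y /=; first by move=> [u _ <-]; apply: in_imfset; apply: fullW.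
    by move=> /imfsetP[/= u _ ->]; exists u.
  rewrite ri in sB.
  have [||||f [ef fa sf]] := @lim_extension N B S0 a fB.
  + by move=> _ _ /imfsetP[/= u _ ->] /imfsetP[/= w _ ->]; rewrite !ai => /val_inj ->.
  + by move=> X /(preim)[X' _ ->]; rewrite aim [RHS]idim.
  + exact: sB.
  + by rewrite aim imW.
  + exists f; split=> // u; rewrite fa ?ai //.
    by apply: in_imfset; apply: fullW.
- move=> X0 /finite_fsetP[X ->] {X0}; exists [set` dm (stage_bound X)]%classic.
  split=> //; last exact: lim_sqsub_stage.
  by move=> x /= /(fsubsetP (sub_stage (leqnn (stage_bound X)))).
Qed.
End Limit.

Lemma generic_exists : exists G : pregeom nat, generic G.
Proof. by have [S SP] := chain_exists; exists (lim SP); apply: lim_generic. Qed.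

(** * The theorem *)

Theorem proposition3p2p11 :
  exists tau : nat -> nat,
    [/\ forall n : nat, n <= tau n,
        forall (M : choiceType) (G : pregeom M),
          generic G -> models_T tau (Lstruct_of G)
      & satisfiable_T tau].
Proof.
have [theta thetaP] := choice hull_exists.
have models := generic_models thetaP.
exists (tau theta); split=> [n||]; first exact: leq_addr.
  exact: models.
have [G genG] := generic_exists.
by exists nat, (Lstruct_of G); apply: models.
Qed.
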